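(* Let $(\mathfrak{g},d,[\cdot,\cdot])$ and $(\mathfrak{g}',d',[\cdot,\cdot])$ be DGLAs over $\mathbb{K}$ with complete descending and exhaustive filtrations $\mathcal{F}^\bullet$, and let $F\colon(\mathfrak{g},Q)\to(\mathfrak{g}',Q')$ be an $L_\infty$-morphism compatible with the filtrations. Let $\pi\in\mathcal{F}^1\mathfrak{g}^1$ be a Maurer--Cartan element equivalent to zero via $\pi=\exp([g,\cdot])\triangleright 0$ with $g\in\mathcal{F}^1\mathfrak{g}^0$; put $\lambda(t)=g=\frac{dA(t)}{dt}$, i.e. $A(t)=tg$, so that $A(1)=g$. Let $S=\sum_{n\ge 1}\frac1{n!}F_n(\pi\vee\cdots\vee\pi)\in\mathcal{F}^1(\mathfrak{g}')^1$; then $0$ and $S$ are equivalent Maurer--Cartan elements in $(\mathfrak{g}',d')$. Let this equivalence be implemented by an $A'(t)\in\mathcal{F}^1\widehat{(\mathfrak{g}')^0[t]}$, meaning: there are $\pi'(t)\in\mathcal{F}^1\widehat{(\mathfrak{g}')^1[t]}$ and $\lambda'(t)\in\mathcal{F}^1\widehat{(\mathfrak{g}')^0[t]}$ with $$\frac{d\pi'(t)}{dt}=-d'\lambda'(t)+[\lambda'(t),\pi'(t)],\qquad \pi'(0)=0,\quad \pi'(1)=S,$$ and $A'(t)$ is the solution of $$\lambda'(t)=\frac{\exp([A'(t),\cdot])-\mathrm{id}}{[A'(t),\cdot]}\,\frac{dA'(t)}{dt},\qquad A'(0)=0,$$ so that in particular $S=\exp([A'(1),\cdot])\triangleright 0$.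 Let $F^\pi\colon(\mathfrak{g},d+[\pi,\cdot])\to(\mathfrak{g}',d'+[S,\cdot])$ be the $L_\infty$-morphism $F$ twisted by $\pi$. Then the $L_\infty$-morphisms $F$ and $e^{[-A'(1),\cdot]}\circ F^{\pi}\circ e^{[A(1),\cdot]}$ from $(\mathfrak{g},d)$ to $(\mathfrak{g}',d')$ are homotopic, i.e. they are gauge equivalent Maurer--Cartan elements in the convolution DGLA $\mathrm{Hom}(\overline{\mathrm{Sym}}(\mathfrak{g}[1]),\mathfrak{g}')$.
   Context: $\mathbb{K}$ is a field of characteristic $0$. $L[1]^k=L^{k+1}$. $\overline{\mathrm{Sym}}(L[1])=\bigoplus_{n\ge1}\mathrm{Sym}^n(L[1])$ is the cofree graded cocommutative coalgebra without counit, with coproduct $\overline{\Delta}$ (sum over unshuffles with Koszul signs). An $L_\infty$-algebra $(L,Q)$ is a graded vector space with a degree $+1$ coderivation $Q$ of $\overline{\mathrm{Sym}}(L[1])$, $Q^2=0$, determined by its components $Q_n\colon\mathrm{Sym}^n(L[1])\to L[2]$. An $L_\infty$-morphism is a degree $0$ coalgebra morphism $F$ with $FQ=Q'F$, determined by its components $F_n\colon \mathrm{Sym}^n(L[1])\to L'[1]$. A DGLA is an $L_\infty$-algebra via $Q_1=-d$, $Q_2(\gamma\vee\mu)=-(-1)^{|\gamma|}[\gamma,\mu]$, with $|\gamma|$ the degree in $\mathfrak{g}[1]$, and $Q_n=0$ for $n\geq3$. Filtrations: a complete descending exhaustive filtration on a DGLA satisfies $\mathfrak{g}\cong\varprojlim\mathfrak{g}/\mathcal{F}^n\mathfrak{g}$,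 $\mathfrak{g}=\bigcup_n\mathcal{F}^n\mathfrak{g}$ ($n\in\mathbb{Z}$), $d\mathcal{F}^k\subseteq\mathcal{F}^k$, $[\mathcal{F}^k,\mathcal{F}^\ell]\subseteq\mathcal{F}^{k+\ell}$. $\widehat{\mathfrak{g}[t]}$ is the completion of $\mathfrak{g}\otimes\mathbb{K}[t]$, i.e. the subspace of $\mathfrak{g}[[t]]$ of series that are polynomial in $t$ modulo $\mathcal{F}^n\mathfrak{g}[[t]]$ for all $n$; $\mathcal{F}^1\widehat{\mathfrak{g}[t]}$ is the part with coefficients in $\mathcal{F}^1\mathfrak{g}$. Its elements can be evaluated at every $t\in\mathbb{K}$. Maurer--Cartan elements are $\pi\in\mathcal{F}^1\mathfrak{g}^1$ with $d\pi+\frac12[\pi,\pi]=0$. The gauge action of $g\in\mathcal{F}^1\mathfrak{g}^0$ is $$\exp([g,\cdot])\triangleright\pi=\sum_{n\ge0}\frac{([g,\cdot])^n}{n!}(\pi)-\sum_{n\ge0}\frac{([g,\cdot])^n}{(n+1)!}(dg),$$ and two Maurer--Cartan elements are gauge equivalent if they lie in the same orbit. The expression $\frac{\exp([a,\cdot])-\mathrm{id}}{[a,\cdot]}$ denotes $\sum_{n\ge0}\frac{([a,\cdot])^n}{(n+1)!}$. Two Maurer--Cartan elements $\pi_0,\pi_1$ are homotopy equivalent if they are related by the transitive closure of the relation: there are $\pi(t)\in\mathcal{F}^1\widehat{\mathfrak{g}^1[t]}$, $\lambda(t)\in\mathcal{F}^1\widehat{\mathfrak{g}^0[t]}$ with $\frac{d}{dt}\pi(t)=-d\lambda(t)+[\lambda(t),\pi(t)]$,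 $\pi(0)=\pi_0$, $\pi(1)=\pi_1$. For DGLAs with complete filtrations, homotopy equivalence and gauge equivalence coincide. Twisting: $F^\pi$ has components $F^\pi_n(x_1,\dots,x_n)=\sum_{k\ge0}\frac1{k!}F_{n+k}(\pi,\dots,\pi,x_1,\dots,x_n)$. The maps $e^{[A(1),\cdot]}\colon(\mathfrak{g},d)\to(\mathfrak{g},d+[\pi,\cdot])$ and $e^{[A'(1),\cdot]}\colon(\mathfrak{g}',d')\to(\mathfrak{g}',d'+[S,\cdot])$ are DGLA isomorphisms. Convolution DGLA: $\mathfrak{h}=\mathrm{Hom}(\overline{\mathrm{Sym}}(\mathfrak{g}[1]),\mathfrak{g}')$ (graded linear maps compatible with the filtrations) with differential $\partial F=d'\circ F+(-1)^{|F|}F\circ Q$ and bracket $[F,G]=-(-1)^{|F|}Q'_2\circ(F\otimes G)\circ\overline{\Delta}$, $|F|$ being the degree in $\mathfrak{h}[1]$. $L_\infty$-morphisms are identified, via their components, with Maurer--Cartan elements of $\mathfrak{h}$, and two $L_\infty$-morphisms are called homotopic if they are homotopy equivalent Maurer--Cartan elements of $\mathfrak{h}$. Here $\mathfrak{h}$ carries the complete descending filtration $$\mathfrak{F}^k\mathfrak{h}=\sum_{n+m=k}\{f\in\mathfrak{h}\mid f|_{\mathrm{Sym}^{<n}(\mathfrak{g}[1])}=0\ \text{and}\ f\colon\mathcal{F}^\bullet\to\mathcal{F}^{\bullet+m}\},$$ with the product filtration on $\overline{\mathrm{Sym}}(\mathfrak{g}[1])$; one has $\mathfrak{F}^1\mathfrak{h}=\mathfrak{h}$.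 Gauge equivalence in $\mathfrak{h}$ is via elements of $\mathfrak{h}^0$.
   Formalization: The path (π',λ') implementing the equivalence of 0 and S is required to be the one induced by F: π'(t)=Σ F_n(π(t),…,π(t))/n!, λ'(t)=F^{π(t)}_1(g), with π(t)=exp([tg,·])▷0; for an arbitrary path the claim is false (F=id, g=0, d=0, Heisenberg algebra in degree 0, λ'=b). *)

(* Defs.v *)
From HB Require Import structures.
From mathcomp Require Import all_boot all_order all_algebra.
From mathcomp Require Import boolp classical_sets functions.
From Stdlib Require Import Relation_Operators.

Set Implicit Arguments.
Unset Strict Implicit.
Unset Printing Implicit Defensive.

Import GRing.Theory.
Local Open Scope classical_set_scope.
Local Open Scope ring_scope.

Definition ksign (K : fieldType) (i : int) : K := (-1) ^+ absz i.

(** * Filtered differential graded Lie algebras *)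

(* A graded vector space is a family [gr i] of subspaces of an ambient module;
   only the subspaces [gr i] carry meaning.  The operations take the degrees of
   their arguments: [dif i x] is the differential of [x] in degree [i], and
   [br i j x y] is the bracket of [x] in degree [i] with [y] in degree [j].
   [fil n] restricted to [gr i] is the [n]-th filtration step in degree [i]. *)
Record fdgla_data (K : fieldType) := FdglaData {
  carrier :> lmodType K ;
  gr : int -> set carrier ;
  dif : int -> carrier -> carrier ;
  br : int -> int -> carrier -> carrier -> carrier ;
  fil : int -> set carrier }.

Arguments gr {K} D i : rename.
Arguments dif {K} D i : rename.
Arguments br {K} D i j : rename.
Arguments fil {K} D n : rename.

Definition is_subspace (K : fieldType) (V : lmodType K) (A : set V) : Prop :=
  A 0 /\ forall (a : K) x y, A x -> A y -> A (a *: x + y).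

Record is_fdgla (K : fieldType) (D : fdgla_data K) : Prop := IsFdgla {
  gr_subspace : forall i, is_subspace (gr D i) ;
  dif_gr : forall i x, gr D i x -> gr D (i + 1) (dif D i x) ;
  dif_linear : forall i (a : K) x y, gr D i x -> gr D i y ->
    dif D i (a *: x + y) = a *: dif D i x + dif D i y ;
  dif_dif : forall i x, gr D i x -> dif D (i + 1) (dif D i x) = 0 ;
  br_gr : forall i j x y,
    gr D i x -> gr D j y -> gr D (i + j) (br D i j x y) ;
  br_linear : forall i j (a : K) x y z, gr D i x -> gr D j y -> gr D j z ->
    br D i j x (a *: y + z) = a *: br D i j x y + br D i j x z ;
  br_antisym : forall i j x y, gr D i x -> gr D j y ->
    br D i j x y = - (ksign K (i * j) *: br D j i y x) ;
  br_jacobi : forall i j k x y z, gr D i x -> gr D j y -> gr D k z ->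
    br D i (j + k) x (br D j k y z) =
      br D (i + j) k (br D i j x y) z
      + ksign K (i * j) *: br D j (i + k) y (br D i k x z) ;
  dif_br : forall i j x y, gr D i x -> gr D j y ->
    dif D (i + j) (br D i j x y) =
      br D (i + 1) j (dif D i x) y
      + ksign K i *: br D i (j + 1) x (dif D j y) ;
  fil_subspace : forall n, is_subspace (fil D n) ;
  fil_descending : forall n m, (n <= m)%R -> fil D m `<=` fil D n ;
  fil_exhaustive : forall i x, gr D i x -> exists n, fil D n x ;
  (* injectivity and surjectivity of g^i -> lim g^i / F^n g^i *)
  fil_separated : forall i x, gr D i x -> (forall n, fil D n x) -> x = 0 ;
  fil_complete : forall i (u : int -> D), (forall n, gr D i (u n)) ->
    (forall n, fil D n (u (n + 1) - u n)) ->
    exists2 x, gr D i x & forall n, fil D n (x - u n) ;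
  fil_dif : forall n i x, gr D i x -> fil D n x -> fil D n (dif D i x) ;
  fil_br : forall n m i j x y, gr D i x -> gr D j y ->
    fil D n x -> fil D m y -> fil D (n + m) (br D i j x y) }.

Record fdgla (K : fieldType) := Fdgla {
  fdata :> fdgla_data K ;
  fdgla_axioms : is_fdgla fdata }.

(** * Infinite sums, gauge action, Maurer-Cartan elements *)

Section Sums.
Variables (K : fieldType) (D : fdgla_data K).
Implicit Types (u : nat -> D) (a x y s : D).

Definition fil_sum u s : Prop :=
  forall n : int, exists N : nat, forall m : nat, (N <= m)%N ->
    fil D n (s - \sum_(j < m) u j).

(* The sum in [gr i] of the series [u]; the value is 0 when the series does
   not converge. *)
Definition gsum (i : int) u : D := xget 0 [set s | gr D i s /\ fil_sum u s].

(* exp([a,.]) x and ((exp([a,.]) - id) / [a,.]) x, for [a] of degree 0 and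
   [x] of degree [i] *)
Definition exp_ad (i : int) a x : D :=
  gsum i (fun n => (n`!%:R : K)^-1 *: iter n (br D 0 i a) x).

Definition dexp_ad (i : int) a x : D :=
  gsum i (fun n => ((n.+1)`!%:R : K)^-1 *: iter n (br D 0 i a) x).

Definition gauge_act a x : D := exp_ad 1 a x - dexp_ad 1 a (dif D 0 a).

Record maurer_cartan x : Prop := MaurerCartan {
  mc_gr : gr D 1 x ;
  mc_fil : fil D 1 x ;
  mc_eq : dif D 1 x + (2%:R : K)^-1 *: br D 1 1 x x = 0 }.

Definition gauge_equivalent x y : Prop :=
  [/\ maurer_cartan x, maurer_cartan y &
      exists a, [/\ gr D 0 a, fil D 1 a & gauge_act a x = y]].

End Sums.

(** * Power series in t that are polynomial modulo each filtration step *)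

Section Series.
Variables (K : fieldType) (D : fdgla_data K).

(* The completion of D (x) K[t]; a series is the sequence of its coefficients. *)
Definition tseries : fdgla_data K := {|
  carrier := (nat -> D : lmodType K) ;
  gr := fun i => [set p : nat -> D | (forall k, gr D i (p k)) /\
          forall n, exists N : nat, forall k : nat, (N <= k)%N -> fil D n (p k)] ;
  dif := fun i p k => dif D i (p k) ;
  br := fun i j p q k => \sum_(l < k.+1) br D i j (p l) (q (k - l)%N) ;
  fil := fun n => [set p : nat -> D | forall k, fil D n (p k)] |}.

Definition tder (p : tseries) : tseries := fun k => p k.+1 *+ k.+1.

Definition teval (i : int) (p : tseries) (t : K) : D :=
  gsum i (fun k => t ^+ k *: p k).

Definition homotopy_path (p l : tseries) (x y : D) : Prop :=
  [/\ gr tseries 1 p /\ fil tseries 1 p,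
      gr tseries 0 l /\ fil tseries 1 l,
      tder p = - dif tseries 0 l + br tseries 0 1 l p,
      teval 1 p 0 = x & teval 1 p 1 = y].

Definition homotopic_step (x y : D) : Prop :=
  [/\ maurer_cartan x, maurer_cartan y & exists p l, homotopy_path p l x y].

Definition homotopy_equivalent : D -> D -> Prop := clos_trans D homotopic_step.

End Series.

(** * Homogeneous elements and unshuffles *)

Record hel (K : fieldType) (D : fdgla_data K) := Hel {
  hdeg : int ;
  hval : D ;
  hgr : gr D hdeg hval }.

Section Closure.
Variables (K : fieldType) (g : fdgla K).

Lemma gr0 i : gr g i 0.
Proof. by case: (gr_subspace (fdgla_axioms g) i). Qed.

Lemma grZ i (a : K) x : gr g i x -> gr g i (a *: x).
Proof.
case: (gr_subspace (fdgla_axioms g) i) => h0 h hx.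
by rewrite -[a *: x]addr0; apply: h.
Qed.

Lemma grN i x : gr g i x -> gr g i (- x).
Proof. by move=> hx; rewrite -scaleN1r; apply: grZ. Qed.

Lemma grB i x y : gr g i x -> gr g i y -> gr g i (x - y).
Proof.
case: (gr_subspace (fdgla_axioms g) i) => _ h hx hy.
by rewrite -[x]scale1r; apply: h => //; apply: grN.
Qed.

Lemma gsum_gr i (u : nat -> g) : gr g i (gsum i u).
Proof.
rewrite /gsum; case: xgetP => [s _ []//|_]; exact: gr0.
Qed.

Lemma gauge_act_gr (a x : g) : gr g 1 (gauge_act a x).
Proof. by apply: grB; apply: gsum_gr. Qed.

End Closure.

Section Coalgebra.
Variables (K : fieldType) (g : fdgla K).
Implicit Types (x y : hel g) (s : seq (hel g)) (m : bitseq).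

(* degree in g[1] *)
Definition sdeg x : int := hdeg x - 1.
Definition sdegs s : int := \sum_(x <- s) sdeg x.

Definition unsel m s := mask (map negb m) s.

(* A mask [m] on [s] is an unshuffle: the selected elements, in order, followed
   by the others, in order.  [koszul m s] is its Koszul sign, for the degrees in
   g[1]: each unselected element moves past the selected ones to its right. *)
Fixpoint koszul m s : K :=
  match m, s with
  | b :: m', x :: s' =>
      (if b then 1 else ksign K (sdeg x * sdegs (mask m' s'))) * koszul m' s'
  | _, _ => 1
  end.

Lemma Q1_subproof x : gr g (hdeg x + 1) (- dif g (hdeg x) (hval x)).
Proof. apply: grN; exact: (dif_gr (fdgla_axioms g) (hgr x)). Qed.
Definition Q1 x : hel g := Hel (Q1_subproof x).

Lemma Q2_subproof x y : gr g (hdeg x + hdeg y)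
  (- (ksign K (sdeg x) *: br g (hdeg x) (hdeg y) (hval x) (hval y))).
Proof.
apply: grN; apply: grZ; exact: (br_gr (fdgla_axioms g) (hgr x) (hgr y)).
Qed.
Definition Q2 x y : hel g := Hel (Q2_subproof x y).

(* F o Q on x_1 v ... v x_n, where the coderivation Q sends x_1 v ... v x_n to
   the sum over unshuffles of +- Q_k(selected) v (unselected). *)
Definition comp_coder (V : lmodType K) (F : seq (hel g) -> V) s : V :=
  \sum_(m : (size s).-tuple bool)
    koszul m s *: match mask m s with
                  | [:: x] => F (Q1 x :: unsel m s)
                  | [:: x; y] => F (Q2 x y :: unsel m s)
                  | _ => 0
                  end.

(* the sum over the terms of the reduced coproduct of x_1 v ... v x_n *)
Definition coprod_sum (V : lmodType K) (B : seq (hel g) -> seq (hel g) -> V) s : V :=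
  \sum_(m : (size s).-tuple bool | (true \in m) && (false \in m))
    koszul m s *: B (mask m s) (unsel m s).

End Coalgebra.

(** * The convolution DGLA Hom(Sym(g[1]), g') *)

Section Convolution.
Variables (K : fieldType) (g g' : fdgla K).

(* A linear map on the direct sum of the Sym^n(g[1]), n >= 1, is given by its
   values on products of homogeneous elements; the value on x_1 v ... v x_n is
   the value at the list [:: x_1; ...; x_n]. *)
Definition cochain := seq (hel g) -> g'.
Implicit Types F G : cochain.

Definition multilinear F : Prop :=
  forall (s1 s2 : seq (hel g)) (x y z : hel g) (a : K),
    hdeg x = hdeg z -> hdeg y = hdeg z -> hval z = a *: hval x + hval y ->
    F (s1 ++ z :: s2) = a *: F (s1 ++ x :: s2) + F (s1 ++ y :: s2).

Definition graded_symmetric F : Prop :=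
  forall (s1 s2 : seq (hel g)) (x y : hel g),
    F (s1 ++ x :: y :: s2) =
      ksign K (sdeg x * sdeg y) *: F (s1 ++ y :: x :: s2).

(* F maps the p-th step of the product filtration to the (p + m)-th step *)
Definition fil_shift (m : int) F : Prop :=
  forall (s : seq (hel g)) (p : 'I_(size s) -> int),
    (forall i, fil g (p i) (hval (tnth (in_tuple s) i))) ->
    fil g' (\sum_i p i + m) (F s).

(* the degree k part of Hom(Sym(g[1]), g') *)
Record hom_gr (k : int) F : Prop := HomGr {
  hom_reduced : F [::] = 0 ;
  hom_multilinear : multilinear F ;
  hom_symmetric : graded_symmetric F ;
  hom_deg : forall s, gr g' (sdegs s + k) (F s) ;
  hom_fil : fil_shift 0 F }.

Definition hom_fil_piece (n : nat) (m : int) F : Prop :=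
  [/\ exists k, hom_gr k F, forall s, (size s < n)%N -> F s = 0 &
      fil_shift m F].

(* Q'_1 and Q'_2 on elements of degrees i, j in g' *)
Definition Q1' (i : int) (x : g') : g' := - dif g' i x.
Definition Q2' (i j : int) (x y : g') : g' :=
  - (ksign K (i - 1) *: br g' i j x y).

(* Q'_2 o (F (x) G) o coproduct, for F and G of degrees k and l (so of degrees
   k - 1 and l - 1 as maps to g'[1]) *)
Definition cup (k l : int) F G : cochain := fun s =>
  coprod_sum (fun s1 s2 =>
    ksign K ((l - 1) * sdegs s1)
      *: Q2' (sdegs s1 + k) (sdegs s2 + l) (F s1) (G s2)) s.

Definition conv : fdgla_data K := {|
  carrier := (cochain : lmodType K) ;
  gr := hom_gr ;
  dif := fun k F s =>
    dif g' (sdegs s + k) (F s) + ksign K (k - 1) *: comp_coder F s ;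
  br := fun k l F G s => - (ksign K (k - 1) *: cup k l F G s) ;
  fil := fun n => [set F : cochain | exists (N : nat) (f : 'I_N -> cochain),
    F = \sum_i f i /\
    forall i, exists (p : nat) (m : int), p%:Z + m = n /\ hom_fil_piece p m (f i)] |}.

(** * L-infinity morphisms *)

(* Filtered L-infinity morphisms, given by their components
   F_n : Sym^n(g[1]) -> g'[1] of degree 0.  The last clause is F Q = Q' F
   corestricted to the cogenerators g'[1]; both sides are coderivations along F,
   hence determined by this corestriction. *)
Definition Linfty_morphism F : Prop :=
  hom_gr 1 F /\
  forall s, comp_coder F s =
    Q1' (sdegs s + 1) (F s) + (2%:R : K)^-1 *: cup 1 1 F F s.

(* sum_(n >= 1) F_n(x, ..., x) / n! *)
Definition mc_image F (x : hel g) : g' :=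
  gsum 1 (fun n => ((n.+1)`!%:R : K)^-1 *: F (nseq n.+1 x)).

Definition twist F (x : hel g) : cochain := fun s =>
  if s is [::] then 0 else
  gsum (sdegs s + 1) (fun k => (k`!%:R : K)^-1 *: F (nseq k x ++ s)).

(* For [a] in F^1 g^0, the image under F of the path t |-> exp([t a, .]) |> 0 with
   constant generator [a]: the series [p] and [l] satisfy
     p(t) = sum_(n >= 1) F_n(pi(t), ..., pi(t)) / n!,
     l(t) = sum_(n >= 0) F_(n+1)(a, pi(t), ..., pi(t)) / n!
   with pi(t) = exp([t a, .]) |> 0.  A path from 0 to S does not determine the
   homotopy class of exp(-[A'(1), .]) o F: for a Lie
   algebra g = g' in degree 0, p = 0 and any constant l = b, the identity is
   not homotopic to exp(-[b, .]) unless they are equal. *)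
Definition induced_path F (a : g) (ha : gr g 0 a) (p l : tseries g') : Prop :=
  forall t : K,
    let pi_t : hel g := Hel (gauge_act_gr (t *: a) 0) in
    teval 1 p t = mc_image F pi_t /\ teval 0 l t = twist F pi_t [:: Hel ha].

Definition exp_hel (a : g) (x : hel g) : hel g :=
  Hel (gsum_gr (hdeg x)
    (fun n => (n`!%:R : K)^-1 *: iter n (br g 0 (hdeg x) a) (hval x))).

(* exp([b,.]) o F o exp([a,.]), for F of degree 1 *)
Definition exp_conj (b : g') F (a : g) : cochain := fun s =>
  exp_ad (sdegs s + 1) b (F (map (exp_hel a) s)).

End Convolution.

(* Main.v *)
Require Import Defs.
From HB Require Import structures.
From mathcomp Require Import all_boot all_order all_algebra.
From mathcomp Require Import boolp classical_sets functions.
From mathcomp Require Import ring zify.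

Set Implicit Arguments.
Unset Strict Implicit.
Unset Printing Implicit Defensive.

Import GRing.Theory.
Local Open Scope classical_set_scope.
Local Open Scope ring_scope.

(** The L-infinity morphisms F and F' = exp(-[A'(1), .]) o F^pi o exp([a, .]) are
    joined by the path F(t) = exp(-[A'(t), .]) o F^(pi(t)) o exp([t a, .]) with
    pi(t) = exp([t a, .]) |> 0, and the proof exhibits a generator of this path.

    The idea is that F^(pi(t)) o exp([t a, .]) is the pull-back of F by the affine
    substitution x |-> pi(t) + exp([t a, .]) x.  These substitutions form the flow
    of the affine field -da + [a, .], whose coderivation is the commutator of the
    coderivation Q with the contraction by a ([lie_Qco], [flow_twist]).  A
    commutator with Q is an inner direction of the gauge action: when F satisfies
    the Maurer-Cartan equation, the flow G(t) of F satisfies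
    G' = -d L + [L, G] with L(t) = G(t)(a, ...) ([flow_series_flow]).

    Contraction with a leaves the space of reduced cochains, because G(t) and L(t)
    have constant terms: L(t) starts with lam'(t) = F^(pi(t))(a).  So the argument
    takes place in a larger DGLA [uconv], the cochains with a constant term; it
    contains the 0-th filtration step of g' as the constants, and the gauge
    transformation by the constants exp(-A'(t)) removes the constant term lam' of
    the generator ([flow_transform]), since lam' is the logarithmic derivative of exp(A').  The constant term of the
    transformed path then vanishes as well: that of G(t) solves the path equation
    in g' with generator lam', so it is exp(A'(t)) |> 0 ([flow_gauge]).  What
    remains is a homotopy of reduced cochains from F to F'.

    Gauge equivalence follows from the homotopy in any complete filtered DGLA
    ([homotopic_gauge]): the generator is the logarithmic derivative of some
    exp(A(t)), by a contraction argument for the filtration, and a path with this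
    generator is the orbit of its starting point under exp(A(t)).

    Two proof patterns recur.  An identity between power series is proved
    coefficient by coefficient, differentiation (K has characteristic 0) reducing
    each order to the preceding one.  An identity between cochains, such as the
    Jacobi identity or the Leibniz rule for Q, is proved by induction on the list
    of arguments for all cochains at once: contraction with the first argument satisfies
    Leibniz rules for the bracket and for the composition with coderivations, and
    only the empty list is left to check.  This replaces the combinatorics of
    unshuffles and of their Koszul signs. *)

(** * Linear identities in a module *)

(** The square-zero extension K + V: through the embedding of V as an ideal,
    linear identities in V become polynomial ones, within reach of [ring]. *)
Definition sqz (K : fieldType) (V : lmodType K) : Type := (K * V)%type.

Section SquareZero.
Variables (K : fieldType) (V : lmodType K).

HB.instance Definition _ := GRing.Zmodule.on (sqz V).

Definition sqz_one : sqz V := (1, 0).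
Definition sqz_mul (x y : sqz V) : sqz V :=
  (x.1 * y.1, x.1 *: y.2 + y.1 *: x.2).

Fact sqz_mulA : associative sqz_mul.
Proof.
move=> [a u] [b v] [c w]; congr (_, _) => /=; first by rewrite mulrA.
by rewrite !scalerDr !scalerA addrA (mulrC c a) (mulrC c b).
Qed.

Fact sqz_mulC : commutative sqz_mul.
Proof. by move=> [a u] [b v]; congr (_, _) => /=; rewrite 1?mulrC 1?addrC. Qed.

Fact sqz_mul1 : left_id sqz_one sqz_mul.
Proof.
by move=> [a u]; congr (_, _) => /=; rewrite ?mul1r // scale1r scaler0 addr0.
Qed.

Fact sqz_mulD : left_distributive sqz_mul +%R.
Proof.
move=> [a u] [b v] [c w]; congr (_, _) => /=; first by rewrite mulrDl.
by rewrite scalerDl scalerDr addrACA.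
Qed.

HB.instance Definition _ := GRing.Zmodule_isComPzRing.Build (sqz V)
  sqz_mulA sqz_mulC sqz_mul1 sqz_mulD.

Definition sqz_vec (v : V) : sqz V := (0, v).
Definition sqz_scal (a : K) : sqz V := (a, 0).

Fact sqz_scal_zmod : zmod_morphism sqz_scal.
Proof. by move=> a b; congr (_, _); rewrite subr0. Qed.
Fact sqz_scal_monoid : monoid_morphism sqz_scal.
Proof. by split=> // a b; congr (_, _); rewrite /= !scaler0 addr0. Qed.

HB.instance Definition _ := GRing.isZmodMorphism.Build K (sqz V) sqz_scal
  sqz_scal_zmod.
HB.instance Definition _ := GRing.isMonoidMorphism.Build K (sqz V) sqz_scal
  sqz_scal_monoid.

Lemma sqz_inj u v : sqz_vec u = sqz_vec v -> u = v. Proof. by case. Qed.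
Lemma sqz0 : sqz_vec 0 = 0. Proof. by []. Qed.
Lemma sqzD u v : sqz_vec (u + v) = sqz_vec u + sqz_vec v.
Proof. by congr (_, _); rewrite addr0. Qed.
Lemma sqzN u : sqz_vec (- u) = - sqz_vec u.
Proof. by congr (_, _); rewrite oppr0. Qed.
Lemma sqzZ a u : sqz_vec (a *: u) = sqz_scal a * sqz_vec u.
Proof. by congr (_, _); rewrite /= ?mulr0 // scale0r addr0. Qed.
Lemma sqzMn u n : sqz_vec (u *+ n) = sqz_vec u *+ n.
Proof. by elim: n => // n IH; rewrite !mulrS sqzD IH. Qed.
Definition sqzE := (sqzD, sqzN, sqzZ, sqzMn, sqz0).
End SquareZero.

Ltac lmod := apply: sqz_inj; rewrite ?sqzE; ring.


(** * Convergent sums in a filtered DGLA *)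

Section Closure.
Variables (K : fieldType) (D : fdgla K).
Implicit Types (x y : D) (i n m : int).

Lemma grD i x y : gr D i x -> gr D i y -> gr D i (x + y).
Proof. by move=> hx hy; rewrite -[y]opprK; apply: grB => //; apply: grN. Qed.

Lemma gr_sum i (I : Type) (r : seq I) (P : pred I) (f : I -> D) :
  (forall j, P j -> gr D i (f j)) -> gr D i (\sum_(j <- r | P j) f j).
Proof. by move=> h; apply: big_ind => //; [apply: gr0 | apply: grD]. Qed.

Lemma grMn i x k : gr D i x -> gr D i (x *+ k).
Proof. by move=> h; rewrite -scaler_nat; apply: grZ. Qed.

Lemma fil0 n : fil D n 0.
Proof. exact: (proj1 (fil_subspace (fdgla_axioms D) n)). Qed.

Lemma filZ n (a : K) x : fil D n x -> fil D n (a *: x).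
Proof.
case: (fil_subspace (fdgla_axioms D) n) => h0 h hx.
by rewrite -[a *: x]addr0; apply: h.
Qed.

Lemma filN n x : fil D n x -> fil D n (- x).
Proof. by move=> h; rewrite -scaleN1r; apply: filZ. Qed.

Lemma filD n x y : fil D n x -> fil D n y -> fil D n (x + y).
Proof.
case: (fil_subspace (fdgla_axioms D) n) => h0 h hx hy.
by rewrite -[x]scale1r; apply: h.
Qed.

Lemma filB n x y : fil D n x -> fil D n y -> fil D n (x - y).
Proof. by move=> hx hy; apply: filD => //; apply: filN. Qed.

Lemma fil_bigsum n (I : Type) (r : seq I) (P : pred I) (f : I -> D) :
  (forall j, P j -> fil D n (f j)) -> fil D n (\sum_(j <- r | P j) f j).
Proof. by move=> h; apply: big_ind => //; [apply: fil0 | apply: filD]. Qed.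

Lemma filMn n x k : fil D n x -> fil D n (x *+ k).
Proof. by move=> h; rewrite -scaler_nat; apply: filZ. Qed.

Lemma fil_le n m x : n <= m -> fil D m x -> fil D n x.
Proof. by move=> h; apply: (fil_descending (fdgla_axioms D)). Qed.

Lemma fil_eq i x y : gr D i x -> gr D i y ->
  (forall n, fil D n (x - y)) -> x = y.
Proof.
move=> hx hy h; apply: subr0_eq.
by apply: (fil_separated (fdgla_axioms D) (grB hx hy)).
Qed.

End Closure.

Section Summable.
Variables (K : fieldType) (D : fdgla K).
Implicit Types (x y : D) (i n m : int) (u v : nat -> D).

Definition null u := forall n, exists N : nat, forall k, (N <= k)%N -> fil D n (u k).

Definition summable i u := (forall k, gr D i (u k)) /\ null u.

Lemma sum_tail n N u p q : (forall k, (N <= k)%N -> fil D n (u k)) ->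
  (N <= p)%N -> (N <= q)%N -> fil D n (\sum_(k < p) u k - \sum_(k < q) u k).
Proof.
move=> h; wlog le_qp : p q / (q <= p)%N.
  move=> H hp hq; case/orP: (leq_total q p) => le; first exact: H.
  by rewrite -opprB; apply: filN; apply: H.
move=> hp hq; rewrite -[p](subnKC le_qp) big_split_ord /= addrAC subrr add0r.
by apply: fil_bigsum => j _; apply: h; apply: leq_trans hq _; apply: leq_addr.
Qed.

(** Completeness speaks of sequences indexed by filtration steps: the n-th term is
    the partial sum up to an order beyond which all terms lie in step n. *)
Lemma summable_sum i u : summable i u -> exists2 s, gr D i s & fil_sum u s.
Proof.
move=> [gu nu]; have [N hN] := choice nu.
have [s gs hs] : exists2 s, gr D i s &
    forall n, fil D n (s - \sum_(k < N n) u k).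
  apply: (fil_complete (fdgla_axioms D)) => [n|n].
    by apply: gr_sum => k _.
  case/orP: (leq_total (N n) (N (n + 1))) => le.
    exact: (sum_tail (hN n)).
  by apply: (@fil_le _ D n (n + 1)); [lia | apply: (sum_tail (hN (n + 1)))].
exists s => // n; exists (N n) => m le_m.
rewrite -(subrK (\sum_(k < N n) u k) s) -addrA.
by apply: filD => //; apply: (sum_tail (hN n)).
Qed.

Lemma fil_sum_uniq i u x y : gr D i x -> gr D i y ->
  fil_sum u x -> fil_sum u y -> x = y.
Proof.
move=> gx gy hx hy; apply: (fil_eq gx gy) => n.
have [N hN] := hx n; have [M hM] := hy n.
rewrite -(subrK (\sum_(k < maxn N M) u k) x) -addrA; apply: filD.
  by apply: hN; apply: leq_maxl.
by rewrite -opprB; apply: filN; apply: hM; apply: leq_maxr.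
Qed.

Lemma gsum_uniq i u x : gr D i x -> fil_sum u x -> gsum i u = x.
Proof.
move=> gx hx; rewrite /gsum; case: xgetP => [s _ [gs hs]|h].
  exact: (fil_sum_uniq gs gx).
by case: (h x).
Qed.

Lemma gsumP i u : summable i u -> fil_sum u (gsum i u).
Proof. by case/summable_sum => s gs hs; rewrite (gsum_uniq gs hs). Qed.

Lemma gsum_tail i u n N : summable i u ->
  (forall k, (N <= k)%N -> fil D n (u k)) ->
  fil D n (gsum i u - \sum_(k < N) u k).
Proof.
move=> su hu; have [M hM] := gsumP su n.
rewrite -(subrK (\sum_(k < maxn M N) u k) (gsum i u)) -addrA; apply: filD.
  by apply: hM; apply: leq_maxl.
by apply: (sum_tail hu); rewrite ?leq_maxr.
Qed.

Lemma gsum_fil i u n : summable i u -> (forall k, fil D n (u k)) ->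
  fil D n (gsum i u).
Proof.
move=> su hu; have := @gsum_tail i u n 0 su (fun k _ => hu k).
by rewrite big_ord0 subr0.
Qed.

Lemma eq_gsum i u v : u =1 v -> gsum i u = gsum i v.
Proof. by move=> h; congr gsum; apply: funext. Qed.

Lemma gsum_fin i u N : (forall k, gr D i (u k)) ->
  (forall k, (N <= k)%N -> u k = 0) -> gsum i u = \sum_(k < N) u k.
Proof.
move=> gu h; apply: gsum_uniq => [|n]; first by apply: gr_sum.
exists N => m le; rewrite -opprB; apply: filN; rewrite -(subnKC le).
rewrite big_split_ord /= addrAC subrr add0r big1 => [|k _]; first exact: fil0.
by rewrite h ?leq_addr.
Qed.

Lemma gsum1 i x : gr D i x -> gsum i (fun k => if k is 0%N then x else 0) = x.
Proof.
move=> gx; rewrite (@gsum_fin _ _ 1) ?big_ord1 // => [[|k]|[|k]] //.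
exact: gr0.
Qed.

Lemma gsum0 i : gsum i (fun=> 0 : D) = 0.
Proof.
rewrite (@gsum_fin _ _ 0) ?big_ord0 // => k; exact: gr0.
Qed.

Lemma summable_shift i u c : (forall k, gr D i (u k)) ->
  (forall k, fil D (k%:Z + c) (u k)) -> summable i u.
Proof.
move=> gu fu; split=> // n; exists (absz (n - c)) => k le.
by apply: (fil_le _ (fu k)); lia.
Qed.

Lemma gsum_head i u : summable i u -> gsum i u = u 0%N + gsum i (u \o S).
Proof.
move=> su; have su' : summable i (u \o S).
  case: su => gu nu; split=> [k|n]; first exact: gu.
  have [N hN] := nu n; exists N => k le; exact: hN (leqW le).
apply: gsum_uniq => [|n].
  by apply: grD; [case: su | apply: gsum_gr].
have [N hN] := gsumP su' n; exists N.+1 => -[//|m] le.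
by rewrite big_ord_recl opprD addrACA subrr add0r; apply: hN.
Qed.

End Summable.

(** Graded linear maps that shift the filtration by a bounded amount: these are
    the operations that commute with infinite sums. *)
Record gmap (K : fieldType) (D E : fdgla K) (i j : int) (f : D -> E) : Prop :=
  Gmap {
  gmap_gr : forall x, gr D i x -> gr E j (f x) ;
  gmap_lin : forall (a : K) x y, gr D i x -> gr D i y ->
    f (a *: x + y) = a *: f x + f y ;
  gmap_fil : exists c, forall n x, gr D i x -> fil D n x -> fil E (n + c) (f x) }.

Section Gmap.
Variables (K : fieldType) (D E : fdgla K) (i j : int) (f : D -> E).
Hypothesis fP : gmap i j f.

Lemma gmap0 : f 0 = 0.
Proof.
have := gmap_lin fP 1 (gr0 D i) (gr0 D i).
by rewrite scaler0 addr0 scale1r => /(congr1 (fun z => z - f 0)); rewrite subrr addrK.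
Qed.

Lemma gmapZ a x : gr D i x -> f (a *: x) = a *: f x.
Proof.
by move=> gx; have := gmap_lin fP a gx (gr0 D i); rewrite !addr0 gmap0 addr0.
Qed.

Lemma gmapD x y : gr D i x -> gr D i y -> f (x + y) = f x + f y.
Proof. by move=> gx gy; have := gmap_lin fP 1 gx gy; rewrite !scale1r. Qed.

Lemma gmapN x : gr D i x -> f (- x) = - f x.
Proof. by move=> gx; rewrite -scaleN1r gmapZ // scaleN1r. Qed.

Lemma gmapB x y : gr D i x -> gr D i y -> f (x - y) = f x - f y.
Proof. by move=> gx gy; rewrite gmapD ?gmapN //; apply: grN. Qed.

Lemma gmapMn x k : gr D i x -> f (x *+ k) = f x *+ k.
Proof. by move=> gx; rewrite -!scaler_nat gmapZ. Qed.

Lemma gmap_sum (I : Type) (r : seq I) (P : pred I) (F : I -> D) :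
  (forall k, P k -> gr D i (F k)) ->
  f (\sum_(k <- r | P k) F k) = \sum_(k <- r | P k) f (F k).
Proof.
move=> h; suff [] : gr D i (\sum_(k <- r | P k) F k) /\
  f (\sum_(k <- r | P k) F k) = \sum_(k <- r | P k) f (F k) by [].
elim/big_rec2: _ => [|k y x Pk [gx <-]]; first by split; [apply: gr0 | apply: gmap0].
by split; [apply: grD => //; apply: h | rewrite gmapD //; apply: h].
Qed.

Lemma gmap_summable u : summable i u -> summable j (f \o u).
Proof.
move=> [gu nu]; have [c hc] := gmap_fil fP; split=> [k|n].
  exact: (gmap_gr fP).
have [N hN] := nu (n - c); exists N => k le.
by rewrite -[n](subrK c); apply: hc => //; apply: hN.
Qed.

Lemma gmap_gsum u : summable i u -> f (gsum i u) = gsum j (f \o u).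
Proof.
move=> su; have [c hc] := gmap_fil fP; apply/esym/gsum_uniq.
  by apply: (gmap_gr fP); apply: gsum_gr.
move=> n; have [N hN] := gsumP su (n - c); exists N => m le.
have gu : gr D i (\sum_(k < m) u k) by apply: gr_sum => k _; case: su.
rewrite /= -gmap_sum; last by case: su.
rewrite -gmapB //; last exact: gsum_gr.
rewrite -[n](subrK c); apply: hc; last exact: hN.
by apply: grB => //; apply: gsum_gr.
Qed.

End Gmap.

Section GmapInstances.
Variables (K : fieldType) (D : fdgla K).
Implicit Types (x y : D) (i j n : int).

Lemma gmap_comp (E H : fdgla K) i j k (f : E -> H) (h : D -> E) :
  gmap j k f -> gmap i j h -> gmap i k (f \o h).
Proof.
move=> fP hP; split=> [x gx|a x y gx gy|].
- by apply: (gmap_gr fP); apply: (gmap_gr hP).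
- by rewrite /= (gmap_lin hP) // (gmap_lin fP) //; apply: (gmap_gr hP).
have [c hc] := gmap_fil fP; have [d hd] := gmap_fil hP; exists (d + c).
move=> n x gx fx; rewrite addrA; apply: hc; first exact: (gmap_gr hP).
exact: hd.
Qed.

Lemma gmap_brr i j x : gr D i x -> gmap j (i + j) (br D i j x).
Proof.
move=> gx; split=> [y gy|a y z gy gz|].
- exact: (br_gr (fdgla_axioms D)).
- exact: (br_linear (fdgla_axioms D)).
have [c hc] := fil_exhaustive (fdgla_axioms D) gx; exists c => n y gy hy.
by rewrite addrC; apply: (fil_br (fdgla_axioms D)).
Qed.

Lemma gmap_brl i j y : gr D j y -> gmap i (i + j) (fun x => br D i j x y).
Proof.
move=> gy; split=> [x gx|a x z gx gz|].
- exact: (br_gr (fdgla_axioms D)).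
- have anti := br_antisym (fdgla_axioms D).
  have gaz : gr D i (a *: x + z) by apply: grD => //; apply: grZ.
  rewrite !(anti i j _ y) // (br_linear (fdgla_axioms D)) //; lmod.
have [c hc] := fil_exhaustive (fdgla_axioms D) gy; exists c => n x gx hx.
exact: (fil_br (fdgla_axioms D)).
Qed.

Lemma gmap_dif i : gmap i (i + 1) (dif D i).
Proof.
split=> [x gx|a x y gx gy|]; first exact: (dif_gr (fdgla_axioms D)).
  exact: (dif_linear (fdgla_axioms D)).
by exists 0 => n x gx hx; rewrite addr0; apply: (fil_dif (fdgla_axioms D)).
Qed.

Lemma gmap_id i : gmap i i (@id D).
Proof. by split=> //; exists 0 => n x; rewrite addr0. Qed.

End GmapInstances.

Section DoubleSums.
Variables (K : fieldType) (D : fdgla K).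
Implicit Types (i n : int) (u v : nat -> D) (l m : nat).

Lemma summableD i u v (a : K) : summable i u -> summable i v ->
  summable i (fun k => a *: u k + v k).
Proof.
move=> [gu nu] [gv nv]; split=> [k|n]; first by apply: grD => //; apply: grZ.
have [N hN] := nu n; have [M hM] := nv n; exists (maxn N M) => k.
rewrite geq_max => /andP[le1 le2].
by apply: filD; [apply: filZ; apply: hN | apply: hM].
Qed.

Lemma gsumD i u v (a : K) : summable i u -> summable i v ->
  gsum i (fun k => a *: u k + v k) = a *: gsum i u + gsum i v.
Proof.
move=> su sv; apply: gsum_uniq => [|n].
  by apply: grD; [apply: grZ|]; apply: gsum_gr.
have [N hN] := gsumP su n; have [M hM] := gsumP sv n; exists (maxn N M) => k.
rewrite geq_max => /andP[le1 le2]; rewrite big_split /= -scaler_sumr.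
set U := \sum_(j < k) u j; set V := \sum_(j < k) v j.
have -> : a *: gsum i u + gsum i v - (a *: U + V) =
  a *: (gsum i u - U) + (gsum i v - V) by lmod.
by apply: filD; [apply: filZ; apply: hN | apply: hM].
Qed.

Lemma gsumZ i u (a : K) : summable i u ->
  gsum i (fun k => a *: u k) = a *: gsum i u.
Proof.
move=> su; have s0 : summable i (fun=> 0 : D).
  by split=> [k|n]; [apply: gr0 | exists 0%N => k _; apply: fil0].
by rewrite -[RHS]addr0 -(gsum0 D i) -gsumD //; apply: eq_gsum => k; rewrite addr0.
Qed.

Lemma summableB i u v : summable i u -> summable i v ->
  summable i (fun k => u k - v k).
Proof.
move=> su sv; rewrite (_ : (fun k => _) = fun k => -1 *: v k + u k).
  exact: summableD.
by apply: funext => k; lmod.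
Qed.

Lemma gsumB i u v : summable i u -> summable i v ->
  gsum i (fun k => u k - v k) = gsum i u - gsum i v.
Proof.
move=> su sv; rewrite (_ : (fun k => _) = fun k => -1 *: v k + u k).
  by rewrite gsumD //; lmod.
by apply: funext => k; lmod.
Qed.

Lemma triangle_sum (V : zmodType) (w : nat -> nat -> V) (M : nat) :
  \sum_(l < M) \sum_(m < M - l) w l m =
  \sum_(k < M) \sum_(l < k.+1) w l (k - l)%N.
Proof.
elim: M => [|M IH]; first by rewrite !big_ord0.
rewrite [RHS]big_ord_recr /= -IH big_ord_recr /= subSnn big_ord1.
rewrite [\sum_(l < M.+1) w l (M - l)%N]big_ord_recr /= subnn addrA.
congr (_ + _); rewrite -big_split /=; apply: eq_bigr => l _.
have -> : (M.+1 - l = (M - l).+1)%N by have := ltn_ord l; lia.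
by rewrite big_ord_recr /= addrC.
Qed.

Definition null2 (w : nat -> nat -> D) :=
  forall n, exists N : nat, forall l m, (N <= l + m)%N -> fil D n (w l m).

Section Double.
Variables (i : int) (w : nat -> nat -> D).
Hypotheses (gw : forall l m, gr D i (w l m)) (nw : null2 w).

Lemma summable_row l : summable i (w l).
Proof.
split=> // n; have [N hN] := nw n; exists N => m le.
by apply: hN; apply: leq_trans le (leq_addl _ _).
Qed.

Lemma summable_rows : summable i (fun l => gsum i (w l)).
Proof.
split=> [l|n]; first exact: gsum_gr.
have [N hN] := nw n; exists N => l le; apply: gsum_fil => [|m].
  exact: summable_row.
by apply: hN; apply: leq_trans le (leq_addr _ _).
Qed.

(** Summation along the rows or along the antidiagonals: modulo a given filtration
    step both are the same finite sum. *)
Lemma gsum_diag : gsum i (fun l => gsum i (w l)) =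
  gsum i (fun k => \sum_(l < k.+1) w l (k - l)%N).
Proof.
apply/esym/gsum_uniq => [|n]; first exact: gsum_gr.
have [N hN] := nw n; have [N' hN'] := gsumP summable_rows n.
exists (maxn N N') => M; rewrite geq_max => /andP[leN leN'].
rewrite -triangle_sum -(subrK (\sum_(l < M) gsum i (w l)) (gsum i _)) -addrA.
apply: filD; first exact: hN'.
rewrite -sumrB; apply: fil_bigsum => l _.
apply: gsum_tail => [|m le]; first exact: summable_row.
by apply: hN; apply: leq_trans leN _; have := ltn_ord l; lia.
Qed.

End Double.

(* Only finitely many terms lie outside the step 0. *)
Lemma summable_bounded i u : summable i u -> exists c, forall k, fil D c (u k).
Proof.
move=> [gu nu]; have [N hN] := nu 0.
have [c hc] := choice (fun k => fil_exhaustive (fdgla_axioms D) (gu k)).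
suff [b hb] : exists b, forall k, (k < N)%N -> fil D b (u k).
  exists (Num.min b 0) => k; case: (ltnP k N) => le.
    by apply: (fil_le _ (hb k le)); lia.
  by apply: (fil_le _ (hN k le)); lia.
elim: (N) => [|M [b hb]]; first by exists 0.
exists (Num.min b (c M)) => k; rewrite ltnS leq_eqVlt => /orP[/eqP->|lt].
  by apply: (fil_le _ (hc M)); lia.
by apply: (fil_le _ (hb k lt)); lia.
Qed.

Lemma br_null2 i j u v : summable i u -> summable j v ->
  null2 (fun l m => br D i j (u l) (v m)).
Proof.
move=> su sv n; have [c hc] := summable_bounded su.
have [d hd] := summable_bounded sv.
have [gu nu] := su; have [gv nv] := sv.
have [N hN] := nu (n - d); have [M hM] := nv (n - c); exists (N + M)%N => l m le.
have [leN|ltN] := leqP N l.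
  rewrite -[n](subrK d); apply: (fil_br (fdgla_axioms D)) => //; exact: hN.
rewrite -[n](subrK c) addrC; apply: (fil_br (fdgla_axioms D)) => //.
by apply: hM; lia.
Qed.

Lemma br_gsum i j u v : summable i u -> summable j v ->
  br D i j (gsum i u) (gsum j v) =
  gsum (i + j) (fun k => \sum_(l < k.+1) br D i j (u l) (v (k - l)%N)).
Proof.
move=> su sv; have [gu _] := su; have [gv _] := sv.
rewrite (gmap_gsum (gmap_brl i (gsum_gr j v)) su).
rewrite -(@gsum_diag (i + j) (fun l m => br D i j (u l) (v m))).
- by apply: eq_gsum => l /=; rewrite (gmap_gsum (gmap_brr j (gu l)) sv).
- by move=> l m; apply: (br_gr (fdgla_axioms D)).
exact: br_null2.
Qed.

End DoubleSums.

(** * The DGLA of power series *)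

Section CharZero.
Variables (K : fieldType) (charK0 : [pchar K] =i pred0).

Lemma natS_neq0 k : k.+1%:R != 0 :> K.
Proof. by have /pcharf0P-> := charK0. Qed.

Lemma mulrSn_inj (V : lmodType K) k (x y : V) : x *+ k.+1 = y *+ k.+1 -> x = y.
Proof.
by rewrite -!scaler_nat => /(scalerI (natS_neq0 k)).
Qed.

Lemma factV_S k : (k.+1`!%:R : K)^-1 * k.+1%:R = (k`!%:R)^-1.
Proof.
by rewrite factS natrM invfM mulrAC mulVf ?mul1r // natS_neq0.
Qed.

End CharZero.

Section SeriesIdentities.
Variables (K : fieldType) (charK0 : [pchar K] =i pred0) (D : fdgla K).
Local Notation T := (tseries D).
Implicit Types (i j : int) (p q r : T).

Lemma tserD p q k : (p + q : T) k = p k + q k. Proof. by []. Qed.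
Lemma tserN p k : (- p : T) k = - p k. Proof. by []. Qed.
Lemma tserZ (a : K) p k : (a *: p : T) k = a *: p k. Proof. by []. Qed.
Definition tserE := (tserD, tserN, tserZ).

Definition coef_gr i p := forall k, gr D i (p k).

Lemma cauchy_tder (V : zmodType) (w : nat -> nat -> V) k :
  (\sum_(l < k.+2) w l (k.+1 - l)%N) *+ k.+1 =
  \sum_(l < k.+1) w l.+1 (k - l)%N *+ l.+1 +
  \sum_(l < k.+1) w l (k - l).+1 *+ (k - l).+1.
Proof.
rewrite -sumrMnl.
have -> : \sum_(l < k.+2) w l (k.+1 - l)%N *+ k.+1 =
    \sum_(l < k.+2) w l (k.+1 - l)%N *+ l +
    \sum_(l < k.+2) w l (k.+1 - l)%N *+ (k.+1 - l).
  rewrite -big_split /=; apply: eq_bigr => l _; rewrite -mulrnDr.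
  by rewrite subnKC // -ltnS.
rewrite big_ord_recl mulr0n add0r.
rewrite [X in _ + X]big_ord_recr /= subnn mulr0n addr0; congr (_ + _).
by apply: eq_bigr => l _; rewrite subSn // -ltnS.
Qed.

Lemma coef_gr_tder i p : coef_gr i p -> coef_gr i (tder p).
Proof. by move=> h k; apply: grMn. Qed.

Lemma coef_gr_br i j p q : coef_gr i p -> coef_gr j q ->
  coef_gr (i + j) (br T i j p q).
Proof.
by move=> hp hq k; apply: gr_sum => l _; apply: (br_gr (fdgla_axioms D)).
Qed.

Lemma coef_gr_dif i p : coef_gr i p -> coef_gr (i + 1) (dif T i p).
Proof. by move=> hp k; apply: (dif_gr (fdgla_axioms D)). Qed.

Lemma tder_br i j p q : coef_gr i p -> coef_gr j q ->
  tder (br T i j p q) = br T i j (tder p) q + br T i j p (tder q).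
Proof.
move=> hp hq; apply: funext => k.
rewrite /tder /= (cauchy_tder (fun l m => br D i j (p l) (q m))).
congr (_ + _); apply: eq_bigr => l _.
  by rewrite (gmapMn (gmap_brl i (hq _))).
by rewrite (gmapMn (gmap_brr j (hp _))).
Qed.

Lemma tder_dif i p : coef_gr i p -> tder (dif T i p) = dif T i (tder p).
Proof.
by move=> hp; apply: funext => k; rewrite /tder /= (gmapMn (gmap_dif D i)).
Qed.

Lemma tbr_linear i j (a : K) p q r : coef_gr i p -> coef_gr j q ->
  coef_gr j r -> br T i j p (a *: q + r) = a *: br T i j p q + br T i j p r.
Proof.
move=> hp hq hr; apply: funext => k; rewrite tserE tserZ /=.
rewrite scaler_sumr -big_split /=; apply: eq_bigr => l _.
by rewrite -(gmap_lin (gmap_brr j (hp l))).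
Qed.

Lemma tbr_linearl i j (a : K) p q r : coef_gr i p -> coef_gr i q ->
  coef_gr j r -> br T i j (a *: p + q) r = a *: br T i j p r + br T i j q r.
Proof.
move=> hp hq hr; apply: funext => k; rewrite tserE tserZ /=.
rewrite scaler_sumr -big_split /=; apply: eq_bigr => l _.
by rewrite -(gmap_lin (gmap_brl i (hr _))).
Qed.

Lemma tbrDr i j p q r : coef_gr i p -> coef_gr j q ->
  coef_gr j r -> br T i j p (q + r) = br T i j p q + br T i j p r.
Proof.
by move=> hp hq hr; have := tbr_linear 1 hp hq hr; rewrite !scale1r.
Qed.

Lemma tbrDl i j p q r : coef_gr i p -> coef_gr i q ->
  coef_gr j r -> br T i j (p + q) r = br T i j p r + br T i j q r.
Proof.
by move=> hp hq hr; have := tbr_linearl 1 hp hq hr; rewrite !scale1r.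
Qed.

Lemma tdifD i p q : coef_gr i p -> coef_gr i q ->
  dif T i (p + q) = dif T i p + dif T i q.
Proof.
by move=> hp hq; apply: funext => k; apply: (gmapD (gmap_dif D i)).
Qed.

(* Identities between power series are proved by induction on the order of the
   coefficient: differentiation reduces each order to the preceding one. *)
Lemma tbr_antisym i j p q k : coef_gr i p -> coef_gr j q ->
  br T i j p q k = - (ksign K (i * j) *: br T j i q p k).
Proof.
elim: k p q => [|k IH] p q hp hq.
  by rewrite /= !big_ord1 (br_antisym (fdgla_axioms D)).
have hp' := coef_gr_tder hp; have hq' := coef_gr_tder hq.
apply: (mulrSn_inj charK0 (k := k)).
rewrite mulNrn scalerMnr -/(tder (br T i j p q) k) -/(tder (br T j i q p) k).
rewrite !tder_br // !tserE !IH //; lmod.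
Qed.

Lemma tbr_jacobi i j l p q r k :
  coef_gr i p -> coef_gr j q -> coef_gr l r ->
  br T i (j + l) p (br T j l q r) k =
    br T (i + j) l (br T i j p q) r k
    + ksign K (i * j) *: br T j (i + l) q (br T i l p r) k.
Proof.
elim: k p q r => [|k IH] p q r hp hq hr.
  by rewrite /= !big_ord1 (br_jacobi (fdgla_axioms D)).
have hp' := coef_gr_tder hp; have hq' := coef_gr_tder hq.
have hr' := coef_gr_tder hr.
apply: (mulrSn_inj charK0 (k := k)).
rewrite mulrnDl scalerMnr.
rewrite -/(tder (br T i (j + l) p (br T j l q r)) k).
rewrite -/(tder (br T (i + j) l (br T i j p q) r) k).
rewrite -/(tder (br T j (i + l) q (br T i l p r)) k).
rewrite !tder_br ?tbrDl ?tbrDr //; do ?exact: coef_gr_br.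
rewrite !tserE !IH //; lmod.
Qed.

Lemma tdif_br i j p q k : coef_gr i p -> coef_gr j q ->
  dif T (i + j) (br T i j p q) k =
    br T (i + 1) j (dif T i p) q k + ksign K i *: br T i (j + 1) p (dif T j q) k.
Proof.
elim: k p q => [|k IH] p q hp hq.
  by rewrite /= !big_ord1 (dif_br (fdgla_axioms D)).
have hp' := coef_gr_tder hp; have hq' := coef_gr_tder hq.
have hdp := coef_gr_dif hp; have hdq := coef_gr_dif hq.
have hpq := coef_gr_br hp hq.
apply: (mulrSn_inj charK0 (k := k)).
rewrite mulrnDl scalerMnr.
rewrite -/(tder (dif T (i + j) (br T i j p q)) k).
rewrite -/(tder (br T (i + 1) j (dif T i p) q) k).
rewrite -/(tder (br T i (j + 1) p (dif T j q)) k).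
rewrite tder_dif // !tder_br // !tder_dif //.
rewrite tdifD; try exact: coef_gr_br.
rewrite !tserE !IH //; lmod.
Qed.

Lemma is_fdgla_tseries : is_fdgla T.
Proof.
have cauchy_null i j p q : gr T i p -> gr T j q ->
    null (br T i j p q : nat -> D).
  move=> hp hq n.
  have [N hN] := br_null2 (hp : summable i p) (hq : summable j q) n.
  exists N => k le; apply: fil_bigsum => l _; apply: hN.
  by rewrite subnKC // -ltnS.
split.
- move=> i; split.
    by split=> [k|n]; [apply: gr0 | exists 0%N => k _; apply: fil0].
  move=> a p q hp hq.
  by have := summableD a (hp : summable i p) (hq : summable i q).
- by move=> i p hp; apply: (gmap_summable (gmap_dif D i)).
- move=> i a p q [hp _] [hq _]; apply: funext => k.
  exact: (dif_linear (fdgla_axioms D)).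
- move=> i p [hp _]; apply: funext => k; exact: (dif_dif (fdgla_axioms D)).
- move=> i j p q hp hq; split; last exact: cauchy_null.
  by case: hp hq => hp _ [hq _]; apply: coef_gr_br.
- by move=> i j a p q r [hp _] [hq _] [hr _]; apply: tbr_linear.
- move=> i j p q [hp _] [hq _]; apply: funext => k; exact: tbr_antisym.
- move=> i j l p q r [hp _] [hq _] [hr _]; apply: funext => k.
  exact: tbr_jacobi.
- move=> i j p q [hp _] [hq _]; apply: funext => k; exact: tdif_br.
- move=> n; split=> [k|a p q hp hq k]; first exact: fil0.
  by apply: filD; [apply: filZ; apply: hp | apply: hq].
- by move=> n m le p hp k; apply: (fil_le le).
- by move=> i p hp; exact: (summable_bounded hp).
- move=> i p [hp _] h; apply: funext => k.
  by apply: (fil_separated (fdgla_axioms D) (hp k)) => n; apply: h.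
- move=> i u hu hd.
  have /choice[x hx] : forall k, exists x, gr D i x /\ forall n, fil D n (x - u n k).
    move=> k; have [|n|x gx hx] := @fil_complete _ _ (fdgla_axioms D) i (fun n => u n k).
    + by move=> n; case: (hu n) => h _; apply: h.
    + exact: hd.
    by exists x.
  exists (x : T) => [|n k]; last by case: (hx k) => _; apply.
  split=> [k|n]; first by case: (hx k).
  have [_ hun] := hu n; have [N hN] := hun n; exists N => k le.
  rewrite -(subrK (u n k) (x k)); apply: filD; last exact: hN.
  by case: (hx k) => _; apply.
- by move=> n i p [hp _] h k; apply: (fil_dif (fdgla_axioms D)).
- move=> n m i j p q [hp _] [hq _] h h' k; apply: fil_bigsum => l _.
  exact: (fil_br (fdgla_axioms D)).
Qed.

Definition tser : fdgla K := Fdgla is_fdgla_tseries.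

Lemma gmap_tder i : @gmap K tser tser i i (@tder K D).
Proof.
split=> [p [hp np]|a p q _ _|].
- split=> [k|n]; first exact: grMn.
  by have [N hN] := np n; exists N => k le; apply: filMn; apply: hN; apply: leqW.
- by apply: funext => k; rewrite /tder [LHS]mulrnDl scalerMnr.
by exists 0 => n p _ hp k; rewrite addr0; apply: filMn; apply: hp.
Qed.

Lemma fil_tder n p : fil T n p -> fil T n (tder p).
Proof. by move=> h k; apply: filMn; apply: h. Qed.

Lemma gmap_coef i k : @gmap K tser D i i (fun p => p k).
Proof.
by split=> [p [hp _]||] //; exists 0 => n p _; rewrite addr0; apply.
Qed.

(** Each coefficient is determined by the preceding ones, in characteristic 0. *)
Lemma linear_ode_uniq i p l : coef_gr 0 l -> coef_gr i p -> p 0%N = 0 ->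
  tder p = br T 0 i l p -> p = 0.
Proof.
move=> hl hp p0 e; apply: funext => k; have [m] := ubnP k.
elim: m k => [//|m IH] [|k] le; first exact: p0.
apply: (mulrSn_inj charK0 (k := k)); rewrite mul0rn -/(tder p k) e /=.
apply: big1 => h _; rewrite IH ?(gmap0 (gmap_brr i (hl _))) //.
by have := ltn_ord h; lia.
Qed.

End SeriesIdentities.

(** * Evaluation of power series *)

Section Evaluation.
Variables (K : fieldType) (charK0 : [pchar K] =i pred0) (D : fdgla K).
Local Notation T := (tser charK0 D).
Implicit Types (i j n : int) (p q : T) (t : K).

Lemma summable_teval i p t : gr T i p -> summable i (fun k => t ^+ k *: p k).
Proof.
move=> [hp np]; split=> [k|n]; first exact: grZ.
by have [N hN] := np n; exists N => k le; apply: filZ; apply: hN.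
Qed.

Lemma teval_fil i n p t : gr T i p -> fil T n p -> fil D n (teval i p t).
Proof.
move=> hp fp; apply: gsum_fil => [|k]; first exact: summable_teval.
by apply: filZ; apply: fp.
Qed.

Lemma gmap_teval i t : @gmap K T D i i (fun p => teval i p t).
Proof.
split=> [p hp|a p q hp hq|]; first exact: gsum_gr.
  rewrite -gsumD; try exact: summable_teval.
  by apply: eq_gsum => k; rewrite !tserE; lmod.
by exists 0 => n p hp fp; rewrite addr0; apply: teval_fil.
Qed.

Lemma teval_br i j p q t : gr T i p -> gr T j q ->
  teval (i + j) (br T i j p q) t = br D i j (teval i p t) (teval j q t).
Proof.
move=> hp hq; rewrite br_gsum; try exact: summable_teval.
apply: eq_gsum => k /=; rewrite scaler_sumr; apply: eq_bigr => l _.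
have [[hp' _] [hq' _]] := (hp, hq).
rewrite (gmapZ (gmap_brl i (grZ _ (hq' _)))) // (gmapZ (gmap_brr j (hp' _))) //.
by rewrite scalerA -exprD subnKC // -ltnS.
Qed.

Lemma teval_dif i p t : gr T i p ->
  teval (i + 1) (dif T i p) t = dif D i (teval i p t).
Proof.
move=> hp; rewrite /teval (gmap_gsum (gmap_dif D i) (summable_teval t hp)).
by apply: eq_gsum => k /=; rewrite (gmapZ (gmap_dif D i)) //; case: hp.
Qed.

Lemma teval0 i p : gr T i p -> teval i p 0 = p 0%N.
Proof.
move=> [hp _]; rewrite -(gsum1 (hp 0%N)); apply: eq_gsum => -[|k].
  by rewrite scale1r.
by rewrite exprS mul0r scale0r.
Qed.

Definition tconst (x : D) : T := fun k => if k is 0%N then x else 0.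

Lemma tconst_gr i x : gr D i x -> gr T i (tconst x).
Proof.
move=> gx; split=> [[|k] //|n]; first exact: gr0.
by exists 1%N => -[|k] // _; apply: fil0.
Qed.

Lemma tder_const x : tder (tconst x) = 0.
Proof. by apply: funext => k; rewrite /tder mul0rn. Qed.

Lemma teval_const i x t : gr D i x -> teval i (tconst x) t = x.
Proof.
move=> gx; rewrite -[RHS](gsum1 gx); apply: eq_gsum => -[|k].
  by rewrite scale1r.
by rewrite scaler0.
Qed.

Lemma interpolation N : exists W : 'I_N -> 'I_N -> K,
  forall i k : 'I_N, \sum_(j < N) W j k * j%:R ^+ i = (i == k)%:R.
Proof.
pose a : 'rV[K]_N := \row_j (j : nat)%:R.
have : Vandermonde N a \in unitmx.
  rewrite unitmxE det_Vandermonde unitfE; apply/prodf_neq0 => i _.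
  apply/prodf_neq0 => j lt; rewrite !mxE -natrB; last exact: ltnW.
  by have /pcharf0P-> := charK0; rewrite subn_eq0 -ltnNge.
move/mulmxV => VW; exists (invmx (Vandermonde N a)) => i k.
have /matrixP/(_ i k) := VW; rewrite !mxE => <-.
by apply: eq_bigr => j _; rewrite mulrC !mxE.
Qed.

(** A polynomial with coefficients in a vector space whose values at all scalars
    lie in a subspace has all its coefficients there: by inverting a Vandermonde
    matrix the coefficients are linear combinations of finitely many values. *)
Lemma poly_values_fil n N (c : nat -> D) :
  (forall t : K, fil D n (\sum_(k < N) t ^+ k *: c k)) ->
  forall k, (k < N)%N -> fil D n (c k).
Proof.
move=> h k ltk; have [W hW] := interpolation N; set k' := Ordinal ltk.
have -> : c k = \sum_(j < N) W j k' *: \sum_(i < N) j%:R ^+ i *: c i.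
  under eq_bigr => j _ do rewrite scaler_sumr.
  rewrite exchange_big /= (bigD1 k') //= [X in _ + X]big1 => [|i ne].
    under eq_bigr => j _ do rewrite scalerA.
    by rewrite -scaler_suml (hW k' k') eqxx scale1r addr0.
  under eq_bigr => j _ do rewrite scalerA.
  by rewrite -scaler_suml hW (negPf ne) scale0r.
by apply: fil_bigsum => j _; apply: filZ; apply: h.
Qed.

(** Modulo each filtration step the series are polynomials, and K is infinite. *)
Lemma teval_inj i p q : gr T i p -> gr T i q ->
  (forall t, teval i p t = teval i q t) -> p = q.
Proof.
move=> hp hq e; apply: subr0_eq.
have hr : gr T i (p - q) by apply: grB.
apply: (fil_separated (fdgla_axioms T) hr) => n k.
have [_ /(_ n)[N hN]] := hr; have [leN|] := leqP N k; first exact: hN.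
apply: poly_values_fil k => t.
have := gsum_tail (summable_teval t hr)
  (fun k le => filZ (t ^+ k) (hN k le) : fil D n (t ^+ k *: (p - q) k)).
rewrite -/(teval i (p - q) t) (gmapB (gmap_teval i t)) // e subrr sub0r.
by move=> /filN; rewrite opprK.
Qed.

End Evaluation.

(** * The exponential of an inner derivation *)

Section ExpAd.
Variables (K : fieldType) (charK0 : [pchar K] =i pred0) (D : fdgla K).
Implicit Types (x y : D) (i j n : int) (c : nat -> K).

Lemma ad_gr a i x : gr D 0 a -> gr D i x -> gr D i (br D 0 i a x).
Proof. by move=> ga gx; rewrite -[X in gr D X]add0r; apply: (br_gr (fdgla_axioms D)). Qed.

Lemma gmap_ad a i : gr D 0 a -> gmap i i (br D 0 i a).
Proof. by move=> ga; have := gmap_brr i ga; rewrite add0r. Qed.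

Lemma ad_br a i j x y : gr D 0 a -> gr D i x -> gr D j y ->
  br D 0 (i + j) a (br D i j x y) =
  br D i j (br D 0 i a x) y + br D i j x (br D 0 j a y).
Proof.
move=> ga gx gy; rewrite (br_jacobi (fdgla_axioms D)) //.
by rewrite !add0r mul0r scale1r.
Qed.

Lemma dif_ad a i x : gr D 0 a -> gr D i x ->
  dif D i (br D 0 i a x) = br D 1 i (dif D 0 a) x + br D 0 (i + 1) a (dif D i x).
Proof.
move=> ga gx; have := dif_br (fdgla_axioms D) ga gx.
by rewrite !add0r scale1r.
Qed.

Lemma iter_ad_gr a i x k : gr D 0 a -> gr D i x -> gr D i (iter k (br D 0 i a) x).
Proof. by move=> ga gx; elim: k => //= k IH; apply: ad_gr. Qed.

Lemma iter_ad_fil a i x k n : gr D 0 a -> fil D 1 a -> gr D i x -> fil D n x ->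
  fil D (k%:Z + n) (iter k (br D 0 i a) x).
Proof.
move=> ga fa gx fx; elim: k => [|k IH] /=; first by rewrite add0r.
have -> : k.+1%:Z + n = 1 + (k%:Z + n) by lia.
by apply: (fil_br (fdgla_axioms D)) => //; apply: iter_ad_gr.
Qed.

(** The value at [a, .] of a power series in one variable. *)
Definition adser c i a x : D := gsum i (fun k => c k *: iter k (br D 0 i a) x).

Lemma adser_gr c i a x : gr D i (adser c i a x).
Proof. exact: gsum_gr. Qed.

Section Fixed.
Variable a : D.
Hypotheses (ga : gr D 0 a) (fa : fil D 1 a).

Lemma adser_summable c i x : gr D i x ->
  summable i (fun k => c k *: iter k (br D 0 i a) x).
Proof.
move=> gx; have [d hd] := fil_exhaustive (fdgla_axioms D) gx.
apply: (@summable_shift _ _ _ _ d) => k; first by apply: grZ; apply: iter_ad_gr.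
by apply: filZ; apply: iter_ad_fil.
Qed.

Lemma gmap_iter_ad i k : gmap i i (iter k (br D 0 i a)).
Proof.
elim: k => [|k IH]; first exact: gmap_id.
exact: (gmap_comp (gmap_ad i ga) IH).
Qed.

Lemma adser_fil c i n x : gr D i x -> fil D n x -> fil D n (adser c i a x).
Proof.
move=> gx fx; apply: gsum_fil => [|k]; first exact: adser_summable.
apply: filZ; apply: (@fil_le _ _ _ (k%:Z + n)); first by lia.
exact: iter_ad_fil.
Qed.

Lemma gmap_adser c i : gmap i i (adser c i a).
Proof.
split=> [x gx|b x y gx gy|]; first exact: adser_gr.
  rewrite -gsumD; try exact: adser_summable.
  by apply: eq_gsum => k; rewrite (gmap_lin (gmap_iter_ad i k)) //; lmod.
by exists 0 => n x gx fx; rewrite addr0; apply: adser_fil.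
Qed.

Definition cauchy_coef c c' k : K := \sum_(l < k.+1) c l * c' (k - l)%N.

Lemma adser_adser c c' i x : gr D i x ->
  adser c i a (adser c' i a x) = adser (cauchy_coef c c') i a x.
Proof.
move=> gx; have [d hd] := fil_exhaustive (fdgla_axioms D) gx.
pose w l m := (c l * c' m) *: iter (l + m) (br D 0 i a) x.
have gw l m : gr D i (w l m) by apply: grZ; apply: iter_ad_gr.
have nw : null2 w.
  move=> n; exists (absz (n - d)) => l m le; apply: filZ.
  by apply: fil_le (iter_ad_fil (l + m) ga fa gx hd); lia.
transitivity (gsum i (fun l => gsum i (w l))).
  apply: eq_gsum => l; have gl := gmap_iter_ad i l.
  rewrite [X in iter l _ X]/adser (gmap_gsum gl); last exact: adser_summable.
  rewrite -gsumZ; last by apply: (gmap_summable gl); apply: adser_summable.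
  apply: eq_gsum => m; rewrite /= (gmapZ gl); last exact: iter_ad_gr.
  by rewrite /w scalerA iterD.
rewrite (gsum_diag gw nw); apply: eq_gsum => k.
rewrite /cauchy_coef scaler_suml; apply: eq_bigr => l _.
by rewrite /w subnKC // -ltnS.
Qed.

Lemma br_adser c c' i j x y : gr D i x -> gr D j y ->
  br D i j (adser c i a x) (adser c' j a y) =
  gsum (i + j) (fun k => \sum_(l < k.+1) (c l * c' (k - l)%N) *:
    br D i j (iter l (br D 0 i a) x) (iter (k - l) (br D 0 j a) y)).
Proof.
move=> gx gy; rewrite br_gsum; try exact: adser_summable.
apply: eq_gsum => k; apply: eq_bigr => l _.
rewrite (gmapZ (gmap_brl i _)); try (try apply: grZ; exact: iter_ad_gr).
by rewrite (gmapZ (gmap_brr j _)) ?scalerA //; exact: iter_ad_gr.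
Qed.

End Fixed.

Lemma gmap_adser_comm (E : fdgla K) c i j a b x (f : D -> E) : gmap i j f ->
  gr D 0 a -> fil D 1 a -> gr D i x ->
  (forall y, gr D i y -> f (br D 0 i a y) = br E 0 j b (f y)) ->
  f (adser c i a x) = gsum j (fun k => c k *: iter k (br E 0 j b) (f x)).
Proof.
move=> fP ga fa gx fb; rewrite (gmap_gsum fP); last exact: adser_summable.
apply: eq_gsum => k /=; rewrite (gmapZ fP); last exact: iter_ad_gr.
congr (_ *: _); elim: k => //= k IH.
by rewrite fb ?IH //; apply: iter_ad_gr.
Qed.

Lemma iter_adZ (t : K) a i x k : gr D 0 a -> gr D i x ->
  iter k (br D 0 i (t *: a)) x = t ^+ k *: iter k (br D 0 i a) x.
Proof.
move=> ga gx; elim: k => [|k IH] /=; first by rewrite scale1r.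
have gk := iter_ad_gr k ga gx.
rewrite IH (gmapZ (gmap_brl 0 (grZ _ gk))) //.
by rewrite (gmapZ (gmap_ad i ga)) // scalerA exprS.
Qed.

Lemma adserZ (t : K) c a i x : gr D 0 a -> gr D i x ->
  adser c i (t *: a) x = adser (fun k => t ^+ k * c k) i a x.
Proof.
by move=> ga gx; apply: eq_gsum => k; rewrite iter_adZ // scalerA mulrC.
Qed.

Lemma adser_zero c i x : gr D i x -> adser c i 0 x = c 0%N *: x.
Proof.
move=> gx; rewrite -(scale0r (0 : D)) adserZ //; last exact: gr0.
rewrite -[RHS](gsum1 (grZ (c 0%N) gx)); apply: eq_gsum => -[|k].
  by rewrite expr0 mul1r.
by rewrite exprS !mul0r scale0r.
Qed.

Definition exp_coef k : K := (k`!%:R)^-1.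
Definition dexp_coef k : K := (k.+1`!%:R)^-1.

Lemma exp_adE i a x : exp_ad i a x = adser exp_coef i a x. Proof. by []. Qed.
Lemma dexp_adE i a x : dexp_ad i a x = adser dexp_coef i a x. Proof. by []. Qed.

Lemma bin_coef (n r : nat) : (r <= n)%N ->
  (n`!%:R)^-1 * 'C(n, r)%:R = exp_coef r * exp_coef (n - r) :> K.
Proof.
move=> le; rewrite /exp_coef -(bin_fact le) !natrM !invfM mulrC !mulrA mulfV ?mul1r //.
by have /pcharf0P-> := charK0; rewrite -lt0n bin_gt0.
Qed.

(** As [a, .] is a derivation, its exponential is an automorphism. *)
Lemma exp_ad_br a i j x y : gr D 0 a -> fil D 1 a -> gr D i x -> gr D j y ->
  exp_ad (i + j) a (br D i j x y) = br D i j (exp_ad i a x) (exp_ad j a y).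
Proof.
move=> ga fa gx gy; rewrite !exp_adE br_adser //; apply: eq_gsum => n.
have -> : iter n (br D 0 (i + j) a) (br D i j x y) =
    \sum_(r < n.+1) br D i j (iter r (br D 0 i a) x) (iter (n - r) (br D 0 j a) y)
      *+ 'C(n, r).
  have gx' r := iter_ad_gr r ga gx; have gy' r := iter_ad_gr r ga gy.
  have gb r s := br_gr (fdgla_axioms D) (gx' r) (gy' s).
  elim: n => [|n IH] /=; first by rewrite big_ord1.
  rewrite IH (gmap_sum (gmap_ad (i + j) ga)); last first.
    by move=> r _; apply: grMn.
  under [LHS]eq_bigr => r _ do rewrite (gmapMn (gmap_ad (i + j) ga)) // ad_br // mulrnDl.
  rewrite big_split /= addrC [RHS]big_ord_recl subn0 bin0 /=.
  under [X in _ = _ + X]eq_bigr => r _ do rewrite /bump add1n subSS binS mulrnDr.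
  rewrite big_split /= addrA; congr (_ + _).
  rewrite big_ord_recl subn0 bin0 /=; congr (_ + _).
  rewrite [RHS]big_ord_recr /= bin_small // mulr0n addr0.
  apply: eq_bigr => r _; rewrite /bump add1n.
  by have -> : (n - r = (n - r.+1).+1)%N by have := ltn_ord r; lia.
rewrite scaler_sumr; apply: eq_bigr => r _.
by rewrite -scaler_nat scalerA bin_coef // -ltnS.
Qed.

(** (1 - exp(-z)) / z = exp(-z) (exp(z) - 1) / z *)
Lemma dexp_ad_opp a i x : gr D 0 a -> fil D 1 a -> gr D i x ->
  dexp_ad i (- a) x = exp_ad i (- a) (dexp_ad i a x).
Proof.
move=> ga fa gx; rewrite exp_adE !dexp_adE -scaleN1r !adserZ //; last exact: adser_gr.
rewrite adser_adser //; apply: eq_gsum => n; congr (_ *: _).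
have key l : (l <= n)%N ->
    exp_coef l * dexp_coef (n - l) = dexp_coef n * 'C(n.+1, l)%:R.
  by move=> le; have := bin_coef (leqW le); rewrite subSn // => ->.
rewrite /cauchy_coef.
have := exprDn (1 : K) (-1) n.+1; rewrite subrr expr0n big_ord_recr /=.
move/esym/eqP; rewrite addr_eq0 binn subnn mulr1n => /eqP e.
transitivity (dexp_coef n * \sum_(l < n.+1) 1 ^+ (n.+1 - l) * (-1) ^+ l *+ 'C(n.+1, l)).
  by rewrite e expr1n mul1r exprS mulrC; congr (_ * _); ring.
rewrite mulr_sumr; apply: eq_bigr => l _.
rewrite -mulrA (key l (leq_ord l)) expr1n mul1r -mulr_natr mulrCA; congr (_ * _).
Qed.

Section Derivation.
Variables (e : int) (dl : int -> D -> D) (a : D).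
Hypotheses (ga : gr D 0 a) (fa : fil D 1 a).
Hypothesis dlP : forall i, gmap i (i + e) (dl i).
Hypothesis dl_ad : forall i x, gr D i x ->
  dl i (br D 0 i a x) = br D e i (dl 0 a) x + br D 0 (i + e) a (dl i x).

Let b := dl 0 a.

Let gb : gr D e b.
Proof. by rewrite -[e]add0r; apply: (gmap_gr (dlP 0)). Qed.

Definition deriv_defect i x (n : nat) : D := \sum_(r < n.+1)
  br D e i (iter r (br D 0 e a) b) (iter (n - r) (br D 0 i a) x) *+ 'C(n.+1, r.+1).

Lemma deriv_iter i x (n : nat) : gr D i x -> dl i (iter n.+1 (br D 0 i a) x) =
  iter n.+1 (br D 0 (i + e) a) (dl i x) + deriv_defect i x n.
Proof.
move=> gx; have gx' r := iter_ad_gr r ga gx; have gb' r := iter_ad_gr r ga gb.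
have gbx r s := br_gr (fdgla_axioms D) (gb' r) (gx' s).
elim: n => [|n IH].
  by rewrite /= dl_ad // /deriv_defect big_ord1 /= addrC.
rewrite iterS dl_ad // IH (gmapD (gmap_ad (i + e) ga)); first last.
- by rewrite addrC; apply: gr_sum => r _; apply: grMn.
- by apply: iter_ad_gr => //; apply: (gmap_gr (dlP i)).
rewrite addrCA -iterS; congr (_ + _).
rewrite /deriv_defect addrC [i + e]addrC (gmap_sum (gmap_ad (e + i) ga)); last first.
  by move=> r _; apply: grMn.
under [X in X + _]eq_bigr => r _ do rewrite (gmapMn (gmap_ad (e + i) ga)) // ad_br // mulrnDl.
rewrite big_split /=.
under [RHS]eq_bigr => r _ do rewrite binS mulrnDr.
rewrite [RHS]big_split /= [X in _ = X + _]big_ord_recr /= bin_small // mulr0n addr0.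
rewrite [X in _ = _ + X]big_ord_recl subn0 bin0 /= mulr1n.
rewrite addrAC addrC [X in _ + X]addrC; congr (_ + (_ + _)).
apply: eq_bigr => r _.
by have -> : (n.+1 - r = (n - r).+1)%N by have := ltn_ord r; lia.
Qed.

Lemma summable_defect c i x : gr D i x ->
  summable (i + e) (fun k => c k.+1 *: deriv_defect i x k) /\
  dl i (adser c i a x) = adser c (i + e) a (dl i x)
    + gsum (i + e) (fun k => c k.+1 *: deriv_defect i x k).
Proof.
move=> gx; have gdx := gmap_gr (dlP i) gx.
have s1 := gmap_summable (dlP i) (adser_summable ga fa c gx).
have s2 := adser_summable ga fa c gdx.
have s3 := summableD (-1) s2 s1; have e3 := gsumD (-1) s2 s1.
rewrite gsum_head // in e3.
have eq (n : nat) : -1 *: (c n.+1 *: iter n.+1 (br D 0 (i + e) a) (dl i x)) +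
    dl i (c n.+1 *: iter n.+1 (br D 0 i a) x) = c n.+1 *: deriv_defect i x n.
  rewrite (gmapZ (dlP i)) ?deriv_iter //; last exact: iter_ad_gr.
  by lmod.
split.
  case: s3 => g3 n3; split=> [k|n]; first by rewrite -eq; apply: g3.
  by have [N hN] := n3 n; exists N => k le; rewrite -eq; apply: hN; apply: leqW.
rewrite {1}/adser (gmap_gsum (dlP i)); last exact: adser_summable.
move: e3; rewrite /= (gmapZ (dlP i)) // scaleN1r addNr add0r.
rewrite (eq_gsum (i + e) eq) => ->; rewrite -/(adser c _ a _); lmod.
Qed.

(** The derivative of the exponential: the logarithmic derivative of exp(a) is
    (exp([a, .]) - 1) / [a, .] applied to the derivative of a. *)
Lemma deriv_exp_ad i x : gr D i x ->
  dl i (exp_ad i a x) =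
    exp_ad (i + e) a (dl i x) + br D e i (dexp_ad e a b) (exp_ad i a x).
Proof.
move=> gx; rewrite !exp_adE (summable_defect exp_coef gx).2; congr (_ + _).
rewrite dexp_adE br_adser // [i + e]addrC; apply: eq_gsum => n.
rewrite /deriv_defect scaler_sumr; apply: eq_bigr => r _.
by rewrite -scaler_nat scalerA bin_coef.
Qed.

End Derivation.

(** If two derivations commute at a, their logarithmic derivatives of exp(a)
    satisfy the Maurer-Cartan structure equation.  The coefficients match by
    C(n+1, r+1) + C(n+1, r) = C(n+2, r+1). *)
Lemma dexp_structure (dl : int -> D -> D) a : gr D 0 a -> fil D 1 a ->
  (forall i, gmap i (i + 0) (dl i)) ->
  (forall i x, gr D i x ->
    dl i (br D 0 i a x) = br D 0 i (dl 0 a) x + br D 0 (i + 0) a (dl i x)) ->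
  dl 1 (dif D 0 a) = dif D 0 (dl 0 a) ->
  dl 1 (dexp_ad 1 a (dif D 0 a)) =
    dif D 0 (dexp_ad 0 a (dl 0 a)) +
    br D 0 1 (dexp_ad 0 a (dl 0 a)) (dexp_ad 1 a (dif D 0 a)).
Proof.
move=> ga fa dlP dl_a comm; rewrite !dexp_adE.
have gb : gr D 1 (dif D 0 a) := dif_gr (fdgla_axioms D) ga.
have gc : gr D 0 (dl 0 a) := gmap_gr (dlP 0) ga.
have dif_a i x : gr D i x ->
    dif D i (br D 0 i a x) = br D 1 i (dif D 0 a) x + br D 0 (i + 1) a (dif D i x).
  exact: dif_ad.
have [s1 ->] := summable_defect ga fa dlP dl_a dexp_coef gb.
have [s2 ->] := summable_defect ga fa (gmap_dif D) dif_a dexp_coef gc.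
rewrite comm !addr0 -[0 + 1]/(1 : int) -addrA; congr (_ + _).
rewrite br_adser // addr0 in s1 *; rewrite -[0 + 1]/(1 : int) in s2 *.
apply/eqP; rewrite addrC -subr_eq -scaleN1r addrC; apply/eqP.
rewrite -gsumD //; apply: eq_gsum => n; rewrite scaleN1r addrC -scalerBr.
set c := dl 0 a in gc *; set b := dif D 0 a in gb *.
have gb' r := iter_ad_gr r ga gb; have gc' r := iter_ad_gr r ga gc.
pose w (r : nat) := br D 0 1 (iter r (br D 0 0 a) c) (iter (n - r) (br D 0 1 a) b).
have -> : deriv_defect 1 (dif D) a 0 c n = - \sum_(r < n.+1) w r *+ 'C(n.+1, r).
  rewrite /deriv_defect (reindex_inj rev_ord_inj) -sumrN.
  apply: eq_bigr => r _; have ler : (r <= n)%N by rewrite -ltnS.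
  rewrite /= (br_antisym (fdgla_axioms D)) // mulr0 scale1r mulNrn.
  have -> : (n - (n.+1 - r.+1) = r)%N by lia.
  by rewrite subSS -subSn // bin_sub // ltnW.
have -> : deriv_defect 0 dl a 1 b n = \sum_(r < n.+1) w r *+ 'C(n.+1, r.+1) by [].
rewrite opprK -big_split scaler_sumr; apply: eq_bigr => r _ /=.
rewrite -mulrnDr -binS -scaler_nat scalerA.
have ler : (r <= n)%N by rewrite -ltnS.
by rewrite bin_coef; [rewrite subSS subSn | rewrite ltnS leqW].
Qed.

End ExpAd.

(** * Homotopies and gauge transformations *)

Section Homotopy.
Variables (K : fieldType) (charK0 : [pchar K] =i pred0) (D : fdgla K).
Local Notation T := (tser charK0 D).
Implicit Types (i j n : int) (p q l A : T) (x y : D).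

Lemma tder_gr i p : gr T i p -> gr T i (tder p).
Proof. exact: (gmap_gr (gmap_tder charK0 D i)). Qed.

Let gmap_tder0 i : @gmap K T T i (i + 0) (@tder K D).
Proof. by rewrite addr0; apply: gmap_tder. Qed.

Lemma tderM i j p q : gr T i p -> gr T j q ->
  tder (br T i j p q) = br T i j (tder p) q + br T i j p (tder q).
Proof. by move=> [hp _] [hq _]; apply: tder_br. Qed.

Lemma tder_difC i p : gr T i p -> tder (dif T i p) = dif T i (tder p).
Proof. by move=> [hp _]; apply: tder_dif. Qed.

Let tder_ad A (gA : gr T 0 A) i p : gr T i p ->
  tder (br T 0 i A p) = br T 0 i (tder A) p + br T 0 (i + 0) A (tder p).
Proof. by move=> gp; rewrite addr0 tderM. Qed.

Lemma tder_exp_ad i A p : gr T 0 A -> fil T 1 A -> gr T i p ->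
  tder (exp_ad i A p) = exp_ad i A (tder p)
    + br T 0 i (dexp_ad 0 A (tder A)) (exp_ad i A p).
Proof.
move=> gA fA gp.
have := deriv_exp_ad charK0 gA fA gmap_tder0 (tder_ad gA) gp.
by rewrite addr0.
Qed.

Lemma tder_dexp_dif A : gr T 0 A -> fil T 1 A ->
  tder (dexp_ad 1 A (dif T 0 A)) = dif T 0 (dexp_ad 0 A (tder A)) +
    br T 0 1 (dexp_ad 0 A (tder A)) (dexp_ad 1 A (dif T 0 A)).
Proof.
move=> gA fA; apply: (dexp_structure charK0 gA fA gmap_tder0 (tder_ad gA)).
exact: tder_difC.
Qed.

Lemma dif_exp_ad (E : fdgla K) i (a x : E) : gr E 0 a -> fil E 1 a -> gr E i x ->
  dif E i (exp_ad i a x) = exp_ad (i + 1) a (dif E i x)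
    + br E 1 i (dexp_ad 1 a (dif E 0 a)) (exp_ad i a x).
Proof.
move=> ga fa gx; apply: (deriv_exp_ad charK0 ga fa (gmap_dif E)) => // j y gy.
exact: dif_ad.
Qed.

Lemma gmap_exp_ad (E : fdgla K) i (a : E) : gr E 0 a -> fil E 1 a ->
  gmap i i (exp_ad i a).
Proof. by move=> ga fa; apply: gmap_adser. Qed.

Lemma gmap_dexp_ad (E : fdgla K) i (a : E) : gr E 0 a -> fil E 1 a ->
  gmap i i (dexp_ad i a).
Proof. by move=> ga fa; apply: gmap_adser. Qed.

Definition flow p l := tder p = - dif T 0 l + br T 0 1 l p.

Lemma tser_fun0 i A c p : gr T 0 A -> fil T 1 A -> gr T i p -> A 0%N = 0 ->
  (adser c i A p) 0%N = c 0%N *: p 0%N.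
Proof.
move=> gA fA gp A0.
rewrite (gmap_adser_comm (E := D) (b := 0) c (gmap_coef charK0 D i 0) gA fA gp).
  by apply: adser_zero; case: gp.
by move=> q [gq _]; rewrite /= big_ord1 A0.
Qed.

Lemma exp_coef0 : exp_coef K 0 = 1. Proof. by rewrite /exp_coef invr1. Qed.

(** A path driven by the logarithmic derivative of exp(A) is the gauge orbit
    of its starting point under exp(A): both solve the same linear equation. *)
Lemma flow_gauge p l A : gr T 1 p -> gr T 0 l -> flow p l ->
  gr T 0 A -> fil T 1 A -> A 0%N = 0 -> l = dexp_ad 0 A (tder A) ->
  p = gauge_act A (tconst charK0 (p 0%N)).
Proof.
move=> gp gl hf gA fA A0 el; set c := tconst _ _.
have gc : gr T 1 c by apply: tconst_gr; case: gp.
have gdA : gr T 1 (dif T 0 A) := dif_gr (fdgla_axioms T) gA.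
have ge : gr T 1 (exp_ad 1 A c) by apply: adser_gr.
have gw : gr T 1 (dexp_ad 1 A (dif T 0 A)) by apply: adser_gr.
have gq : gr T 1 (gauge_act A c) by apply: gauge_act_gr.
apply: subr0_eq.
apply: (@linear_ode_uniq _ charK0 _ 1 _ l).
- by case: gl.
- by case: (grB gp gq).
- rewrite /gauge_act !tserE exp_adE dexp_adE !tser_fun0 //.
  have -> : dif T 0 A 0%N = 0 by rewrite /= A0; apply: (gmap0 (gmap_dif D 0)).
  by rewrite exp_coef0 scale1r scaler0 subr0 subrr.
rewrite (gmapB (gmap_tder charK0 D 1)) // (gmapB (gmap_tder charK0 D 1)) //.
rewrite hf tder_exp_ad // tder_const tder_dexp_dif // -el.
rewrite (gmap0 (gmap_exp_ad 1 gA fA)).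
rewrite -/(br T 0 1 l (p - gauge_act A c)) (gmapB (gmap_brr 1 gl)) //.
rewrite [in RHS](gmapB (gmap_brr 1 gl)) //; lmod.
Qed.

(** The Maurer-Cartan equation propagates along a homotopy: the curvature
    satisfies a linear equation. *)
Lemma flow_maurer_cartan p l : gr T 1 p -> gr T 0 l -> flow p l ->
  dif D 1 (p 0%N) + (2%:R : K)^-1 *: br D 1 1 (p 0%N) (p 0%N) = 0 ->
  dif T 1 p + (2%:R : K)^-1 *: br T 1 1 p p = 0.
Proof.
move=> gp gl hf mc0.
have gdp := dif_gr (fdgla_axioms T) gp.
have gpp := br_gr (fdgla_axioms T) gp gp.
have gp' := tder_gr gp.
have gdl : gr T 1 (dif T 0 l) := dif_gr (fdgla_axioms T) gl.
have glp : gr T 1 (br T 0 1 l p) := br_gr (fdgla_axioms T) gl gp.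
have anti q : gr T 1 q -> br T 1 1 p q = br T 1 1 q p.
  move=> gq; rewrite (br_antisym (fdgla_axioms T)) //.
  by rewrite mulr1 scaleN1r opprK.
have n2 : (2%:R : K) != 0 by apply: natS_neq0.
apply: (@linear_ode_uniq _ charK0 _ 2 _ l).
- by case: gl.
- have : gr T 2 (dif T 1 p + (2%:R : K)^-1 *: br T 1 1 p p).
    by apply: grD => //; apply: grZ.
  by case.
- by rewrite !tserE /= big_ord1.
have gm := gmap_tder charK0 D 2.
rewrite (gmapD gm) //; last exact: grZ.
rewrite (gmapZ gm) // tder_difC // tderM // anti //.
rewrite [in RHS](gmapD (gmap_brr 2 gl)) //; last exact: grZ.
rewrite [in RHS](gmapZ (gmap_brr 2 gl)) //.
have -> : dif T 1 (tder p) = br T 1 1 (dif T 0 l) p + br T 0 2 l (dif T 1 p).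
  rewrite hf (gmapD (gmap_dif T 1)) //; last exact: grN.
  have ddl : dif T 1 (dif T 0 l) = 0 := dif_dif (fdgla_axioms T) gl.
  rewrite (gmapN (gmap_dif T 1)) // ddl oppr0 add0r.
  exact: (dif_ad gl gp).
have -> : br T 0 2 l (br T 1 1 p p) = br T 1 1 (br T 0 1 l p) p *+ 2.
  by rewrite (ad_br gl gp gp) anti // mulr2n.
have -> : br T 1 1 (tder p) p = - br T 1 1 (dif T 0 l) p + br T 1 1 (br T 0 1 l p) p.
  rewrite hf (gmapD (gmap_brl 1 gp)) ?(gmapN (gmap_brl 1 gp)) //; exact: grN.
rewrite -!scaler_nat -mulr2n -scaler_nat !scalerA mulVf // !scale1r; lmod.
Qed.


(** Gauge transformation of a homotopy by exp(-A).  Conjugation by exp(-[A, .])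
    turns d - [w, .] into d and d/dt - [l0, .] into d/dt, where w and l0 are the
    logarithmic derivatives of exp(A) along d and d/dt; the path equation
    expresses that d + [p, .] and d/dt - [l, .] commute. *)
Lemma flow_transform p l A : gr T 1 p -> gr T 0 l -> flow p l ->
  gr T 0 A -> fil T 1 A ->
  flow (exp_ad 1 (- A) (p + dexp_ad 1 A (dif T 0 A)))
       (exp_ad 0 (- A) (l - dexp_ad 0 A (tder A))).
Proof.
move=> gp gl hf gA fA; have gnA := grN gA; have fnA := filN fA.
set w := dexp_ad 1 A (dif T 0 A); set l0 := dexp_ad 0 A (tder A).
have gw : gr T 1 w := gsum_gr _ _; have gl0 : gr T 0 l0 := gsum_gr _ _.
have gdA : gr T 1 (dif T 0 A) := dif_gr (fdgla_axioms T) gA.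
have gA' := tder_gr gA.
have gpw := grD gp gw; have gll := grB gl gl0.
have gb i j (q r : T) gq gr_ : gr T (i + j) (br T i j q r) :=
  br_gr (fdgla_axioms T) gq gr_.
have tder_e q : gr T 1 q ->
    tder (exp_ad 1 (- A) q) = exp_ad 1 (- A) (tder q - br T 0 1 l0 q).
  move=> gq; rewrite tder_exp_ad // (gmapN (gmap_tder charK0 D 0)) //.
  rewrite (gmapN (gmap_dexp_ad 0 gnA fnA)) //.
  rewrite dexp_ad_opp // -/l0.
  rewrite (gmapN (gmap_brl 0 (gsum_gr _ _))); last exact: gsum_gr.
  rewrite (gmapB (gmap_exp_ad 1 gnA fnA)); try exact: tder_gr.
    by congr (_ - _); rewrite -(exp_ad_br charK0 gnA fnA gl0 gq).
  exact: (gb 0 1).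
have dif_e q : gr T 0 q ->
    dif T 0 (exp_ad 0 (- A) q) = exp_ad 1 (- A) (dif T 0 q - br T 1 0 w q).
  move=> gq; rewrite dif_exp_ad // (gmapN (gmap_dif T 0)) //.
  rewrite (gmapN (gmap_dexp_ad 1 gnA fnA)) //.
  rewrite dexp_ad_opp // -/w.
  rewrite (gmapN (gmap_brl 1 (gsum_gr _ _))); last exact: gsum_gr.
  have gdq : gr T 1 (dif T 0 q) := dif_gr (fdgla_axioms T) gq.
  rewrite (gmapB (gmap_exp_ad 1 gnA fnA)) //; last exact: (gb 1 0).
  by congr (_ - _); rewrite -(exp_ad_br charK0 gnA fnA gw gq).
have anti q : gr T 0 q -> br T 1 0 w q = - br T 0 1 q w.
  by move=> gq; rewrite (br_antisym (fdgla_axioms T)) // mulr0 scale1r.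
have gE := gmap_exp_ad 1 gnA fnA.
have gdll : gr T 1 (dif T 0 (l - l0)) := dif_gr (fdgla_axioms T) gll.
have gbw : gr T 1 (br T 1 0 w (l - l0)) := gb 1 0 _ _ gw gll.
have gbpw : gr T 1 (br T 0 1 (l - l0) (p + w)) := gb 0 1 _ _ gll gpw.
rewrite /flow tder_e // dif_e // -(exp_ad_br charK0 gnA fnA gll gpw).
rewrite -[0 + 1]/(1 : int) -(gmapN gE); last exact: (grB gdll gbw).
rewrite -(gmapD gE) //; last exact: (grN (grB gdll gbw)).
congr (exp_ad 1 _ _).
rewrite (gmapD (gmap_tder charK0 D 1)) // hf tder_dexp_dif // -/l0 -/w.
rewrite anti // (gmapB (gmap_dif T 0)) //.
rewrite !(gmapB (gmap_brl 0 _)) // !(gmapD (gmap_brr 1 _)) //; lmod.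
Qed.

(** The logarithm of a generator.  The equation l = dexp_A(A') reads
    A' = l - (terms with at least one bracket with A), and integrating the
    right-hand side is a contraction for the filtration, since A lies in its
    first step. *)
Section Logarithm.
Variable l : T.
Hypotheses (gl : gr T 0 l) (fl : fil T 1 l).

Definition tint p : T := fun k => if k is k'.+1 then (k'.+1%:R : K)^-1 *: p k' else 0.

Definition log_step A : T := tint (l - (dexp_ad 0 A (tder A) - tder A)).

Let admissible A := gr T 0 A /\ fil T 1 A.

Lemma tint_gr i p : gr T i p -> gr T i (tint p).
Proof.
move=> [hp np]; split=> [[|k]|n]; [exact: gr0 | exact: grZ |].
have [N hN] := np n; exists N.+1 => -[//|k] le.
by apply: filZ; apply: hN.
Qed.

Lemma tint_fil n p : fil T n p -> fil T n (tint p).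
Proof. by move=> hp [|k]; [apply: fil0 | apply: filZ; apply: hp]. Qed.

Lemma tintK p : tder (tint p) = p.
Proof.
apply: funext => k; rewrite /tder /= -scaler_nat scalerA divff ?scale1r //.
exact: natS_neq0.
Qed.

Lemma tintB p q : tint (p - q) = tint p - tint q.
Proof.
by apply: funext => -[|k]; rewrite tserE /= ?subr0 // tserE /= scalerBr.
Qed.

Lemma log_step_admissible A : admissible A -> admissible (log_step A).
Proof.
move=> [gA fA]; have gA' := tder_gr gA.
have fA' := fil_tder fA.
split; first by apply: tint_gr; do 2!apply: grB => //; apply: gsum_gr.
by apply: tint_fil; do 2!apply: filB => //; apply: adser_fil.
Qed.

Lemma log_step_contracts A B n : admissible A -> admissible B ->
  fil T n (A - B) -> fil T (n + 1) (log_step A - log_step B).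
Proof.
move=> [gA fA] [gB fB] h; have gA' := tder_gr gA; have gB' := tder_gr gB.
have fA' := fil_tder fA.
have h' : fil T n (tder A - tder B).
  by rewrite -(gmapB (gmap_tder charK0 D 0)) //; apply: fil_tder.
rewrite /log_step -tintB; apply: tint_fil.
have -> : l - (dexp_ad 0 A (tder A) - tder A) - (l - (dexp_ad 0 B (tder B) - tder B))
  = (dexp_ad 0 B (tder B) - tder B) - (dexp_ad 0 A (tder A) - tder A) by lmod.
rewrite -opprB; apply: filN.
have sA := adser_summable gA fA (dexp_coef K) gA'.
have sB := adser_summable gB fB (dexp_coef K) gB'.
have tail (u : nat -> T) : summable 0 u -> gsum 0 u - u 0%N = gsum 0 (u \o S).
  by move=> su; rewrite gsum_head // addrC addKr.
have e1 : dexp_coef K 0 = 1 by rewrite /dexp_coef invr1.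
have := tail _ sA; have := tail _ sB; rewrite !e1 !scale1r => eB eA.
rewrite [dexp_ad 0 A _ - _]eA [dexp_ad 0 B _ - _]eB.
have sS (u : nat -> T) : summable 0 u -> summable 0 (u \o S).
  move=> [gu nu]; split=> [k|m]; first exact: gu.
  by have [N hN] := nu m; exists N => k le; apply: hN; apply: leqW.
rewrite -gsumB; try exact: sS.
apply: gsum_fil => [|k]; first by apply: summableB; apply: sS.
rewrite -scalerBr; apply: filZ.
elim: k => [|k IH].
  rewrite -[_ - _]/(br T 0 0 A (tder A) - br T 0 0 B (tder B)).
  have -> : br T 0 0 A (tder A) - br T 0 0 B (tder B) =
      br T 0 0 (A - B) (tder A) + br T 0 0 B (tder A - tder B).
    rewrite (gmapB (gmap_brl 0 gA')) // (gmapB (gmap_brr 0 gB)) //; lmod.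
  apply: filD; first by apply: (fil_br (fdgla_axioms T)) => //; apply: grB.
  by rewrite addrC; apply: (fil_br (fdgla_axioms T)) => //; apply: grB.
rewrite iterS [iter k.+2 _ (tder B)]iterS.
set X := iter k.+1 _ (tder A) in IH *; set Y := iter k.+1 _ (tder B) in IH *.
have gX : gr T 0 X by apply: iter_ad_gr.
have gY : gr T 0 Y by apply: iter_ad_gr.
have -> : br T 0 0 A X - br T 0 0 B Y = br T 0 0 (A - B) X + br T 0 0 B (X - Y).
  rewrite (gmapB (gmap_brl 0 gX)) // (gmapB (gmap_brr 0 gB)) //; lmod.
apply: filD.
  apply: (fil_br (fdgla_axioms T)) => //; first exact: grB.
  by apply: (fil_le _ (iter_ad_fil k.+1 gA fA gA' fA')); lia.
apply: (@fil_le _ _ _ (1 + (n + 1))); first by lia.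
by apply: (fil_br (fdgla_axioms T)) => //; apply: grB.
Qed.

Lemma log_exists : exists A, [/\ gr T 0 A, fil T 1 A, A 0%N = 0 &
  l = dexp_ad 0 A (tder A)].
Proof.
pose B k := iter k log_step 0.
have adB k : admissible (B k).
  elim: k => [|k IH] /=; last exact: log_step_admissible.
  by split; [apply: gr0 | apply: fil0].
have stepB (k : nat) : fil T k%:Z (B k.+1 - B k).
  elim: k => [|k IH].
    rewrite subr0; apply: (@fil_le _ _ _ 1) => //.
    by case: (log_step_admissible (adB 0%N)).
  by have := log_step_contracts (adB k.+1) (adB k) IH; rewrite -PoszD addn1.
have [||A gA hA] := @fil_complete _ _ (fdgla_axioms T) 0
    (fun n => if n is Posz k then B k else 0).
- by case=> k; [case: (adB k) | apply: gr0].
- case=> [k|[|k]]; first by rewrite -PoszD addn1; apply: stepB.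
    by rewrite subrr; apply: fil0.
  have -> : Negz k.+1 + 1 = Negz k by lia.
  by rewrite subrr; apply: fil0.
have fA : fil T 1 A.
  rewrite -(subrK (B 1%N) A); apply: filD; first exact: (hA 1).
  by case: (adB 1%N).
have eA : A = log_step A.
  have [gA1 fA1] := log_step_admissible (conj gA fA).
  apply: (fil_eq gA gA1) => -[k|k]; last first.
    by apply: (@fil_le _ _ _ 1) => //; apply: filB.
  have -> : A - log_step A = (A - B k.+1) + (B k.+1 - log_step A).
    by rewrite addrA subrK.
  apply: filD; first by apply: (fil_le _ (hA k.+1)); lia.
  apply: (@fil_le _ _ _ (k%:Z + 1)); first by lia.
  rewrite -opprB; apply: filN; exact: log_step_contracts.
exists A; split=> //; first by rewrite eA.
have e : tder A = l - (dexp_ad 0 A (tder A) - tder A) by rewrite {1}eA tintK.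
apply: subr0_eq; set X := dexp_ad 0 A (tder A) in e *.
have -> : l - X = l - (X - tder A) - tder A by lmod.
by rewrite -e subrr.
Qed.
End Logarithm.

Lemma teval_adser c i A p t : gr T 0 A -> fil T 1 A -> gr T i p ->
  teval i (adser c i A p) t = adser c i (teval 0 A t) (teval i p t).
Proof.
move=> gA fA gp.
apply: (gmap_adser_comm (E := D) c (gmap_teval charK0 D i t) gA fA gp) => q gq.
by rewrite -teval_br // add0r.
Qed.

Lemma teval_gauge A p t : gr T 0 A -> fil T 1 A -> gr T 1 p ->
  teval 1 (gauge_act A p) t = gauge_act (teval 0 A t) (teval 1 p t).
Proof.
move=> gA fA gp; have gdA : gr T 1 (dif T 0 A) := dif_gr (fdgla_axioms T) gA.
rewrite /gauge_act (gmapB (gmap_teval charK0 D 1 t)); try exact: gsum_gr.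
rewrite exp_adE dexp_adE !teval_adser //.
have e : teval 1 (dif T 0 A) t = dif D 0 (teval 0 A t) := teval_dif t gA.
by rewrite e.
Qed.

(** The gauge parameter is A(1), where the generator of the homotopy is the
    logarithmic derivative of exp(A(t)). *)
Lemma homotopic_gauge x y : homotopic_step x y -> gauge_equivalent x y.
Proof.
move=> [mcx mcy [p [l [[gp fp] [gl fl] hf px py]]]]; split=> //.
have [A [gA fA A0 eA]] := log_exists gl fl.
exists (teval 0 A 1); split; [exact: gsum_gr | exact: (teval_fil 1 gA fA) |].
have gx : gr D 1 (p 0%N) by case: gp.
rewrite -py {1}(flow_gauge gp gl hf gA fA A0 eA) teval_gauge //; last exact: tconst_gr.
by rewrite teval_const // -px (teval0 gp).
Qed.

Lemma flow_mc_end p l t : gr T 1 p -> fil T 1 p -> gr T 0 l -> flow p l ->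
  maurer_cartan (p 0%N) -> maurer_cartan (teval 1 p t).
Proof.
move=> gp fp gl hf [_ _ mc0]; split; [exact: gsum_gr | exact: (teval_fil t gp fp) |].
have := congr1 (fun q => teval 2 q t) (flow_maurer_cartan gp gl hf mc0).
have gdp : gr T 2 (dif T 1 p) := dif_gr (fdgla_axioms T) gp.
have gpp : gr T 2 (br T 1 1 p p) := br_gr (fdgla_axioms T) gp gp.
have gm := gmap_teval charK0 D 2 t.
rewrite (gmap0 gm) addrC (gmap_lin gm) // addrC.
have e1 : teval 2 (dif T 1 p) t = dif D 1 (teval 1 p t) := teval_dif t gp.
have e2 : teval 2 (br T 1 1 p p) t = br D 1 1 (teval 1 p t) (teval 1 p t).
  exact: (teval_br t gp gp).
by rewrite e1 e2.
Qed.

End Homotopy.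

(** * Cochains on the symmetric coalgebra with counit *)

Section Signs.
Variable K : fieldType.
Implicit Types i j : int.

Definition parity i := odd (absz i).

Lemma ksignE i : ksign K i = (-1) ^+ parity i.
Proof. by rewrite /ksign signr_odd. Qed.

Lemma parityD i j : parity (i + j) = parity i (+) parity j.
Proof. rewrite /parity; lia. Qed.

Lemma parityM i j : parity (i * j) = parity i && parity j.
Proof. by rewrite /parity abszM oddM. Qed.

Lemma parityN i : parity (- i) = parity i.
Proof. by rewrite /parity abszN. Qed.

Lemma parity0 : parity 0 = false. Proof. by []. Qed.
Lemma parity1 : parity 1 = true. Proof. by []. Qed.
Lemma parity2 : parity 2 = false. Proof. by []. Qed.

Definition parityE := (parityD, parityM, parityN, parity0, parity1, parity2).
End Signs.

(* Linear identities whose coefficients are signs: all parities are tried. *)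
Ltac ksigns :=
  rewrite ?ksignE ?parityE;
  repeat match goal with |- context [parity ?x] => case: (parity x) end;
  rewrite /= ?expr0 ?expr1; lmod.

Section HomogeneousElements.
Variables (K : fieldType) (g : fdgla K).

Lemma hel_eq (x y : hel g) : hdeg x = hdeg y -> hval x = hval y -> x = y.
Proof.
case: x y => [i v h] [j w h'] /= eij evw.
by case: j / eij h' => h'; case: w / evw h' => h'; rewrite (Prop_irrelevance h h').
Qed.

(* The value is 0 when v does not have degree i. *)
Definition mkhel i (v : g) : hel g :=
  match pselect (gr g i v) with left h => Hel h | right _ => Hel (gr0 g i) end.

Lemma hdeg_mkhel i v : hdeg (mkhel i v) = i.
Proof. by rewrite /mkhel; case: pselect. Qed.

Lemma hval_mkhel i v : gr g i v -> hval (mkhel i v) = v.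
Proof. by rewrite /mkhel; case: pselect. Qed.

Lemma mkhelK x : mkhel (hdeg x) (hval x) = x.
Proof. by apply: hel_eq; rewrite ?hdeg_mkhel ?hval_mkhel //; apply: hgr. Qed.

Lemma sdegs_cons (x : hel g) s : sdegs (x :: s) = sdeg x + sdegs s.
Proof. by rewrite /sdegs big_cons. Qed.

Lemma sdegs_nil : sdegs ([::] : seq (hel g)) = 0.
Proof. by rewrite /sdegs big_nil. Qed.

Lemma sdegs_cat (s1 s2 : seq (hel g)) : sdegs (s1 ++ s2) = sdegs s1 + sdegs s2.
Proof. by rewrite /sdegs big_cat. Qed.

Fixpoint fbound (s : seq (hel g)) (p : seq int) : Prop :=
  match s, p with
  | x :: s', n :: p' => fil g n (hval x) /\ fbound s' p'
  | [::], [::] => True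
  | _, _ => False
  end.

Lemma fbound_exists s : exists p, fbound s p.
Proof.
elim: s => [|x s [p hp]]; first by exists [::].
by have [n hn] := fil_exhaustive (fdgla_axioms g) (hgr x); exists (n :: p).
Qed.
End HomogeneousElements.

Section Cochains.
Variables (K : fieldType) (g g' : fdgla K).
Local Notation cochain := (cochain g g').
Implicit Types (F G H : cochain) (x y z : hel g) (s : seq (hel g)) (k l m c : int).

(** Contraction with x.  Cochains on a list are studied through their
    contractions, as power series are through their derivatives: an identity is
    proved by induction on the list, for all cochains simultaneously. *)
Definition ctr x F : cochain := fun s => F (x :: s).

Definition has_deg k F := forall s, gr g' (sdegs s + k) (F s).

Record acochain k F : Prop := Acochain {
  ac_lin : multilinear F ; ac_sym : graded_symmetric F ; ac_deg : has_deg k F }.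

(** Filtration bound in which an entry of filtration degree n has weight n - c:
    c = 0 gives the compatibility with the filtrations, c = 1 the steps of the
    filtration that counts arguments as well. *)
Definition wshift c m F := forall s p, fbound s p ->
  fil g' (\sum_(q <- p) (q - c) + m) (F s).

Lemma cochainD F G s : (F + G : cochain) s = F s + G s. Proof. by []. Qed.
Lemma cochainN F s : (- F : cochain) s = - F s. Proof. by []. Qed.
Lemma cochainZ (a : K) F s : (a *: F : cochain) s = a *: F s. Proof. by []. Qed.
Definition cochainE := (cochainD, cochainN, cochainZ).

Lemma ctr_lin x (a : K) F G : ctr x (a *: F + G) = a *: ctr x F + ctr x G.
Proof. by []. Qed.

Lemma deg_ctr k x F : has_deg k F -> has_deg (k + sdeg x) (ctr x F).
Proof.
move=> h s; have := h (x :: s); rewrite sdegs_cons.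
by have -> : sdeg x + sdegs s + k = sdegs s + (k + sdeg x) by lia.
Qed.

Lemma deg_lin k (a : K) F G : has_deg k F -> has_deg k G -> has_deg k (a *: F + G).
Proof. by move=> hF hG s; apply: grD; [apply: grZ; apply: hF | apply: hG]. Qed.

Lemma ctrC F x y : graded_symmetric F ->
  ctr y (ctr x F) = ksign K (sdeg x * sdeg y) *: ctr x (ctr y F).
Proof. by move=> h; apply: funext => s; apply: (h [::]). Qed.

Lemma ctr_rel F x y z (a : K) : multilinear F -> hdeg x = hdeg z ->
  hdeg y = hdeg z -> hval z = a *: hval x + hval y ->
  ctr z F = a *: ctr x F + ctr y F.
Proof. by move=> h e1 e2 e; apply: funext => s; apply: (h [::]). Qed.

Lemma ac_ctr k x F : acochain k F -> acochain (k + sdeg x) (ctr x F).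
Proof.
move=> [hl hs hd]; split; last exact: deg_ctr.
  by move=> s1 s2 y z t a e1 e2 e; apply: (hl (x :: s1)).
by move=> s1 s2 y z; apply: (hs (x :: s1)).
Qed.

Lemma ac_lincomb k (a : K) F G : acochain k F -> acochain k G ->
  acochain k (a *: F + G).
Proof.
move=> [hl hs hd] [hl' hs' hd']; split; last exact: deg_lin.
  move=> s1 s2 x y z b e1 e2 e; rewrite !cochainE.
  by rewrite (hl _ _ x y z b) // (hl' _ _ x y z b) //; lmod.
move=> s1 s2 x y; rewrite !cochainE (hs s1 s2 x y) (hs' s1 s2 x y); lmod.
Qed.

Lemma wshift_ctr c m n x F : wshift c m F -> fil g n (hval x) ->
  wshift c (m + (n - c)) (ctr x F).
Proof.
move=> h hx s p hp; have := h (x :: s) (n :: p) (conj hx hp).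
rewrite big_cons; set S := \sum_(_ <- _) _.
by have -> : n - c + S + m = S + (m + (n - c)) by lia.
Qed.

Lemma wshift_lin c m (a : K) F G : wshift c m F -> wshift c m G ->
  wshift c m (a *: F + G).
Proof.
by move=> hF hG s p hp; apply: filD; [apply: filZ; apply: hF | apply: hG].
Qed.

Lemma wshift_le c m m' F : m' <= m -> wshift c m F -> wshift c m' F.
Proof. by move=> le h s p hp; apply: (fil_le _ (h s p hp)); lia. Qed.

(** ** The bracket *)

(** The sum over all ways of distributing s between F and G, including the
    trivial ones. *)
Fixpoint cbr k l F G s : g' :=
  if s is x :: s' then
    ksign K (l * sdeg x) *: cbr (k + sdeg x) l (ctr x F) G s'
    + cbr k (l + sdeg x) F (ctr x G) s'
  else br g' k l (F [::]) (G [::]).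

Lemma ctr_cbr k l F G x : ctr x (cbr k l F G) =
  ksign K (l * sdeg x) *: cbr (k + sdeg x) l (ctr x F) G
    + cbr k (l + sdeg x) F (ctr x G).
Proof. by []. Qed.

Lemma deg_nil k F : has_deg k F -> gr g' k (F [::]).
Proof. by move=> h; have := h [::]; rewrite sdegs_nil add0r. Qed.

Lemma cbr_deg k l F G : has_deg k F -> has_deg l G ->
  has_deg (k + l) (cbr k l F G).
Proof.
move=> hF hG s; elim: s k l F G hF hG => [|x s IH] k l F G hF hG.
  rewrite sdegs_nil add0r; apply: (br_gr (fdgla_axioms g')); exact: deg_nil.
rewrite sdegs_cons; apply: grD.
  have -> : sdeg x + sdegs s + (k + l) = sdegs s + (k + sdeg x + l) by lia.
  by apply: grZ; apply: IH => //; apply: deg_ctr.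
have -> : sdeg x + sdegs s + (k + l) = sdegs s + (k + (l + sdeg x)) by lia.
by apply: IH => //; apply: deg_ctr.
Qed.

Lemma cbr_linl k l (a : K) F F' G s : has_deg k F -> has_deg k F' -> has_deg l G ->
  cbr k l (a *: F + F') G s = a *: cbr k l F G s + cbr k l F' G s.
Proof.
elim: s k l F F' G => [|x s IH] k l F F' G hF hF' hG /=.
  by rewrite (gmap_lin (gmap_brl k (deg_nil hG))) //; apply: deg_nil.
have := deg_ctr x hF; have := deg_ctr x hF'; have := deg_ctr x hG.
move=> hG1 hF1' hF1; rewrite ctr_lin !IH //; lmod.
Qed.

Lemma cbr_linr k l (a : K) F G G' s : has_deg k F -> has_deg l G -> has_deg l G' ->
  cbr k l F (a *: G + G') s = a *: cbr k l F G s + cbr k l F G' s.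
Proof.
elim: s k l F G G' => [|x s IH] k l F G G' hF hG hG' /=.
  by rewrite (gmap_lin (gmap_brr l (deg_nil hF))) //; apply: deg_nil.
have := deg_ctr x hF; have := deg_ctr x hG'; have := deg_ctr x hG.
move=> hG1 hG1' hF1; rewrite ctr_lin !IH //; lmod.
Qed.

Lemma cbr_Zl k l (a : K) F G s : has_deg k F -> has_deg l G ->
  cbr k l (a *: F) G s = a *: cbr k l F G s.
Proof.
elim: s k l F G => [|x s IH] k l F G hF hG /=.
  by rewrite (gmapZ (gmap_brl k (deg_nil hG))) //; apply: deg_nil.
have := deg_ctr x hF; have := deg_ctr x hG => hG1 hF1.
rewrite -![ctr x (a *: F)]/(a *: ctr x F) !IH //; lmod.
Qed.

Lemma cbr_Zr k l (a : K) F G s : has_deg k F -> has_deg l G ->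
  cbr k l F (a *: G) s = a *: cbr k l F G s.
Proof.
elim: s k l F G => [|x s IH] k l F G hF hG /=.
  by rewrite (gmapZ (gmap_brr l (deg_nil hF))) //; apply: deg_nil.
have := deg_ctr x hF; have := deg_ctr x hG => hG1 hF1.
rewrite -![ctr x (a *: G)]/(a *: ctr x G) !IH //; lmod.
Qed.

Lemma cbr_antisym k l F G s : has_deg k F -> has_deg l G ->
  cbr k l F G s = - (ksign K (k * l) *: cbr l k G F s).
Proof.
elim: s k l F G => [|x s IH] k l F G hF hG /=.
  by rewrite (br_antisym (fdgla_axioms g')) //; apply: deg_nil.
have := deg_ctr x hF; have := deg_ctr x hG => hG1 hF1.
rewrite [cbr (k + _) _ _ _ _]IH // [cbr k _ _ _ _]IH //; ksigns.
Qed.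

Lemma cbr_jacobi i j l F G H s : has_deg i F -> has_deg j G -> has_deg l H ->
  cbr i (j + l) F (cbr j l G H) s =
    cbr (i + j) l (cbr i j F G) H s
    + ksign K (i * j) *: cbr j (i + l) G (cbr i l F H) s.
Proof.
elim: s i j l F G H => [|x s IH] i j l F G H hF hG hH.
  by rewrite /= (br_jacobi (fdgla_axioms g')) //; apply: deg_nil.
have hF1 := deg_ctr x hF; have hG1 := deg_ctr x hG; have hH1 := deg_ctr x hH.
have E1 := IH _ _ _ _ _ _ hF1 hG hH; have E2 := IH _ _ _ _ _ _ hF hG1 hH.
have E3 := IH _ _ _ _ _ _ hF hG hH1.
have D p q P Q (hP : has_deg p P) (hQ : has_deg q Q) := cbr_deg hP hQ.
have h1 := D _ _ _ _ hF1 hH; have h2 := D _ _ _ _ hF hH1.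
have h3 := D _ _ _ _ hF1 hG; have h4 := D _ _ _ _ hF hG1.
have h5 := D _ _ _ _ hG1 hH; have h6 := D _ _ _ _ hG hH1.
rewrite [LHS]/= ![cbr _ _ _ _ (x :: s)]/= !ctr_cbr.
set e := sdeg x in E1 E2 E3 h1 h2 h3 h4 h5 h6 hF1 hG1 hH1 *; clearbody e.
rewrite ?addrA ?[_ + e + _]addrAC in E1 E2 E3 h1 h2 h3 h4 h5 h6 *.
rewrite !cbr_linl ?cbr_linr // E1 E2 E3; ksigns.
Qed.


Definition postd k F : cochain := fun s => dif g' (sdegs s + k) (F s).

Lemma ctr_postd k F x : ctr x (postd k F) = postd (k + sdeg x) (ctr x F).
Proof.
apply: funext => s; rewrite /ctr /postd sdegs_cons.
by have -> : sdeg x + sdegs s + k = sdegs s + (k + sdeg x) by lia.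
Qed.

Lemma postd_deg k F : has_deg k F -> has_deg (k + 1) (postd k F).
Proof. by move=> h s; rewrite addrA; apply: (dif_gr (fdgla_axioms g')). Qed.

Lemma postd_lin k (a : K) F G : has_deg k F -> has_deg k G ->
  postd k (a *: F + G) = a *: postd k F + postd k G.
Proof.
by move=> hF hG; apply: funext => s; apply: (dif_linear (fdgla_axioms g')).
Qed.

Lemma postd_cbr k l F G s : has_deg k F -> has_deg l G ->
  postd (k + l) (cbr k l F G) s = cbr (k + 1) l (postd k F) G s
    + ksign K k *: cbr k (l + 1) F (postd l G) s.
Proof.
elim: s k l F G => [|x s IH] k l F G hF hG.
  rewrite /= /postd sdegs_nil !add0r.
  by rewrite (dif_br (fdgla_axioms g')) //; apply: deg_nil.
have hF1 := deg_ctr x hF; have hG1 := deg_ctr x hG.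
have E1 := IH _ _ _ _ hF1 hG; have E2 := IH _ _ _ _ hF hG1.
rewrite -[LHS]/(ctr x (postd (k + l) (cbr k l F G)) s) ctr_postd ctr_cbr.
rewrite ![cbr _ _ _ _ (x :: s)]/= !ctr_postd.
have h1 := cbr_deg hF1 hG; have h2 := cbr_deg hF hG1.
set e := sdeg x in E1 E2 h1 h2 hF1 hG1 *; clearbody e.
rewrite ?addrA ?[_ + 1 + _]addrAC ?[_ + e + _]addrAC in E1 E2 h1 h2 *.
rewrite postd_lin // !cochainE E1 E2; ksigns.
Qed.

Lemma acochain_cbr k l F G : acochain k F -> acochain l G ->
  acochain (k + l) (cbr k l F G).
Proof.
move=> hF hG; split; last exact: (cbr_deg (ac_deg hF) (ac_deg hG)).
  move=> s1; elim: s1 k l F G hF hG => [|t s1 IH] k l F G hF hG s2 x y z a e1 e2 e.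
    have [sx sy] : sdeg x = sdeg z /\ sdeg y = sdeg z by rewrite /sdeg e1 e2.
    rewrite /= (ctr_rel (ac_lin hF) e1 e2 e) (ctr_rel (ac_lin hG) e1 e2 e) sx sy.
    have dF := ac_deg hF; have dG := ac_deg hG.
    have := (deg_ctr x dF, deg_ctr y dF, deg_ctr x dG, deg_ctr y dG).
    by rewrite sx sy => -[[[h1 h2] h3] h4]; rewrite cbr_linl ?cbr_linr //; lmod.
  rewrite /= (IH _ _ _ _ (ac_ctr t hF) hG s2 x y z a) //.
  rewrite (IH _ _ _ _ hF (ac_ctr t hG) s2 x y z a) //; lmod.
move=> s1; elim: s1 k l F G hF hG => [|t s1 IH] k l F G hF hG s2 x y.
  rewrite /= (ctrC x y (ac_sym hF)) (ctrC x y (ac_sym hG)).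
  have dF := ac_deg hF; have dG := ac_deg hG.
  have dFyx := deg_ctr x (deg_ctr y dF); have dGyx := deg_ctr x (deg_ctr y dG).
  rewrite ![_ + sdeg x + sdeg y]addrAC cbr_Zl // cbr_Zr //; ksigns.
rewrite /= (IH _ _ _ _ (ac_ctr t hF) hG) (IH _ _ _ _ hF (ac_ctr t hG)); lmod.
Qed.

Lemma wshift_cbr c k l m n F G : has_deg k F -> has_deg l G ->
  wshift c m F -> wshift c n G -> wshift c (m + n) (cbr k l F G).
Proof.
move=> + + + + s; elim: s k l m n F G => [|x s IH] k l m n F G hF hG wF wG [|q p] //=.
  move=> _; rewrite big_nil add0r.
  have := wF [::] [::] I; have := wG [::] [::] I; rewrite !big_nil !add0r => h2 h1.
  by apply: (fil_br (fdgla_axioms g')) => //; apply: deg_nil.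
move=> [hx hp]; rewrite big_cons; set S := \sum_(_ <- _) _.
apply: filD.
  apply: filZ; have -> : q - c + S + (m + n) = S + (m + (q - c) + n) by lia.
  by apply: IH => //; [apply: deg_ctr | apply: wshift_ctr].
have -> : q - c + S + (m + n) = S + (m + (n + (q - c))) by lia.
by apply: IH => //; [apply: deg_ctr | apply: wshift_ctr].
Qed.

(* The first entry of the list is selected or not; this matches the recursive
   definitions of the bracket and of the composition with sums over masks. *)
Lemma mask_sum_cons (V : zmodType) n (f : bitseq -> V) :
  \sum_(m : n.+1.-tuple bool) f m =
  \sum_(m : n.-tuple bool) (f (true :: m) + f (false :: m)).
Proof.
rewrite (reindex (fun p : bool * n.-tuple bool => [tuple of p.1 :: p.2])) /=; last first.
  exists (fun t => (thead t, [tuple of behead t])) => [[b t] _|t _].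
    by congr (_, _); apply: val_inj.
  by rewrite -tuple_eta.
rewrite -(pair_bigA _ (fun b (m : n.-tuple bool) => f (b :: m))) /=.
by rewrite big_bool /= -big_split.
Qed.

Lemma cbr_sum k l F G s : cbr k l F G s =
  \sum_(m : (size s).-tuple bool) koszul m s *: (ksign K (l * sdegs (mask m s)) *:
    br g' (sdegs (mask m s) + k) (sdegs (unsel m s) + l)
      (F (mask m s)) (G (unsel m s))).
Proof.
elim: s k l F G => [|x s IH] k l F G.
  rewrite (bigD1 [tuple]) //= big1 => [|t]; last by rewrite tuple0.
  by rewrite sdegs_nil !add0r mulr0 !scale1r addr0.
rewrite (mask_sum_cons _ (fun m : bitseq => koszul m (x :: s) *: (ksign K (l * sdegs (mask m (x :: s)))
  *: br g' (sdegs (mask m (x :: s)) + k) (sdegs (unsel m (x :: s)) + l)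
      (F (mask m (x :: s))) (G (unsel m (x :: s)))))).
rewrite /= !IH scaler_sumr -big_split /=; apply: eq_bigr => m _.
rewrite /unsel /= !sdegs_cons.
set s1 := mask m s; set s2 := mask (map negb m) s.
have -> : sdeg x + sdegs s1 + k = sdegs s1 + (k + sdeg x) by lia.
have -> : sdeg x + sdegs s2 + l = sdegs s2 + (l + sdeg x) by lia.
rewrite /ctr; ksigns.
Qed.
End Cochains.

(** * Composition of cochains with coderivations *)

(** The composite of F with the coderivation of degree l - 1 whose corestriction
    to g[1] is V: the sum over all ways of feeding V with a part of the list, F
    taking the result and the rest.  In the language of formal geometry it is
    the Lie derivative of F along the vector field V. *)
Fixpoint vcomp (K : fieldType) (g g' : fdgla K) (l : int) (F : cochain g g')
    (V : cochain g g) (s : seq (hel g)) : g' :=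
  if s is x :: s' then
    vcomp (l + sdeg x) F (ctr x V) s'
    + ksign K ((l - 1) * sdeg x) *: vcomp l (ctr x F) V s'
  else F [:: mkhel l (V [::])].

Section Comp.
Variables (K : fieldType) (g g' : fdgla K).
Local Notation cochain := (cochain g g').
Implicit Types (F G H : cochain) (V W : Defs.cochain g g).
Implicit Types (x y z : hel g) (s : seq (hel g)) (k l m c : int).

Lemma ctr_comp l F V x : ctr x (vcomp l F V) =
  vcomp (l + sdeg x) F (ctr x V) + ksign K ((l - 1) * sdeg x) *: vcomp l (ctr x F) V.
Proof. by []. Qed.

Lemma sdeg_mkhel l (v : g) : sdeg (mkhel l v) = l - 1.
Proof. by rewrite /sdeg hdeg_mkhel. Qed.

Lemma comp_deg k l F V : has_deg k F -> has_deg (k + (l - 1)) (vcomp l F V).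
Proof.
move=> hF s; elim: s k l F V hF => [|x s IH] k l F V hF /=.
  rewrite sdegs_nil add0r; have := hF [:: mkhel l (V [::])].
  by rewrite sdegs_cons sdeg_mkhel sdegs_nil addr0 addrC.
rewrite sdegs_cons; apply: grD.
  have -> : sdeg x + sdegs s + (k + (l - 1)) = sdegs s + (k + (l + sdeg x - 1)) by lia.
  exact: IH.
have -> : sdeg x + sdegs s + (k + (l - 1)) = sdegs s + (k + sdeg x + (l - 1)) by lia.
by apply: grZ; apply: IH; apply: deg_ctr.
Qed.

Lemma comp_linl l (a : K) F G V s :
  vcomp l (a *: F + G) V s = a *: vcomp l F V s + vcomp l G V s.
Proof.
elim: s l F G V => [//|x s IH] l F G V /=.
by rewrite ctr_lin !IH; lmod.
Qed.

Lemma comp_Zl l (a : K) F V s : vcomp l (a *: F) V s = a *: vcomp l F V s.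
Proof.
elim: s l F V => [//|x s IH] l F V /=.
by rewrite -[ctr x (a *: F)]/(a *: ctr x F) !IH; lmod.
Qed.

Lemma comp_linr l (a : K) F V W s : multilinear F -> has_deg l V -> has_deg l W ->
  vcomp l F (a *: V + W) s = a *: vcomp l F V s + vcomp l F W s.
Proof.
elim: s l F V W => [|x s IH] l F V W hF hV hW.
  rewrite [LHS]/= (hF [::] [::] (mkhel l (V [::])) (mkhel l (W [::])) _ a) //.
  - by rewrite !hdeg_mkhel.
  - by rewrite !hdeg_mkhel.
  have h1 := deg_nil hV; have h2 := deg_nil hW.
  by rewrite !hval_mkhel //; exact: (deg_nil (deg_lin a hV hW)).
rewrite ![vcomp _ _ _ (x :: s)]/= ctr_lin IH //; try exact: deg_ctr.
rewrite IH //; first lmod.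
by move=> s1; apply: (hF (x :: s1)).
Qed.

Lemma comp_Zr l (a : K) F V s : multilinear F -> has_deg l V ->
  vcomp l F (a *: V) s = a *: vcomp l F V s.
Proof.
move=> hF hV; have h0 : has_deg l (0 : Defs.cochain g g) by move=> t; apply: gr0.
have E := comp_linr 1 s hF h0 h0; rewrite scale1r addr0 scale1r in E.
have e0 : vcomp l F 0 s = 0 by apply: (addrI (vcomp l F 0 s)); rewrite addr0 -E.
by have := comp_linr a s hF hV h0; rewrite addr0 e0 addr0.
Qed.

Lemma acochain_comp k l F V : acochain k F -> acochain l V ->
  acochain (k + (l - 1)) (vcomp l F V).
Proof.
move=> hF hV; split; last exact: (comp_deg l V (ac_deg hF)).
  move=> s1; elim: s1 k l F V hF hV => [|t s1 IH] k l F V hF hV s2 x y z a e1 e2 e.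
    have [sx sy] : sdeg x = sdeg z /\ sdeg y = sdeg z by rewrite /sdeg e1 e2.
    rewrite /= (ctr_rel (ac_lin hF) e1 e2 e) (ctr_rel (ac_lin hV) e1 e2 e) sx sy.
    have dV := ac_deg hV; have := (deg_ctr x dV, deg_ctr y dV).
    rewrite sx sy => -[h1 h2].
    by rewrite comp_linl comp_linr //; [lmod | exact: ac_lin hF].
  rewrite /= (IH _ _ _ _ hF (ac_ctr t hV) s2 x y z a) //.
  by rewrite (IH _ _ _ _ (ac_ctr t hF) hV s2 x y z a) //; lmod.
move=> s1; elim: s1 k l F V hF hV => [|t s1 IH] k l F V hF hV s2 x y.
  rewrite /= (ctrC x y (ac_sym hF)) (ctrC x y (ac_sym hV)).
  have dV := ac_deg hV; have dVyx := deg_ctr x (deg_ctr y dV).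
  rewrite ![_ + sdeg x + sdeg y]addrAC comp_Zr // ?comp_Zl; last exact: ac_lin hF.
  ksigns.
rewrite /= (IH _ _ _ _ hF (ac_ctr t hV)) (IH _ _ _ _ (ac_ctr t hF) hV); lmod.
Qed.

Lemma wshift_comp c l m e F V : has_deg l V ->
  wshift c m F -> wshift c (e + c) V -> wshift c (m + e) (vcomp l F V).
Proof.
move=> + + + s; elim: s l m e F V => [|x s IH] l m e F V hV wF wV [|q p] //=.
  move=> _; rewrite big_nil add0r; have := wV [::] [::] I; rewrite big_nil add0r => h.
  have := wF [:: mkhel l (V [::])] [:: e + c]; rewrite big_cons big_nil.
  have -> : e + c - c + 0 + m = m + e by lia.
  by apply; split; rewrite //= hval_mkhel //; apply: deg_nil.
move=> [hx hp]; rewrite big_cons; set S := \sum_(_ <- _) _; apply: filD.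
  have -> : q - c + S + (m + e) = S + (m + (e + (q - c))) by lia.
  apply: IH => //; first exact: deg_ctr.
  by rewrite addrAC; apply: wshift_ctr.
apply: filZ; have -> : q - c + S + (m + e) = S + (m + (q - c) + e) by lia.
by apply: IH => //; apply: wshift_ctr.
Qed.

Lemma comp_postd k l F V s : has_deg k F ->
  vcomp l (postd k F) V s = postd (k + (l - 1)) (vcomp l F V) s.
Proof.
elim: s k l F V => [|x s IH] k l F V hF.
  by rewrite /= /postd sdegs_nil sdegs_cons sdeg_mkhel sdegs_nil addr0 add0r addrC.
rewrite -[RHS]/(ctr x (postd (k + (l - 1)) (vcomp l F V)) s) ctr_postd ctr_comp.
rewrite [vcomp _ _ _ (x :: s)]/= ctr_postd !IH //; last exact: deg_ctr.
have h1 : has_deg (k + (l - 1) + sdeg x) (vcomp (l + sdeg x) F (ctr x V)).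
  have -> : k + (l - 1) + sdeg x = k + (l + sdeg x - 1) by lia.
  exact: comp_deg.
have h2 : has_deg (k + (l - 1) + sdeg x) (vcomp l (ctr x F) V).
  by rewrite addrAC; apply: comp_deg; apply: deg_ctr.
rewrite [vcomp _ _ _ + _]addrC postd_lin // cochainE addrC.
have -> : k + sdeg x + (l - 1) = k + (l - 1) + sdeg x by lia.
by have -> : k + (l + sdeg x - 1) = k + (l - 1) + sdeg x by lia.
Qed.

Lemma comp_cbr k l v F G V s : has_deg k F -> has_deg l G ->
  vcomp v (cbr k l F G) V s =
    ksign K (l * (v - 1)) *: cbr (k + (v - 1)) l (vcomp v F V) G s
    + cbr k (l + (v - 1)) F (vcomp v G V) s.
Proof.
elim: s k l v F G V => [|x s IH] k l v F G V hF hG; first by rewrite /= sdeg_mkhel.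
have hF1 := deg_ctr x hF; have hG1 := deg_ctr x hG.
have h1 := comp_deg v V hF1; have h2 := comp_deg v V hG1.
have h3 := comp_deg (v + sdeg x) (ctr x V) hF.
have h4 := comp_deg (v + sdeg x) (ctr x V) hG.
have E1 := IH k l (v + sdeg x) F G (ctr x V) hF hG.
have E2 := IH _ _ v _ _ V hF1 hG; have E3 := IH _ _ v _ _ V hF hG1.
rewrite ![vcomp _ _ _ (x :: s)]/= ctr_cbr comp_linl.
rewrite ![cbr _ _ _ _ (x :: s)]/= !ctr_comp.
set e := sdeg x in E1 E2 E3 h1 h2 h3 h4 hF1 hG1 *; clearbody e.
have ee : v + e - 1 = v - 1 + e by lia.
rewrite !ee in E1 h3 h4 *; set u := v - 1 in E1 E2 E3 h1 h2 h3 h4 *; clearbody u.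
rewrite ?addrA ?[_ + e + _]addrAC in E1 E2 E3 h1 h2 h3 h4 *.
rewrite ![vcomp _ _ _ + _ *: _]addrC.
rewrite cbr_linl // cbr_linr // E1 E2 E3; ksigns.
Qed.

End Comp.

(** In the commutator of two compositions the terms where both fields feed F
    directly cancel, F being graded symmetric. *)
Lemma comp_comp (K : fieldType) (g g' : fdgla K) k v w (F : cochain g g')
    (V W : cochain g g) s :
  acochain k F -> has_deg v V -> has_deg w W ->
  vcomp w (vcomp v F V) W s
      - ksign K ((v - 1) * (w - 1)) *: vcomp v (vcomp w F W) V s =
    vcomp (v + (w - 1)) F (vcomp w V W) s
      - ksign K ((v - 1) * (w - 1)) *: vcomp (v + (w - 1)) F (vcomp v W V) s.
Proof.
elim: s k v w F V W => [|x s IH] k v w F V W hF hV hW.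
  rewrite /= !sdeg_mkhel [w + (v - 1)](_ : _ = v + (w - 1)); last by lia.
  rewrite /ctr (ac_sym hF [::] [::]) /= !sdeg_mkhel; ksigns.
have hV1 := deg_ctr x hV; have hW1 := deg_ctr x hW.
have E1 := IH _ _ _ _ _ _ hF hV1 hW; have E2 := IH _ _ _ _ _ _ hF hV hW1.
have E3 := IH _ _ _ _ _ _ (ac_ctr x hF) hV hW.
have h1 := comp_deg w W hV1; have h2 := comp_deg v V hW1.
have h3 := comp_deg (w + sdeg x) (ctr x W) hV.
have h4 := comp_deg (v + sdeg x) (ctr x V) hW.
have hl := ac_lin hF.
rewrite ![vcomp _ _ _ (x :: s)]/= !ctr_comp.
set e := sdeg x in E1 E2 E3 h1 h2 h3 h4 *; clearbody e.
have e1 : v + e + (w - 1) = v + (w - 1) + e by lia.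
have e2 : v + (w + e - 1) = v + (w - 1) + e by lia.
have e3 : w + e + (v - 1) = v + (w - 1) + e by lia.
have e4 : w + (v + e - 1) = v + (w - 1) + e by lia.
rewrite ?e1 ?e2 ?e3 ?e4 in E1 E2 h1 h2 h3 h4 *.
rewrite ![vcomp _ _ _ + _ *: _]addrC !comp_linl !comp_linr //.
move/eqP: E1; rewrite subr_eq => /eqP->.
move/eqP: E2; rewrite subr_eq => /eqP->.
move/eqP: E3; rewrite subr_eq => /eqP->.
ksigns.
Qed.

Lemma mkhel0 (K : fieldType) (g g' : fdgla K) i (F : cochain g g') s1 s2 :
  multilinear F -> F (s1 ++ mkhel i 0 :: s2) = 0.
Proof.
move=> hF; have := hF s1 s2 (mkhel i 0) (mkhel i 0) (mkhel i 0) (-1) erefl erefl.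
by rewrite scaleN1r addNr scaleN1r addNr hval_mkhel; [apply | apply: gr0].
Qed.

Lemma comp_sum (K : fieldType) (g g' : fdgla K) l (F : cochain g g')
    (V : cochain g g) s : graded_symmetric F ->
  vcomp l F V s = \sum_(m : (size s).-tuple bool) koszul m s *:
    F (mkhel (sdegs (mask m s) + l) (V (mask m s)) :: unsel m s).
Proof.
elim: s l F V => [|x s IH] l F V hF.
  rewrite (bigD1 [tuple]) //= big1 => [|t]; last by rewrite tuple0.
  by rewrite sdegs_nil add0r scale1r addr0.
rewrite (mask_sum_cons _ (fun m : bitseq => koszul m (x :: s) *:
  F (mkhel (sdegs (mask m (x :: s)) + l) (V (mask m (x :: s))) :: unsel m (x :: s)))).
rewrite /= !IH //; last by move=> s1; apply: (hF (x :: s1)).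
rewrite scaler_sumr -big_split /=; apply: eq_bigr => m _.
rewrite /unsel /= !sdegs_cons (hF [::]) /= sdeg_mkhel.
set s1 := mask m s; set s2 := mask (map negb m) s.
have -> : sdeg x + sdegs s1 + l = sdegs s1 + (l + sdeg x) by lia.
rewrite /ctr; ksigns.
Qed.

(** ** The differential of the source *)

Section Source.
Variables (K : fieldType) (charK0 : [pchar K] =i pred0) (g : fdgla K).

(** The components Q_1 and Q_2 of the coderivation of g. *)
Definition Qco : cochain g g := fun s =>
  match s with
  | [:: x] => hval (Q1 x)
  | [:: x; y] => hval (Q2 x y)
  | _ => 0
  end.

Lemma Qco_deg : has_deg 2 Qco.
Proof.
move=> [|x [|y [|z s]]]; try exact: gr0.
  have := hgr (Q1 x); rewrite /= sdegs_cons sdegs_nil /sdeg.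
  by have -> : hdeg x - 1 + 0 + 2 = hdeg x + 1 by lia.
have := hgr (Q2 x y); rewrite /= !sdegs_cons sdegs_nil /sdeg.
by have -> : hdeg x - 1 + (hdeg y - 1 + 0) + 2 = hdeg x + hdeg y by lia.
Qed.

Lemma comp_coderE (g' : fdgla K) (F : cochain g g') : multilinear F ->
  graded_symmetric F -> comp_coder F = vcomp 2 F Qco.
Proof.
move=> hl hs; apply: funext => s; rewrite comp_sum //; apply: eq_bigr => m _.
congr (_ *: _); have := Qco_deg (mask m s).
case: (mask m s) => [|x [|y [|z t]]] hd; rewrite ?(mkhel0 _ [::]) //.
  congr F; congr (_ :: _); apply: hel_eq; last by rewrite hval_mkhel.
  by rewrite hdeg_mkhel sdegs_cons sdegs_nil /sdeg /=; lia.
congr F; congr (_ :: _); apply: hel_eq; last by rewrite hval_mkhel.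
by rewrite hdeg_mkhel !sdegs_cons sdegs_nil /sdeg /=; lia.
Qed.

Lemma Qco_nil3 x y z s : Qco [:: x, y, z & s] = 0. Proof. by []. Qed.

Lemma acochain_Qco : acochain 2 Qco.
Proof.
split; last exact: Qco_deg.
  move=> s1 s2 [i u hu] [j v hv] [k w hw] a /= eik ejk e; subst i j.
  case: s1 => [|t [|t' s1]] /=.
  - case: s2 => [|t [|t' s2]] /=; last by rewrite scaler0 addr0.
      by rewrite e (gmap_lin (gmap_dif g k)) //; lmod.
    rewrite /sdeg /= e (gmap_lin (gmap_brl k (hgr t))) //; lmod.
  - case: s2 => [|t' s2] /=; last by rewrite scaler0 addr0.
    by rewrite e (gmap_lin (gmap_brr k (hgr t))) //; lmod.
  by case: (s1) => [|? ?]; rewrite /= scaler0 addr0.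
move=> [|t [|t' s1]] s2 x y /=; last by case: s1 => [|? ?]; rewrite scaler0.
  case: s2 => [|? ?] /=; last by rewrite scaler0.
  rewrite (br_antisym (fdgla_axioms g)) ?/sdeg; try exact: hgr.
  ksigns.
by rewrite scaler0.
Qed.

Lemma wshift_Qco c : 0 <= c -> wshift c c Qco.
Proof.
move=> c0 [|x [|y [|z s]]] [|n [|m [|q p]]] //=;
  try solve [move=> *; apply: fil0 | by move=> [_ []] | by move=> [_ [_ []]]].
- move=> [hx _]; rewrite big_cons big_nil; apply: filN.
  have -> : n - c + 0 + c = n by lia.
  by apply: (fil_dif (fdgla_axioms g)) => //; apply: hgr.
move=> [hx [hy _]]; rewrite !big_cons big_nil; apply: filN; apply: filZ.
apply: (@fil_le _ _ _ (n + m)); first by lia.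
by apply: (fil_br (fdgla_axioms g)) => //; apply: hgr.
Qed.

Lemma Qco_mkhel1 i v : gr g i v -> Qco [:: mkhel i v] = - dif g i v.
Proof. by move=> h; rewrite /= hdeg_mkhel hval_mkhel. Qed.

Lemma Qco_mkhel2 x i v : gr g i v ->
  Qco [:: x; mkhel i v] = - (ksign K (sdeg x) *: br g (hdeg x) i (hval x) v).
Proof. by move=> h; rewrite /= hdeg_mkhel hval_mkhel. Qed.

Arguments Qco : simpl never.

(** On one, two and three arguments these are d d = 0, the derivation property of
    d and the Jacobi identity of g. *)
Lemma Qco_Qco s : vcomp 2 Qco Qco s = 0.
Proof.
have dif0 i : dif g i 0 = 0 := gmap0 (gmap_dif g i).
have bb i j u v hu hv := br_gr (fdgla_axioms g) (hu : gr g i u) (hv : gr g j v).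
have dd i u hu := dif_gr (fdgla_axioms g) (hu : gr g i u).
have Q0 : Qco [::] = 0 by [].
have m1 x i : Qco [:: x; mkhel i 0] = 0 := mkhel0 i [:: x] [::] (ac_lin acochain_Qco).
have Qx i u (hu : gr g i u) : Qco [:: Hel hu] = - dif g i u by [].
have Qxy i u (hu : gr g i u) j v (hv : gr g j v) :
  Qco [:: Hel hu; Hel hv] = - (ksign K (i - 1) *: br g i j u v) by [].
case: s => [|x [|y [|z [|t s]]]].
- by rewrite /= Q0 (mkhel0 _ [::]) //; apply: ac_lin acochain_Qco.
- case: x => i u hu; rewrite /= /ctr /sdeg /= Q0 m1 Qx.
  have -> : 2 + (i - 1) = i + 1 by lia.
  rewrite Qco_mkhel1; last exact: grN (dd _ _ hu).
  by rewrite (gmapN (gmap_dif g _)) ?(dif_dif (fdgla_axioms g)) //; [lmod | exact: dd].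
- case: x y => i u hu [j v hv]; rewrite /= /ctr /sdeg /= Q0 ?m1 ?Qx ?Qxy.
  have -> : 2 + (i - 1) + (j - 1) = i + j by lia.
  have [-> ->] : 2 + (i - 1) = i + 1 /\ 2 + (j - 1) = j + 1 by split; lia.
  have hdu := dd _ _ hu; have hdv := dd _ _ hv; have huv := bb _ _ _ _ hu hv.
  rewrite Qco_mkhel1; last by apply: grN; apply: grZ.
  rewrite !Qco_mkhel2; try exact: grN.
  rewrite (gmapN (gmap_dif g _)) ?(gmapZ (gmap_dif g _)) //; last exact: grZ.
  rewrite (gmapN (gmap_brr _ hv)) // (gmapN (gmap_brr _ hu)) //.
  rewrite (dif_br (fdgla_axioms g)) // (br_antisym (fdgla_axioms g) hdu hv) /sdeg /=.
  ksigns.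
- case: x y z => i u hu [j v hv] [k w hw].
  rewrite /= /ctr /sdeg /= Q0 ?m1 ?Qx ?Qxy ?Qco_nil3 (mkhel0 _ [::]); last first.
    exact: ac_lin acochain_Qco.
  have -> : 2 + (i - 1) + (j - 1) = i + j by lia.
  have -> : 2 + (i - 1) + (k - 1) = i + k by lia.
  have -> : 2 + (j - 1) + (k - 1) = j + k by lia.
  have huv := bb _ _ _ _ hu hv; have huw := bb _ _ _ _ hu hw.
  have hvw := bb _ _ _ _ hv hw.
  rewrite !Qco_mkhel2; try by apply: grN; apply: grZ.
  rewrite (gmapN (gmap_brr _ hw)) ?(gmapZ (gmap_brr _ hw)) //; last exact: grZ.
  rewrite (gmapN (gmap_brr _ hv)) ?(gmapZ (gmap_brr _ hv)) //; last exact: grZ.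
  rewrite (gmapN (gmap_brr _ hu)) ?(gmapZ (gmap_brr _ hu)) //; last exact: grZ.
  rewrite (br_jacobi (fdgla_axioms g) hu hv hw).
  rewrite (br_antisym (fdgla_axioms g) huv hw) /sdeg /=; ksigns.
rewrite comp_sum; last exact: ac_sym acochain_Qco.
apply: big1 => m _; set r := [:: x, y, z, t & s].
have : (size (mask m r) + size (unsel m r) = size r)%N.
  rewrite /unsel !size_mask ?size_map ?size_tuple // count_map.
  by rewrite (count_predC id) size_tuple.
case: (mask m r) => [|a [|b [|c v]]] /= e.
- by rewrite Q0 (mkhel0 _ [::]) ?scaler0 //; apply: ac_lin acochain_Qco.
- by case: (unsel m r) e => [|? [|? [|? ?]]] //; rewrite Qco_nil3 scaler0.
- by case: (unsel m r) e => [|? [|? ?]] //; rewrite Qco_nil3 scaler0.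
by rewrite Qco_nil3 (mkhel0 _ [::]) ?scaler0 //; apply: ac_lin acochain_Qco.
Qed.

(** The coderivation has odd degree, so its square is half a commutator, whose
    corestriction is the composition of Q with itself. *)
Lemma comp_Qco_Qco (g' : fdgla K) k (F : cochain g g') s : acochain k F ->
  vcomp 2 (vcomp 2 F Qco) Qco s = 0.
Proof.
move=> hF; have := comp_comp s hF Qco_deg Qco_deg.
have -> : vcomp 2 Qco Qco = 0 by apply: funext => t; apply: Qco_Qco.
have -> : vcomp (2 + (2 - 1)) F (0 : cochain g g) s = 0.
  have h0 : has_deg 3 (0 : cochain g g) by move=> t; apply: gr0.
  by have := comp_Zr 0 s (ac_lin hF) h0; rewrite !scale0r.
have -> : ksign K ((2 - 1) * (2 - 1)) = -1 by [].
rewrite scaler0 subr0 scaleN1r opprK -mulr2n => e.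
by apply: (mulrSn_inj charK0 (k := 1)); rewrite e mul0rn.
Qed.
End Source.

(** * The convolution DGLA, with and without counit *)

Section Bounds.
Variables (K : fieldType) (g g' : fdgla K).
Local Notation cochain := (cochain g g').
Implicit Types (F G : cochain) (s : seq (hel g)) (p : seq int) (c m n : int).

Lemma fbound_size s p : fbound s p -> size p = size s.
Proof. by elim: s p => [|x s IH] [|q p] //= [_ /IH->]. Qed.

Lemma weight_sum (p : seq int) c :
  \sum_(q <- p) (q - c) = \sum_(q <- p) q - c * (size p)%:Z.
Proof.
elim: p => [|q p IH]; first by rewrite !big_nil mulr0 subr0.
by rewrite !big_cons IH /=; lia.
Qed.

Lemma wshift_weaken m F : wshift 0 m F -> wshift 1 m F.
Proof.
move=> h s p hp; apply: (fil_le _ (h s p hp)).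
by rewrite !weight_sum; lia.
Qed.

Lemma wshift_postd c m k F : has_deg k F -> wshift c m F -> wshift c m (postd k F).
Proof. by move=> hd h s p hp; apply: (fil_dif (fdgla_axioms g')) => //; apply: h. Qed.

Lemma wshift_sum c m (I : Type) (r : seq I) (P : pred I) (f : I -> cochain) :
  (forall i, P i -> wshift c m (f i)) -> wshift c m (\sum_(i <- r | P i) f i).
Proof.
move=> h; apply: big_ind => // [s p hp|F G hF hG]; first exact: fil0.
by rewrite -[F]scale1r; apply: wshift_lin.
Qed.

Lemma fil_shiftP m F : fil_shift m F <-> wshift 0 m F.
Proof.
have sum_nth (s : seq (hel g)) (p : seq int) : size p = size s ->
    \sum_(i < size s) nth 0 p i = \sum_(q <- p) (q - 0).
  move=> e; rewrite (big_nth 0) big_mkord e.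
  by apply: eq_bigr => i _; rewrite subr0.
have tnthE s (i : 'I_(size s)) x : tnth (in_tuple s) i = nth x s i.
  by rewrite (tnth_nth x).
split=> h s p hp.
  rewrite -(sum_nth s p (fbound_size hp)); apply: h => i.
  rewrite (tnthE _ _ (tnth (in_tuple s) i)).
  case: i => i lti /=; move: (tnth _ _) => y.
  by elim: s p hp i lti => [|x s IH] [|q p] //= [hx hp] [|i] lti //; exact: (IH p hp i lti).
pose q := [seq p i | i <- enum 'I_(size s)].
have sq : size q = size s by rewrite size_map size_enum_ord.
have eq_q (i : 'I_(size s)) : nth 0 q i = p i.
  by rewrite (nth_map i) ?size_enum_ord // nth_ord_enum.
have -> : \sum_i p i = \sum_(r <- q) (r - 0).
  by rewrite -(sum_nth s) //; apply: eq_bigr => i _; rewrite eq_q.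
apply: h.
have : forall i, (i < size s)%N -> forall x, fil g (nth 0 q i) (hval (nth x s i)).
  by move=> i lti x; have := hp (Ordinal lti); rewrite (tnthE _ _ x) -eq_q.
move: (q) sq; elim: (s) => [|x s' IH] [|r q'] //= [sq] hq; split.
  exact: (hq 0%N isT x).
by apply: IH => // i lti y; have := hq i.+1 lti y.
Qed.

Lemma acochain_postd k F : acochain k F -> acochain (k + 1) (postd k F).
Proof.
move=> [hl hs hd]; split; last exact: postd_deg.
  move=> s1 s2 x y z a e1 e2 e; rewrite /postd.
  have sd u : hdeg u = hdeg z -> sdegs (s1 ++ u :: s2) = sdegs (s1 ++ z :: s2).
    by move=> eu; rewrite !sdegs_cat !sdegs_cons /sdeg eu.
  have := (hd (s1 ++ x :: s2), hd (s1 ++ y :: s2)); rewrite (sd x) // (sd y) //.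
  move=> [h1 h2]; rewrite (hl s1 s2 x y z a) //.
  exact: (dif_linear (fdgla_axioms g')).
move=> s1 s2 x y; rewrite /postd (hs s1 s2 x y).
have -> : sdegs (s1 ++ x :: y :: s2) = sdegs (s1 ++ y :: x :: s2).
  by rewrite !sdegs_cat !sdegs_cons; lia.
exact: (gmapZ (gmap_dif g' _)).
Qed.

Lemma acochain0 k : acochain k (0 : cochain).
Proof.
have z s : (0 : cochain) s = 0 by [].
split=> [s1 s2 x y t a _ _ _|s1 s2 x y|s]; last exact: gr0.
  by rewrite !z scaler0 addr0.
by rewrite !z scaler0.
Qed.

End Bounds.

Section Uconv.
Variables (K : fieldType) (charK0 : [pchar K] =i pred0) (g g' : fdgla K).
Local Notation cochain := (cochain g g').
Implicit Types (F G : cochain) (s : seq (hel g)) (p : seq int) (k l m n : int).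

(** Without the condition F [::] = 0 the elements of the 0-th filtration step of g'
    become cochains, the constant ones, and contractions are defined. *)
Definition uconv_data : fdgla_data K := {|
  carrier := (cochain : lmodType K) ;
  gr := fun k => [set F : cochain | acochain k F /\ wshift 0 0 F] ;
  dif := fun k F => postd k F + ksign K (k - 1) *: vcomp 2 F (@Qco K g) ;
  br := fun k l F G => cbr k l F G ;
  fil := fun n => [set F : cochain | wshift 1 n F] |}.

Let Q := @Qco K g.

Lemma ugr_dif k F : gr uconv_data k F -> gr uconv_data (k + 1) (dif uconv_data k F).
Proof.
move=> [aF wF]; have aQ := acochain_comp aF (acochain_Qco g).
split; rewrite /= [postd _ _ + _]addrC.
  by apply: ac_lincomb => //; apply: acochain_postd.
apply: wshift_lin; last by apply: wshift_postd => //; apply: ac_deg aF.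
rewrite -[X in wshift _ X]addr0; apply: wshift_comp => //; first exact: Qco_deg.
by rewrite addr0; apply: wshift_Qco.
Qed.

Lemma udif_dif k F : gr uconv_data k F ->
  dif uconv_data (k + 1) (dif uconv_data k F) = 0.
Proof.
move=> [aF wF]; apply: funext => s; rewrite /= [postd k F + _]addrC.
have dF := ac_deg aF; have dQ := comp_deg 2 Q dF.
have dp := postd_deg dF.
rewrite postd_lin // !cochainE comp_linl (comp_Qco_Qco charK0 s aF) comp_postd //.
have -> : postd (k + 1) (postd k F) s = 0.
  rewrite /postd; have := dif_dif (fdgla_axioms g') (dF s).
  by rewrite -addrA.
ksigns.
Qed.

Lemma udif_br k l F G : gr uconv_data k F -> gr uconv_data l G ->
  dif uconv_data (k + l) (br uconv_data k l F G) =
    br uconv_data (k + 1) l (dif uconv_data k F) G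
    + ksign K k *: br uconv_data k (l + 1) F (dif uconv_data l G).
Proof.
move=> [aF wF] [aG wG]; apply: funext => s /=.
have dF := ac_deg aF; have dG := ac_deg aG.
have dFQ := comp_deg 2 Q dF; have dGQ := comp_deg 2 Q dG.
have dpF := postd_deg dF; have dpG := postd_deg dG.
rewrite ![postd _ _ + _]addrC !cochainE postd_cbr // comp_cbr //.
rewrite cbr_linl // cbr_linr //; ksigns.
Qed.

(** The conditions on cochains are closed under pointwise limits, by separation
    of the target. *)
Lemma ulimit k (u : int -> cochain) (x : cochain) :
  (forall n, gr uconv_data k (u n)) -> has_deg k x ->
  (forall s, exists c, forall n, fil g' (n + c) (x s - u n s)) ->
  gr uconv_data k x.
Proof.
move=> hu gx hx.
have zero i (y : g') : gr g' i y -> (exists c, forall n, fil g' (n + c) y) -> y = 0.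
  move=> gy [c hc]; apply: (fil_separated (fdgla_axioms g') gy) => n.
  by rewrite -[n](subrK c).
split; first split=> //.
- move=> s1 s2 x1 x2 x3 a e1 e2 e; apply: subr0_eq.
  have sd y : hdeg y = hdeg x3 -> sdegs (s1 ++ y :: s2) = sdegs (s1 ++ x3 :: s2).
    by move=> eu; rewrite !sdegs_cat !sdegs_cons /sdeg eu.
  have := (gx (s1 ++ x1 :: s2), gx (s1 ++ x2 :: s2)); rewrite (sd x1) // (sd x2) //.
  move=> [h1 h2]; apply: (zero (sdegs (s1 ++ x3 :: s2) + k)).
    by apply: grB => //; apply: grD => //; apply: grZ.
  have [c1 hc1] := hx (s1 ++ x1 :: s2); have [c2 hc2] := hx (s1 ++ x2 :: s2).
  have [c3 hc3] := hx (s1 ++ x3 :: s2); exists (Num.min c1 (Num.min c2 c3)) => n.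
  have [[hl _ _] _] := hu n; have := hl s1 s2 x1 x2 x3 a e1 e2 e.
  set X1 := x _; set X2 := x _; set X3 := x _.
  move: (hc1 n) (hc2 n) (hc3 n); set U1 := u n _; set U2 := u n _; set U3 := u n _.
  move=> f1 f2 f3 eU.
  have -> : X1 - (a *: X2 + X3) = (X1 - U3) - (a *: (X2 - U1) + (X3 - U2)).
    by rewrite eU; lmod.
  apply: filB; first by apply: fil_le f3; lia.
  apply: filD; first by apply: filZ; apply: fil_le f1; lia.
  by apply: fil_le f2; lia.
- move=> s1 s2 x1 x2; apply: subr0_eq.
  have sd : sdegs (s1 ++ x2 :: x1 :: s2) = sdegs (s1 ++ x1 :: x2 :: s2).
    by rewrite !sdegs_cat !sdegs_cons; lia.
  have := gx (s1 ++ x2 :: x1 :: s2); rewrite sd => h2.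
  apply: (zero (sdegs (s1 ++ x1 :: x2 :: s2) + k)).
    by apply: grB => //; apply: grZ.
  have [c1 hc1] := hx (s1 ++ x1 :: x2 :: s2).
  have [c2 hc2] := hx (s1 ++ x2 :: x1 :: s2); exists (Num.min c1 c2) => n.
  have [[_ hs _] _] := hu n; have := hs s1 s2 x1 x2.
  set X1 := x _; set X2 := x _.
  move: (hc1 n) (hc2 n); set U1 := u n _; set U2 := u n _ => f1 f2 eU.
  have -> : X1 - ksign K (sdeg x1 * sdeg x2) *: X2 =
      (X1 - U1) - ksign K (sdeg x1 * sdeg x2) *: (X2 - U2) by rewrite eU; lmod.
  apply: filB; first by apply: fil_le f1; lia.
  by apply: filZ; apply: fil_le f2; lia.
move=> s p hp; have [c hc] := hx s; set S := \sum_(_ <- _) _.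
rewrite -(subrK (u (S - c) s) (x s)); apply: filD.
  by rewrite addr0 -[X in fil _ X](subrK c).
by case: (hu (S - c)) => _; apply.
Qed.

Lemma ucomplete k (u : int -> cochain) : (forall n, gr uconv_data k (u n)) ->
  (forall n, fil uconv_data n (u (n + 1) - u n)) ->
  exists2 x, gr uconv_data k x & forall n, fil uconv_data n (x - u n).
Proof.
move=> hu hd.
have /choice[x hx] : forall s, exists y, gr g' (sdegs s + k) y /\
    exists c, forall n, fil g' (n + c) (y - u n s).
  move=> s; have [p hp] := fbound_exists s; set c := \sum_(q <- p) (q - 1).
  have [||y gy hy] := @fil_complete _ _ (fdgla_axioms g') (sdegs s + k)
      (fun n => u (n - c) s).
  - by move=> n; have [[_ _ h] _] := hu (n - c); apply: h.
  - move=> n; have := hd (n - c) s p hp; rewrite -/c addrC subrK.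
    by have -> : n - c + 1 = n + 1 - c by lia.
  exists y; split=> //; exists c => n.
  by have := hy (n + c); rewrite addrK.
exists x; first by apply: (ulimit hu) => s; case: (hx s).
have mono n (N : nat) : fil uconv_data n (u (n + N%:Z) - u n).
  elim: N => [|N IH].
    by rewrite addr0 subrr => s p hp; apply: fil0.
  have -> : u (n + N.+1%:Z) - u n =
      1 *: (u (n + N%:Z + 1) - u (n + N%:Z)) + (u (n + N%:Z) - u n).
    have -> : n + N.+1%:Z = n + N%:Z + 1 by lia.
    by rewrite scale1r addrA subrK.
  by apply: wshift_lin => //; apply: (@wshift_le _ _ _ _ (n + N%:Z)) ; [lia | exact: hd].
move=> n s p hp; have [_ [c hc]] := hx s; set S := \sum_(_ <- _) _.
pose N := absz (S - c).
rewrite -[(x - u n : cochain) s]/(x s - u n s).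
rewrite -(subrK (u (n + N%:Z) s) (x s)) -addrA; apply: filD; last exact: mono.
by apply: (fil_le _ (hc _)); rewrite /N; lia.
Qed.

Lemma is_fdgla_uconv : is_fdgla uconv_data.
Proof.
split.
- move=> k; split=> [|a F G [aF wF] [aG wG]].
    by split; [apply: acochain0 | move=> s p hp; apply: fil0].
  by split; [apply: ac_lincomb | apply: wshift_lin].
- exact: ugr_dif.
- move=> k a F G [aF wF] [aG wG]; apply: funext => s /=.
  have dF := ac_deg aF; have dG := ac_deg aG.
  rewrite postd_lin // !cochainE comp_linl; lmod.
- exact: udif_dif.
- move=> k l F G [aF wF] [aG wG]; split; first exact: acochain_cbr.
  by rewrite -[0]addr0; apply: wshift_cbr => //; apply: ac_deg.
- move=> k l a F G H [aF wF] [aG wG] [aH wH]; apply: funext => s /=.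
  have dF := ac_deg aF; have dG := ac_deg aG; have dH := ac_deg aH.
  by rewrite cbr_linr.
- move=> k l F G [aF wF] [aG wG]; apply: funext => s /=.
  have dF := ac_deg aF; have dG := ac_deg aG.
  by rewrite cbr_antisym.
- move=> i j k F G H [aF wF] [aG wG] [aH wH]; apply: funext => s /=.
  have dF := ac_deg aF; have dG := ac_deg aG; have dH := ac_deg aH.
  by rewrite cbr_jacobi.
- exact: udif_br.
- move=> n; split=> [s p hp|a F G hF hG]; first exact: fil0.
  exact: wshift_lin.
- by move=> n m le F; apply: wshift_le.
- by move=> k F [aF wF]; exists 0; apply: wshift_weaken.
- move=> k F [aF wF] h; apply: funext => s.
  have [p hp] := fbound_exists s.
  apply: (fil_separated (fdgla_axioms g') (ac_deg aF s)) => n.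
  set S := \sum_(q <- p) (q - 1); rewrite -[n](subrK S) addrC.
  exact: (h (n - S) s p hp).
- exact: ucomplete.
- move=> n k F [aF wF] h; rewrite /= [postd _ _ + _]addrC; apply: wshift_lin.
    rewrite -[X in wshift _ X]addr0; apply: wshift_comp => //; first exact: Qco_deg.
    by rewrite add0r; apply: wshift_Qco.
  by apply: wshift_postd => //; apply: ac_deg aF.
move=> n m k l F G [aF wF] [aG wG] hF hG; apply: wshift_cbr => //; exact: ac_deg.
Qed.

Definition uconv : fdgla K := Fdgla is_fdgla_uconv.

End Uconv.

Section Conv.
Variables (K : fieldType) (charK0 : [pchar K] =i pred0) (g g' : fdgla K).
Local Notation cochain := (cochain g g').
Local Notation U := (uconv charK0 g g').
Local Notation C := (conv g g').
Implicit Types (F G : cochain) (s : seq (hel g)) (p : seq int) (k l n : int).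

Lemma hom_grP k F : gr C k F <-> gr U k F /\ F [::] = 0.
Proof.
split=> [[h0 hl hs hd hf]|[[[hl hs hd] hf] h0]].
  by split=> //; split; [split | apply/fil_shiftP].
by split=> //; apply/fil_shiftP.
Qed.

Lemma conv_difE k F : gr U k F -> dif C k F = dif U k F.
Proof.
by move=> [[hl hs hd] _]; apply: funext => s; rewrite /= comp_coderE.
Qed.

Lemma conv_brE k l F G : gr U k F -> gr U l G -> F [::] = 0 -> G [::] = 0 ->
  br C k l F G = br U k l F G.
Proof.
move=> [[_ _ hd1] _] [[_ _ hd2] _] F0 G0; apply: funext => s; rewrite /= cbr_sum /cup /coprod_sum.
rewrite [RHS](bigID (fun m : (size s).-tuple bool => (true \in m) && (false \in m))) /=.
rewrite [X in _ = _ + X]big1 ?addr0 => [|m].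
  rewrite scaler_sumr -sumrN; apply: eq_bigr => m _; rewrite /Q2'; ksigns.
have no (t : bitseq) q : true \notin t -> mask t q = [::] :> seq (hel g).
  by elim: t q => [|b t IH] [|x q] //=; rewrite inE negb_or; case: b => //= /IH.
rewrite negb_and => /orP[nt|nf].
  rewrite (no _ _ nt) F0 (gmap0 (gmap_brl _ (hd2 _))) scaler0 ?scaler0 //.
have nf' : true \notin map negb m.
  by rewrite -[true]/(~~ false) mem_map //; apply: (can_inj negbK).
by rewrite /unsel (no _ _ nf') G0 (gmap0 (gmap_brr _ (hd1 _))) !scaler0.
Qed.

(** A reduced cochain lies in the n-th step exactly when its restriction to the
    lists of length r shifts the filtration by n - r.  The decomposition required
    by the definition separates the lengths r < n and keeps the lengths r >= n
    together, where no shift is needed. *)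
Lemma conv_filP k n F : gr U k F -> F [::] = 0 -> (fil C n F <-> fil U n F).
Proof.
move=> [aF wF] F0; split=> [[N [f [-> hf]]]|wnF].
  apply: wshift_sum => i _; have [p [m [epm [_ hz hs]]]] := hf i.
  move=> s q hq; have := fbound_size hq => sq.
  have [lt|le] := ltnP (size s) p; first by rewrite hz //; apply: fil0.
  have /fil_shiftP/(_ s q hq) := hs; apply: fil_le.
  by rewrite !weight_sum sq; lia.
have [le|lt] : n <= 0 \/ 0 < n by lia.
  exists 1%N, (fun=> F); split; first by rewrite big_ord1.
  move=> _; exists 0%N, n; split; first by rewrite add0r.
  split=> //; first by exists k; apply/hom_grP.
  by apply/fil_shiftP; apply: wshift_le wF.
have [N eN] : exists N : nat, n = N%:Z by exists (absz n); lia.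
subst n; pose f (i : 'I_N.+1) : cochain := fun s => if minn (size s) N == i then F s else 0.
exists N.+1, f; split.
  apply: funext => s.
  have -> : (\sum_i f i) s = \sum_i f i s.
    by elim/big_rec2: _ => // i y x _ <-.
  have lt_m : (minn (size s) N < N.+1)%N by rewrite ltnS geq_minr.
  rewrite (bigD1 (Ordinal lt_m)) //= /f eqxx big1 ?addr0 // => i ne.
  by rewrite ifN //; apply: contra ne => /eqP e; apply/eqP/val_inj.
move=> i; exists i, (N%:Z - i%:Z); split; first by lia.
split.
- exists k; apply/hom_grP; split; last by rewrite /f; case: ifP.
  case: aF => hl hs hd; split; first split.
  + move=> s1 s2 x y z a e1 e2 e; rewrite /f !size_cat /=.
    by case: ifP => _; [apply: hl | rewrite scaler0 addr0].
  + move=> s1 s2 x y; rewrite /f !size_cat /=.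
    by case: ifP => _; [apply: hs | rewrite scaler0].
  + by move=> s; rewrite /f; case: ifP => _ //; apply: gr0.
  by move=> s p hp; rewrite /f; case: ifP => _; [apply: wF | apply: fil0].
- move=> s lt_i; rewrite /f ifN //; apply/eqP => e.
  by move: lt_i; rewrite -e ltnNge geq_minl.
apply/fil_shiftP => s p hp; rewrite /f; case: eqP => [e|_]; last exact: fil0.
have sp := fbound_size hp.
have [le|lt'] := leqP N (size s).
  have -> : N%:Z - i%:Z = 0 by rewrite -e; lia.
  exact: wF.
apply: fil_le (wnF s p hp); rewrite !weight_sum sp -e; lia.
Qed.


Lemma conv_fil_subspace n : is_subspace (fil C n).
Proof.
split; first by exists 0%N, (fun=> 0); split=> [|[]//]; rewrite big_ord0.
move=> a _ _ [N [f [-> hf]]] [M [h [-> hh]]].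
exists (N + M)%N, (fun i => match fintype.split i with inl j => a *: f j | inr j => h j end).
split.
  rewrite big_split_ord scaler_sumr /=; congr (_ + _); apply: eq_bigr => i _.
    by rewrite (unsplitK (inl i)).
  by rewrite (unsplitK (inr i)).
move=> i; case: (fintype.split i) => j; last exact: hh.
have [p [m [e [[k hk] hz hs]]]] := hf j; exists p, m; split=> //; split.
- exists k; have [gU F0] := (hom_grP k (f j)).1 hk.
  apply/hom_grP; split; last by rewrite cochainZ F0 scaler0.
  exact: (@grZ _ U).
- by move=> s lt; rewrite cochainZ hz // scaler0.
by move=> s q hq; apply: filZ; apply: hs.
Qed.

Lemma conv_fil_le n m : n <= m -> fil C m `<=` fil C n.
Proof.
move=> le _ [N [f [-> hf]]]; exists N, f; split=> // i.
have [p [q [e [hk hz hs]]]] := hf i; exists p, (q - (m - n)); split; first by lia.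
split=> // s r hr; apply: (fil_le _ (hs s r hr)); lia.
Qed.

Lemma hom_gr_dif k F : gr C k F -> gr C (k + 1) (dif C k F).
Proof.
move=> /hom_grP[gF F0]; apply/hom_grP; rewrite conv_difE //.
split; first exact: (dif_gr (fdgla_axioms U)).
rewrite /= cochainD cochainZ /postd /=.
rewrite F0 (gmap0 (gmap_dif g' _)) (mkhel0 2 [::]) ?scaler0 ?addr0 //.
exact: (ac_lin gF.1).
Qed.

Lemma cbr_nil0 k l F G : gr U l G -> F [::] = 0 -> br U k l F G [::] = 0.
Proof.
by move=> [[_ _ hd] _] F0; rewrite /= F0 (gmap0 (gmap_brl k (deg_nil hd))).
Qed.

Lemma hom_gr_br k l F G : gr C k F -> gr C l G ->
  br C k l F G = br U k l F G /\ gr C (k + l) (br C k l F G).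
Proof.
move=> /hom_grP[gF F0] /hom_grP[gG G0]; rewrite conv_brE //; split=> //.
by apply/hom_grP; split; [apply: (br_gr (fdgla_axioms U)) | apply: cbr_nil0].
Qed.

Lemma is_fdgla_conv : is_fdgla C.
Proof.
have grU k F : gr C k F -> gr U k F by move=> /hom_grP[].
have gr_lin k (a : K) F G : gr C k F -> gr C k G -> gr C k (a *: F + G).
  move=> /hom_grP[gF F0] /hom_grP[gG G0]; apply/hom_grP; split.
    by apply: (@grD _ U) => //; apply: (@grZ _ U).
  by rewrite cochainD cochainZ F0 G0 scaler0 addr0.
have filU k n F : gr C k F -> (fil C n F <-> fil U n F).
  by move=> /hom_grP[gF F0]; apply: conv_filP gF F0.
have gr_sub k F G : gr C k F -> gr C k G -> gr C k (F - G).
  by move=> hF hG; have := gr_lin k (-1) G F hG hF; rewrite scaleN1r addrC.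
split.
- move=> k; split; last exact: gr_lin.
  by apply/hom_grP; split=> //; apply: (@gr0 _ U).
- exact: hom_gr_dif.
- move=> k a F G hF hG; rewrite !conv_difE; try exact: grU; last first.
    exact: (grU k _ (gr_lin _ _ _ _ hF hG)).
  by apply: (dif_linear (fdgla_axioms U)); apply: grU.
- move=> k F hF; have hd := hom_gr_dif hF.
  rewrite (conv_difE (grU _ _ hd)) conv_difE; last exact: grU.
  by apply: (dif_dif (fdgla_axioms U)); apply: grU.
- by move=> k l F G hF hG; case: (hom_gr_br hF hG).
- move=> k l a F G H hF hG hH; have hGH := gr_lin _ a _ _ hG hH.
  rewrite (hom_gr_br hF hG).1 (hom_gr_br hF hH).1 (hom_gr_br hF hGH).1.
  by apply: (br_linear (fdgla_axioms U)); apply: grU.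
- move=> k l F G hF hG; rewrite (hom_gr_br hF hG).1 (hom_gr_br hG hF).1.
  by apply: (br_antisym (fdgla_axioms U)); apply: grU.
- move=> i j k F G H hF hG hH.
  have [eFG hFG] := hom_gr_br hF hG; have [eGH hGH] := hom_gr_br hG hH.
  have [eFH hFH] := hom_gr_br hF hH.
  rewrite (hom_gr_br hF hGH).1 (hom_gr_br hFG hH).1 (hom_gr_br hG hFH).1.
  by rewrite eFG eGH eFH; apply: (br_jacobi (fdgla_axioms U)); apply: grU.
- move=> k l F G hF hG; have [eFG hFG] := hom_gr_br hF hG.
  have hdF := hom_gr_dif hF; have hdG := hom_gr_dif hG.
  rewrite (hom_gr_br hdF hG).1 (hom_gr_br hF hdG).1.
  rewrite !conv_difE; try exact: grU.
  by rewrite eFG; apply: (dif_br (fdgla_axioms U)); apply: grU.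
- exact: conv_fil_subspace.
- exact: conv_fil_le.
- move=> k F hF; have [n hn] := fil_exhaustive (fdgla_axioms U) (grU _ _ hF).
  by exists n; apply/(filU _ _ _ hF).
- move=> k F hF h; apply: (fil_separated (fdgla_axioms U) (grU _ _ hF)) => n.
  by apply/(filU _ _ _ hF).
- move=> k u hu hd.
  have [n|n|x gx hx] := @fil_complete _ _ (fdgla_axioms U) k u.
  + exact: grU.
  + by apply/(filU _ _ _ (gr_sub _ _ _ (hu (n + 1)) (hu n))); apply: hd.
  have x0 : x [::] = 0.
    apply: (fil_separated (fdgla_axioms g') (deg_nil (ac_deg gx.1))) => n.
    have := hx n [::] [::] I; rewrite big_nil add0r.
    have -> // : (x - u n : cochain) [::] = x [::].
    by rewrite cochainD cochainN (hom_reduced (hu n)) subr0.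
  have hxC : gr C k x by apply/hom_grP.
  by exists x => // n; apply/(filU _ _ _ (gr_sub _ _ _ hxC (hu n))); apply: hx.
- move=> n k F hF /(filU _ _ _ hF) hn; have hd := hom_gr_dif hF.
  apply/(filU _ _ _ hd); rewrite conv_difE; last exact: grU.
  by apply: (fil_dif (fdgla_axioms U)) => //; apply: grU.
move=> n m k l F G hF hG /(filU _ _ _ hF) hn /(filU _ _ _ hG) hm.
have [eFG hFG] := hom_gr_br hF hG; apply/(filU _ _ _ hFG); rewrite eFG.
by apply: (fil_br (fdgla_axioms U)) => //; apply: grU.
Qed.

Definition convF : fdgla K := Fdgla is_fdgla_conv.

End Conv.

(** * Twisting as a flow *)

Section Flow.
Variables (K : fieldType) (charK0 : [pchar K] =i pred0) (g g' : fdgla K).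
Variables (a : g) (ga : gr g 0 a) (fa : fil g 1 a).
Local Notation cochain := (cochain g g').
Local Notation U := (uconv charK0 g g').
Implicit Types (F G : cochain) (x y : hel g) (s : seq (hel g)) (i k l : int).

Let ha : hel g := Hel ga.

(** The affine field -da + [a, .], as the contraction of Q with a. *)
Definition gauge_field : Defs.cochain g g := ctr ha (@Qco K g).

Definition gauge_lie F : cochain := vcomp 1 F gauge_field.

(** The pull-back of F by the flow of the field at time t is the sum of the
    t^n *: flow_coef n F. *)
Definition flow_coef n F : cochain := (n`!%:R : K)^-1 *: iter n gauge_lie F.

Lemma acochain_field : acochain 1 gauge_field.
Proof. exact: (ac_ctr ha (acochain_Qco g)). Qed.

Lemma wshift_field : wshift 0 1 gauge_field.
Proof. by apply: (wshift_ctr (m := 0) (n := 1)) => //; apply: wshift_Qco. Qed.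

Lemma acochain_lie k F : acochain k F -> acochain k (gauge_lie F).
Proof. by move=> h; have := acochain_comp h acochain_field; rewrite subrr addr0. Qed.

Lemma wshift_lie m F : wshift 0 m F -> wshift 0 (m + 1) (gauge_lie F).
Proof.
move=> h; apply: wshift_comp => //; last by rewrite addr0; apply: wshift_field.
exact: ac_deg acochain_field.
Qed.

Lemma flow_coef0 F : flow_coef 0 F = F.
Proof. by rewrite /flow_coef invr1 scale1r. Qed.

Lemma gauge_lieZ (c : K) F : gauge_lie (c *: F) = c *: gauge_lie F.
Proof. by apply: funext => s; apply: comp_Zl. Qed.

Lemma gauge_lie_lin (c : K) F G :
  gauge_lie (c *: F + G) = c *: gauge_lie F + gauge_lie G.
Proof. by apply: funext => s; apply: comp_linl. Qed.

Lemma gauge_lie_sum (I : Type) (r : seq I) (P : pred I) (f : I -> cochain) :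
  gauge_lie (\sum_(i <- r | P i) f i) = \sum_(i <- r | P i) gauge_lie (f i).
Proof.
apply: (big_morph gauge_lie) => [F G|].
  by rewrite -[F]scale1r gauge_lie_lin !scale1r.
by have := gauge_lieZ 0 0; rewrite !scale0r.
Qed.

Lemma flow_coefS n F : flow_coef n.+1 F *+ n.+1 = gauge_lie (flow_coef n F).
Proof.
rewrite /flow_coef gauge_lieZ -scaler_nat scalerA mulrC.
by rewrite factV_S // -iterS.
Qed.

Lemma flow_coef_lin n (c : K) F G :
  flow_coef n (c *: F + G) = c *: flow_coef n F + flow_coef n G.
Proof.
rewrite /flow_coef; have -> : iter n gauge_lie (c *: F + G) =
    c *: iter n gauge_lie F + iter n gauge_lie G.
  by elim: n => //= n ->; rewrite gauge_lie_lin.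
by lmod.
Qed.

Lemma flow_coefZ n (c : K) F : flow_coef n (c *: F) = c *: flow_coef n F.
Proof.
rewrite /flow_coef; have -> : iter n gauge_lie (c *: F) = c *: iter n gauge_lie F.
  by elim: n => //= n ->; rewrite gauge_lieZ.
by lmod.
Qed.

Lemma acochain_flow n k F : acochain k F -> acochain k (flow_coef n F).
Proof.
move=> h; rewrite -[flow_coef n F]addr0; apply: ac_lincomb.
  by elim: n => //= n IH; apply: acochain_lie.
exact: acochain0.
Qed.

Lemma wshift_flow n m F : wshift 0 m F -> wshift 0 (n%:Z + m) (flow_coef n F).
Proof.
move=> h; rewrite -[flow_coef n F]addr0; apply: wshift_lin.
  elim: n => [|n IH]; first by rewrite add0r.
  have -> : n.+1%:Z + m = n%:Z + m + 1 by lia.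
  exact: wshift_lie.
by move=> s p hp; apply: fil0.
Qed.

Lemma vcomp_const l F (V : Defs.cochain g g) s : multilinear F ->
  graded_symmetric F -> (forall x t, V (x :: t) = 0) ->
  vcomp l F V s = F (mkhel l (V [::]) :: s).
Proof.
move=> hl hs hV; elim: s F hl hs => [//|x s IH] F hl hs /=.
have -> : ctr x V = 0 by apply: funext => t; apply: hV.
have -> : vcomp (l + sdeg x) F 0 s = 0.
  have h0 : has_deg (l + sdeg x) (0 : Defs.cochain g g) by move=> t; apply: gr0.
  by have := comp_Zr 0 s hl h0; rewrite !scale0r.
rewrite add0r IH; first last.
- by move=> s1; apply: (hs (x :: s1)).
- by move=> s1; apply: (hl (x :: s1)).
by rewrite [RHS](hs [::] s) sdeg_mkhel.
Qed.

Definition ad_hel x : hel g := mkhel (hdeg x) (br g 0 (hdeg x) a (hval x)).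

Lemma field1 x : gauge_field [:: x] = br g 0 (hdeg x) a (hval x).
Proof.
rewrite /gauge_field /ctr /=; have -> : ksign K (sdeg ha) = -1 by [].
lmod.
Qed.

Lemma ctr_lie k F x : acochain k F ->
  ctr x (gauge_lie F) = ctr (ad_hel x) F + gauge_lie (ctr x F).
Proof.
move=> hF; rewrite /gauge_lie ctr_comp subrr mul0r scale1r; congr (_ + _).
apply: funext => s; rewrite vcomp_const //; first last.
- exact: ac_sym hF.
- exact: ac_lin hF.
congr (F (_ :: _)); rewrite {1}/ctr field1 /ad_hel; congr mkhel.
by rewrite /sdeg; lia.
Qed.

(** exp(t a) x, as a power series of homogeneous elements. *)
Definition exp_coef_hel x n : hel g :=
  mkhel (hdeg x) (exp_coef K n *: iter n (br g 0 (hdeg x) a) (hval x)).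

Lemma ctr_mkhel_lin i (c : K) (v w : g) F : multilinear F -> gr g i v -> gr g i w ->
  ctr (mkhel i (c *: v + w)) F = c *: ctr (mkhel i v) F + ctr (mkhel i w) F.
Proof.
move=> hF gv gw; apply: ctr_rel => //; rewrite ?hdeg_mkhel //.
by rewrite !hval_mkhel //; apply: grD => //; apply: grZ.
Qed.

Lemma ctr_mkhelZ i (c : K) (v : g) F : multilinear F -> gr g i v ->
  ctr (mkhel i (c *: v)) F = c *: ctr (mkhel i v) F.
Proof.
move=> hF gv; have := ctr_mkhel_lin c hF gv (gr0 g i); rewrite addr0 => ->.
have -> : ctr (mkhel i 0) F = 0 by apply: funext => s; apply: (mkhel0 _ [::]).
by rewrite addr0.
Qed.

(** Transport of the arguments by exp(t a): the commutator of the contraction by x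
    with the field is the contraction by [a, x] ([ctr_lie]). *)
Lemma ctr_flow n k F x : acochain k F -> ctr x (flow_coef n F) =
  \sum_(j < n.+1) flow_coef (n - j) (ctr (exp_coef_hel x j) F).
Proof.
move=> hF; elim: n x => [|n IH] x.
  rewrite big_ord1 !flow_coef0; congr (ctr _ F).
  by rewrite /exp_coef_hel /exp_coef invr1 scale1r /= mkhelK.
apply: (mulrSn_inj charK0 (k := n)).
rewrite (cauchy_tder (fun j m => flow_coef m (ctr (exp_coef_hel x j) F))).
have -> : ctr x (flow_coef n.+1 F) *+ n.+1 = ctr x (flow_coef n.+1 F *+ n.+1).
  by rewrite -!scaler_nat.
rewrite flow_coefS.
rewrite (ctr_lie x (acochain_flow n hF)) !IH gauge_lie_sum; congr (_ + _).
  apply: eq_bigr => j _; rewrite -scaler_nat -flow_coefZ; congr (flow_coef _ _).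
  have gj := iter_ad_gr j ga (hgr x).
  rewrite /exp_coef_hel /ad_hel hdeg_mkhel hval_mkhel; last exact: (ad_gr ga (hgr x)).
  have gj1 := iter_ad_gr j.+1 ga (hgr x); have hl := ac_lin hF.
  rewrite -iterSr !ctr_mkhelZ //.
  by rewrite scalerA [_%:R * _]mulrC /exp_coef factV_S.
by apply: eq_bigr => j _; rewrite flow_coefS.
Qed.


Definition flow_sum k F s : g' := gsum (sdegs s + k) (fun n => flow_coef n F s).

Lemma flow_gr k F s n : acochain k F -> gr g' (sdegs s + k) (flow_coef n F s).
Proof. by move=> /(acochain_flow n)/ac_deg. Qed.

Lemma flow_summable k m F s : acochain k F -> wshift 0 m F ->
  summable (sdegs s + k) (fun n => flow_coef n F s).
Proof.
move=> hF wF; have [p hp] := fbound_exists s.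
apply: (@summable_shift _ _ _ _ (\sum_(q <- p) (q - 0) + m)) => n.
  exact: flow_gr.
have := wshift_flow n wF hp; set S := \sum_(_ <- _) _.
by rewrite addrCA.
Qed.

Lemma fil_mkhel i n (v : g) : gr g i v -> fil g n v -> fil g n (hval (mkhel i v)).
Proof. by move=> gv; rewrite hval_mkhel. Qed.

Lemma acochain_mkhel i k v F : acochain k F ->
  acochain (k + (i - 1)) (ctr (mkhel i v) F).
Proof. by move=> hF; have := ac_ctr (mkhel i v) hF; rewrite sdeg_mkhel. Qed.

Lemma wshift_mkhel i n m v F : gr g i v -> fil g n v -> wshift 0 m F ->
  wshift 0 (m + n) (ctr (mkhel i v) F).
Proof.
by move=> gv fv wF; rewrite -[n]subr0; apply: wshift_ctr => //; apply: fil_mkhel.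
Qed.

Lemma gmap_flow_sum i k m F s : acochain k F -> wshift 0 m F ->
  gmap i (sdegs s + (k + (i - 1)))
    (fun v => flow_sum (k + (i - 1)) (ctr (mkhel i v) F) s).
Proof.
move=> hF wF.
have bnd v : gr g i v -> exists n, wshift 0 n (ctr (mkhel i v) F).
  move=> gv; have [n hn] := fil_exhaustive (fdgla_axioms g) gv.
  by exists (m + n); apply: wshift_mkhel.
split=> [v gv|c v w gv gw|]; first exact: gsum_gr.
  have [n1 w1] := bnd v gv; have [n2 w2] := bnd w gw.
  rewrite -gsumD; try exact: (flow_summable s (acochain_mkhel _ _ hF)).
  - apply: eq_gsum => n; rewrite ctr_mkhel_lin //; last exact: ac_lin hF.
    by rewrite flow_coef_lin.
  - exact: (flow_summable s (acochain_mkhel _ _ hF) w1).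
  exact: (flow_summable s (acochain_mkhel _ _ hF) w2).
have [p hp] := fbound_exists s; exists (\sum_(q <- p) (q - 0) + m) => n v gv fv.
have wv := wshift_mkhel gv fv wF.
apply: gsum_fil => [|l]; first exact: (flow_summable s (acochain_mkhel _ _ hF) wv).
by apply: (fil_le _ (wshift_flow l wv hp)); set S := \sum_(_ <- _) _; lia.
Qed.

Lemma exp_helE x : exp_hel a x = mkhel (hdeg x) (exp_ad (hdeg x) a (hval x)).
Proof.
apply: hel_eq; first by rewrite hdeg_mkhel.
by rewrite hval_mkhel //; apply: gsum_gr.
Qed.

Lemma flow_sum_cons k m F x s : acochain k F -> wshift 0 m F ->
  flow_sum k F (x :: s) = flow_sum (k + sdeg x) (ctr (exp_hel a x) F) s.
Proof.
move=> hF wF; have gm := gmap_flow_sum (hdeg x) s hF wF.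
have [q hq] := fil_exhaustive (fdgla_axioms g) (hgr x).
have gj j := iter_ad_gr j ga (hgr x).
rewrite exp_helE exp_adE /adser -/(sdeg x) (gmap_gsum gm); last first.
  exact: adser_summable (hgr x).
pose w j n := flow_coef n (ctr (exp_coef_hel x j) F) s.
have wj j : wshift 0 (m + (j%:Z + q)) (ctr (exp_coef_hel x j) F).
  apply: wshift_mkhel => //; first exact: grZ.
  by apply: filZ; apply: iter_ad_fil => //; apply: hgr.
have aj j : acochain (k + sdeg x) (ctr (exp_coef_hel x j) F).
  exact: acochain_mkhel.
rewrite /flow_sum sdegs_cons.
have -> : sdeg x + sdegs s + k = sdegs s + (k + sdeg x) by lia.
have gw j n : gr g' (sdegs s + (k + sdeg x)) (w j n) by apply: flow_gr.
have nw : null2 w.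
  have [p hp] := fbound_exists s; set S := \sum_(r <- p) (r - 0).
  move=> N; exists (absz (N - (S : int) - m - q)%R) => j n le.
  by apply: (fil_le _ (wshift_flow n (wj j) hp)); rewrite -/S; lia.
rewrite [RHS](gsum_diag gw nw); apply: eq_gsum => n.
rewrite -[LHS]/(ctr x (flow_coef n F) s) (ctr_flow n x hF) /w.
by elim/big_rec2: _ => // j y f _ <-.
Qed.


(** The path pi(t) = exp(t a) |> 0 starts in the direction -da, and its n-th
    power inside a symmetric cochain is a Cauchy product. *)
Let v0 : g := - dif g 0 a.

Let gv0 : gr g 1 v0.
Proof. exact: (grN (dif_gr (fdgla_axioms g) ga)). Qed.

Let fv0 : fil g 1 v0.
Proof. by apply: filN; apply: (fil_dif (fdgla_axioms g)). Qed.

Definition path_coef j : g := dexp_coef K j *: iter j (br g 0 1 a) v0.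
Definition path_hel j : hel g := mkhel 1 (path_coef j).

Lemma path_coef_gr j : gr g 1 (path_coef j).
Proof. by apply: grZ; apply: iter_ad_gr. Qed.

Lemma path_coef_fil j : fil g (j%:Z + 1) (path_coef j).
Proof. by apply: filZ; apply: iter_ad_fil. Qed.

Lemma gauge_act0 : gauge_act a 0 = gsum 1 path_coef.
Proof.
have gda : gr g 1 (dif g 0 a) := dif_gr (fdgla_axioms g) ga.
rewrite /gauge_act (gmap0 (gmap_exp_ad 1 ga fa)) sub0r.
by rewrite -(gmapN (gmap_dexp_ad 1 ga fa)).
Qed.

(* The coefficient of order n + m of F(pi(t), ..., pi(t)), with n arguments. *)
Fixpoint power_coef n m F : g' :=
  if n is n'.+1 then \sum_(j < m.+1) power_coef n' (m - j)%N (ctr (path_hel j) F)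
  else if m is 0%N then F [::] else 0.

Lemma acochain_path j k F : acochain k F -> acochain k (ctr (path_hel j) F).
Proof. by move=> hF; have := acochain_mkhel 1 (path_coef j) hF; rewrite subrr addr0. Qed.

Lemma wshift_path j m F : wshift 0 m F -> wshift 0 (m + (j%:Z + 1)) (ctr (path_hel j) F).
Proof.
by apply: wshift_mkhel; [apply: path_coef_gr | apply: path_coef_fil].
Qed.

Lemma power_coef_gr n m k F : acochain k F -> gr g' k (power_coef n m F).
Proof.
elim: n m F => [|n IH] m F hF /=; last first.
  by apply: gr_sum => j _; apply: IH; apply: acochain_path.
by case: m => [|m]; [exact: deg_nil (ac_deg hF) | exact: gr0].
Qed.

Lemma power_coef_fil n m e F : wshift 0 e F ->
  fil g' (n%:Z + m%:Z + e) (power_coef n m F).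
Proof.
elim: n m e F => [|n IH] m e F wF /=; last first.
  apply: fil_bigsum => j _.
  apply: (fil_le _ (IH (m - j)%N _ _ (wshift_path j wF))).
  by have := ltn_ord j; lia.
case: m => [|m]; last exact: fil0.
by have := wF [::] [::] I; rewrite big_nil !add0r.
Qed.

Lemma triangle_swap (V : zmodType) (w : nat -> nat -> V) (M : nat) :
  \sum_(l < M) \sum_(m < M - l) w l m = \sum_(l < M) \sum_(m < M - l) w m l.
Proof.
rewrite triangle_sum (triangle_sum (fun i j : nat => w j i)); apply: eq_bigr => k _.
rewrite (reindex_inj rev_ord_inj) /=; apply: eq_bigr => l _ /=.
by rewrite subSS subKn // -ltnS.
Qed.

Lemma sum_subSn (V : zmodType) (f : nat -> nat -> V) m :
  \sum_(j < m.+1) \sum_(i < (m - j).+1) f j i =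
  \sum_(j < m.+1) \sum_(i < (m - j).+1) f i j.
Proof.
have e (h : nat -> nat -> V) : \sum_(j < m.+1) \sum_(i < (m - j).+1) h j i =
    \sum_(j < m.+1) \sum_(i < m.+1 - j) h j i.
  by apply: eq_bigr => j _; rewrite subSn // -ltnS.
by rewrite e triangle_swap -(e (fun j i : nat => f i j)).
Qed.

Lemma ctr_pathC k F (i j : nat) : acochain k F ->
  ctr (path_hel i) (ctr (path_hel j) F) = ctr (path_hel j) (ctr (path_hel i) F).
Proof.
move=> hF; rewrite (ctrC _ _ (ac_sym hF)) !sdeg_mkhel subrr mul0r.
exact: scale1r.
Qed.

(** Differentiating the n-th power: each of the n factors contributes equally,
    by symmetry of F. *)
Lemma power_coef_deriv (n m : nat) k F : acochain k F ->
  power_coef n.+1 m F *+ (n.+1 + m) =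
  (\sum_(j < m.+1) power_coef n (m - j) (ctr (path_hel j) F) *+ j.+1) *+ n.+1.
Proof.
elim: n m F => [|n IH] m F hF.
  rewrite /= mulr1n add1n -sumrMnl big_ord_recr [RHS]big_ord_recr /=.
  have z (j : 'I_m) : (m - j = (m - j).-1.+1)%N by have := ltn_ord j; lia.
  by rewrite !big1 //= => j _; rewrite z ?mul0rn.
rewrite [power_coef n.+2 m F]/= -sumrMnl.
pose f (j i : nat) := power_coef n (m - j - i) (ctr (path_hel i) (ctr (path_hel j) F)).
transitivity (\sum_(j < m.+1) power_coef n.+1 (m - j) (ctr (path_hel j) F) *+ j.+1
    + (\sum_(j < m.+1) \sum_(i < (m - j).+1) f j i *+ i.+1) *+ n.+1).
  rewrite -sumrMnl -big_split; apply: eq_bigr => j _ /=.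
  rewrite -(IH (m - j)%N _ (acochain_path j hF)) -mulrnDr.
  by congr (_ *+ _); have := ltn_ord j; lia.
rewrite (sum_subSn (fun j i : nat => f j i *+ i.+1)) [RHS]mulrS; congr (_ + _ *+ _).
apply: eq_bigr => j _; rewrite [power_coef n.+1 _ _]/= -sumrMnl.
apply: eq_bigr => i _; rewrite /f (ctr_pathC j i hF).
by congr (power_coef _ _ _ *+ _); lia.
Qed.

(** The exponential formula.  Both sides satisfy the same recursion in n: on the
    left the flow starts in the direction -da transported by exp(t a), which is
    the derivative of pi(t); on the right this is the derivative of a power. *)
Lemma flow_coef_nil (n : nat) k F : acochain k F ->
  flow_coef n F [::] = \sum_(l < n.+1) (l`!%:R : K)^-1 *: power_coef l (n - l) F.
Proof.
have [N] := ubnP n; elim: N n F => // N IH [|n] F ltN hF.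
  by rewrite big_ord1 flow_coef0 invr1 scale1r.
apply: (mulrSn_inj charK0 (k := n)).
have -> : flow_coef n.+1 F [::] *+ n.+1 = (flow_coef n.+1 F *+ n.+1) [::].
  by rewrite -!scaler_nat.
rewrite flow_coefS /gauge_lie /=.
have -> : gauge_field [::] = v0 by [].
rewrite -[LHS]/(ctr (mkhel 1 v0) (flow_coef n F) [::]) (ctr_flow n _ hF).
pose f (j l : nat) := (l`!%:R : K)^-1 *: power_coef l (n - j - l) (ctr (path_hel j) F) *+ j.+1.
transitivity (\sum_(j < n.+1) \sum_(l < (n - j).+1) f j l).
  have -> : (\sum_(j < n.+1) flow_coef (n - j)
      (ctr (exp_coef_hel (mkhel 1 v0) j) F)) [::] =
    \sum_(j < n.+1) flow_coef (n - j) (ctr (exp_coef_hel (mkhel 1 v0) j) F) [::].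
    by elim/big_rec2: _ => // j y h _ <-.
  apply: eq_bigr => j _.
  have -> : ctr (exp_coef_hel (mkhel 1 v0) j) F = j.+1%:R *: ctr (path_hel j) F.
    rewrite -ctr_mkhelZ //; [|exact: ac_lin hF | exact: path_coef_gr].
    rewrite /exp_coef_hel hdeg_mkhel hval_mkhel // scalerA.
    by rewrite [_%:R * _]mulrC factV_S.
  rewrite flow_coefZ cochainZ IH; first last.
  - exact: acochain_path.
  - by apply: leq_ltn_trans (leq_subr _ _) _; rewrite -ltnS.
  by rewrite scaler_nat -sumrMnl.
rewrite (sum_subSn f).
rewrite -sumrMnl [RHS]big_ord_recl [X in X + _]/= scaler0 mul0rn add0r.
apply: eq_bigr => j _; rewrite scalerMnr.
have lej : (j <= n)%N by rewrite -ltnS.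
have -> : (n.+1 - bump 0 j = n - j)%N by [].
have := power_coef_deriv j (n - j) hF.
have -> : (j.+1 + (n - j) = n.+1)%N by lia.
move=> ->; rewrite -scalerMnr scalerMnl -mulr_natr factV_S //.
rewrite scaler_sumr; apply: eq_bigr => i _.
by rewrite /f scalerMnr subnAC.
Qed.

Let pi_hel : hel g := mkhel 1 (gauge_act a 0).

Lemma power_summable n k e F : acochain k F -> wshift 0 e F ->
  summable k (fun m => power_coef n m F).
Proof.
move=> hF wF; apply: (@summable_shift _ _ _ _ (n%:Z + e)) => m.
  exact: power_coef_gr.
by apply: (fil_le _ (power_coef_fil n m wF)); lia.
Qed.

Lemma power_sum n k e F : acochain k F -> wshift 0 e F ->
  F (nseq n pi_hel) = gsum k (fun m => power_coef n m F).
Proof.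
elim: n e F => [|n IH] e F hF wF.
  by rewrite -[LHS](gsum1 (deg_nil (ac_deg hF))).
have gm : gmap 1 k (fun v => F (mkhel 1 v :: nseq n pi_hel)).
  have sd : sdegs (nseq n pi_hel) = 0.
    elim: (n) => [|l IHl]; first by rewrite sdegs_nil.
    by rewrite sdegs_cons sdeg_mkhel subrr add0r.
  have [p hp] := fbound_exists (nseq n pi_hel).
  split=> [v gv|c v w gv gw|].
  - have := ac_deg hF (mkhel 1 v :: nseq n pi_hel).
    by rewrite sdegs_cons sdeg_mkhel subrr add0r sd add0r.
  - exact: (congr1 (fun f => f _) (ctr_mkhel_lin c (ac_lin hF) gv gw)).
  exists (\sum_(q <- p) (q - 0) + e) => l v gv fv.
  have := wF (mkhel 1 v :: nseq n pi_hel) (l :: p).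
  rewrite big_cons -addrA subr0; apply; split=> //; exact: fil_mkhel.
rewrite -[LHS]/((fun v => F (mkhel 1 v :: nseq n pi_hel)) (gauge_act a 0)).
rewrite gauge_act0 (gmap_gsum gm); last first.
  apply: (@summable_shift _ _ _ _ 1) => j; first exact: path_coef_gr.
  exact: path_coef_fil.
pose w j m := power_coef n m (ctr (path_hel j) F).
have gw j m : gr g' k (w j m) by apply: power_coef_gr; apply: acochain_path.
have nw : null2 w.
  move=> l; exists (absz (l - e)) => j m le.
  by apply: (fil_le _ (power_coef_fil n m (wshift_path j wF))); lia.
rewrite -[RHS](gsum_diag gw nw); apply: eq_gsum => j.
exact: (IH _ _ (acochain_path j hF) (wshift_path j wF)).
Qed.

Lemma flow_sum_nil k e F : acochain k F -> wshift 0 e F ->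
  flow_sum k F [::] = gsum k (fun n => (n`!%:R : K)^-1 *: F (nseq n pi_hel)).
Proof.
move=> hF wF; rewrite /flow_sum sdegs_nil add0r.
pose w (l m : nat) := (l`!%:R : K)^-1 *: power_coef l m F.
have gw (l m : nat) : gr g' k (w l m) by apply: grZ; apply: power_coef_gr.
have nw : null2 w.
  move=> n; exists (absz (n - e)) => l m le; apply: filZ.
  by apply: (fil_le _ (power_coef_fil l m wF)); lia.
transitivity (gsum k (fun n => \sum_(l < n.+1) w l (n - l)%N)).
  by apply: eq_gsum => n; apply: flow_coef_nil hF.
rewrite -(gsum_diag gw nw); apply: eq_gsum => l.
rewrite (power_sum l hF wF) -gsumZ //; exact: power_summable hF wF.
Qed.

Lemma move_even (y : hel g) n F s : sdeg y = 0 -> graded_symmetric F ->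
  F (nseq n y ++ s) = F (s ++ nseq n y).
Proof.
move=> y0; elim: n F => [|n IH] F hF; first by rewrite cats0.
have hF1 : graded_symmetric (ctr y F) by move=> s1; apply: (hF (y :: s1)).
rewrite -[LHS]/(ctr y F (nseq n y ++ s)) IH // /ctr.
rewrite /=; move: (nseq n y) => t.
suff h s1 : F (s1 ++ y :: s ++ t) = F (s1 ++ s ++ y :: t) by apply: (h [::]).
elim: (s) s1 => [//|x s2 IHs] s1 /=.
by rewrite hF y0 mul0r scale1r -cat_rcons IHs cat_rcons.
Qed.

(** The flow at time 1 is the twist by pi = exp(a) |> 0 composed with exp(a):
    on Sym(g[1]) the flow of the field is the substitution of
    pi + exp([a, .]) x for x. *)
Lemma flow_twist k e F s : acochain k F -> wshift 0 e F ->
  flow_sum k F s = gsum (sdegs s + k)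
    (fun n => (n`!%:R : K)^-1 *: F (nseq n pi_hel ++ map (exp_hel a) s)).
Proof.
elim: s k e F => [|x s IH] k e F hF wF.
  rewrite (flow_sum_nil hF wF) sdegs_nil add0r.
  by apply: eq_gsum => n; rewrite cats0.
have [q hq] := fil_exhaustive (fdgla_axioms g) (hgr x).
have hex : hdeg (exp_hel a x) = hdeg x by [].
have w1 : wshift 0 (e + q) (ctr (exp_hel a x) F).
  rewrite exp_helE; apply: wshift_mkhel => //; first exact: gsum_gr.
  by apply: adser_fil => //; apply: hgr.
rewrite (flow_sum_cons x s hF wF) (IH _ _ _ (ac_ctr (exp_hel a x) hF) w1).
rewrite sdegs_cons /sdeg hex.
have -> : sdegs s + (k + (hdeg x - 1)) = hdeg x - 1 + sdegs s + k by lia.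
apply: eq_gsum => n; congr (_ *: _).
have y0 : sdeg pi_hel = 0 by rewrite sdeg_mkhel.
rewrite !move_even //; first exact: ac_sym hF.
exact: (ac_sym (ac_ctr (exp_hel a x) hF)).
Qed.

End Flow.

(** * The path of twisted morphisms *)

Section FlowPath.
Variables (K : fieldType) (charK0 : [pchar K] =i pred0) (g g' : fdgla K).
Variables (a : g) (ga : gr g 0 a) (fa : fil g 1 a).
Local Notation cochain := (cochain g g').
Local Notation U := (uconv charK0 g g').
Local Notation T := (tser charK0 U).
Local Notation Q := (@Qco K g).
Implicit Types (F G : cochain) (s : seq (hel g)).

Let ha : hel g := Hel ga.
Let lie F : cochain := gauge_lie ga F.

Lemma lie_Qco k F : acochain k F ->
  lie F = ctr ha (vcomp 2 F Q) + vcomp 2 (ctr ha F) Q.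
Proof.
move=> hF; rewrite ctr_comp; have -> : ksign K ((2 - 1) * sdeg ha) = -1 by [].
by rewrite scaleN1r addrNK.
Qed.

(** The field is the commutator of the differential with the contraction by a,
    hence commutes with the differential, whose square is 0. *)
Lemma lie_dif F : acochain 1 F -> lie (dif U 1 F) = dif U 1 (lie F).
Proof.
move=> hF; have dif1 H : dif U 1 H = 1 *: vcomp 2 H Q + postd 1 H :> cochain.
  by rewrite scale1r addrC -[vcomp 2 H Q]scale1r.
have comm : lie (vcomp 2 F Q) = vcomp 2 (lie F) Q.
  have hFQ := acochain_comp hF (acochain_Qco g).
  rewrite (lie_Qco hFQ) (lie_Qco hF).
  have -> : vcomp 2 (vcomp 2 F Q) Q = 0.
    by apply: funext => t; apply: (comp_Qco_Qco charK0 t hF).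
  apply: funext => t; rewrite -[ctr ha 0]/(0 : cochain) add0r.
  rewrite -[in RHS](scale1r (ctr ha (vcomp 2 F Q))) comp_linl scale1r.
  by rewrite (comp_Qco_Qco charK0 t (ac_ctr ha hF)) addr0.
rewrite !dif1 /lie gauge_lie_lin -/(lie _) comm; congr (_ + _).
apply: funext => t; rewrite /gauge_lie comp_postd; last exact: ac_deg hF.
by rewrite subrr addr0.
Qed.

Lemma lie_br F G : acochain 1 F -> acochain 1 G ->
  lie (br U 1 1 F G) = br U 1 1 (lie F) G + br U 1 1 F (lie G).
Proof.
move=> hF hG; apply: funext => s; rewrite /lie /gauge_lie /= comp_cbr ?subrr //.
- by rewrite mulr0 scale1r addr0.
- exact: ac_deg hF.
exact: ac_deg hG.
Qed.

(** The image of F under the flow, as a power series of cochains; as shown by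
    its values it is t |-> F^(pi(t)) o exp([t a, .]). *)
Definition flow_series F : T := fun n => flow_coef ga n F.
Definition flow_generator F : T := fun n => ctr ha (flow_coef ga n F).

Section Morphism.
Variable F : cochain.
Hypotheses (hF : acochain 1 F) (wF : wshift 0 0 F).
Hypothesis mcF : dif U 1 F + (2%:R : K)^-1 *: br U 1 1 F F = 0.

Let G := flow_series F.
Let L := flow_generator F.

Let aG n : acochain 1 (G n).
Proof. exact: acochain_flow. Qed.

Let wG n : wshift 0 n%:Z (G n).
Proof. by have := wshift_flow ga fa n wF; rewrite addr0. Qed.

Lemma flow_series_gr : gr T 1 G.
Proof.
split=> [n|n]; first by split=> //; apply: wshift_le (wG n).
exists (absz n) => k le; apply: wshift_weaken; apply: wshift_le (wG k); lia.
Qed.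

Lemma flow_generator_gr : gr T 0 L.
Proof.
have wL n : wshift 0 (n%:Z + (1 - 0)) (L n) by apply: (wshift_ctr (wG n)).
split=> [n|n]; first split; first exact: (ac_ctr ha (aG n)).
  by apply: wshift_le (wL n); lia.
exists (absz n) => k le; apply: wshift_weaken; apply: wshift_le (wL k); lia.
Qed.

Lemma tder_flow n : tder G n = lie (G n).
Proof. exact: flow_coefS. Qed.

(** The field commutes with the differential and acts as a derivation of the
    bracket, so the defect of the Maurer-Cartan equation satisfies a linear
    recursion with initial value 0. *)
Lemma flow_series_mc : dif T 1 G + (2%:R : K)^-1 *: br T 1 1 G G = 0.
Proof.
have gG := flow_series_gr; have gG' := tder_gr gG.
apply: funext => n; rewrite !tserE; elim: n => [|n IH].
  by rewrite /= big_ord1 /G /flow_series flow_coef0.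
apply: (mulrSn_inj charK0 (k := n)).
rewrite mulrnDl mul0rn scalerMnr -/(tder (br T 1 1 G G) n) -/(tder (dif T 1 G) n).
rewrite tder_difC // tderM // tserE.
have -> : br T 1 1 (tder G) G n + br T 1 1 G (tder G) n = lie (br T 1 1 G G n).
  rewrite /= /lie gauge_lie_sum -big_split; apply: eq_bigr => l _ /=.
  by rewrite !tder_flow -/(lie _) -[RHS]/(lie (br U 1 1 _ _)) lie_br.
have -> : dif T 1 (tder G) n = lie (dif U 1 (G n)).
  by rewrite (lie_dif (aG n)) -tder_flow.
have -> : lie (dif U 1 (G n)) + 2%:R^-1 *: lie (br T 1 1 G G n) =
    lie (2%:R^-1 *: br T 1 1 G G n + dif U 1 (G n)).
  by rewrite /lie gauge_lie_lin addrC.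
rewrite addrC -[dif U 1 (G n)]/(dif T 1 G n) in IH *.
by rewrite IH /lie; have := gauge_lieZ ga 0 (0 : cochain); rewrite !scale0r.
Qed.

(** Contracting the Maurer-Cartan equation of G with a turns the composition
    with Q into the field plus the composition of L with Q. *)
Lemma flow_series_flow : flow G L.
Proof.
have gG := flow_series_gr; have gL := flow_generator_gr.
apply: funext => n; rewrite tder_flow (lie_Qco (aG n)) !tserE.
have eL : br T 1 0 G L = - br T 0 1 L G.
  by rewrite (br_antisym (fdgla_axioms T) gG gL) mulr0 scale1r.
have mc : vcomp 2 (G n) Q =
    - (2%:R : K)^-1 *: br T 1 1 G G n + - 1 *: postd 1 (G n).
  have e : postd 1 (G n) + 1 *: vcomp 2 (G n) Q + (2%:R : K)^-1 *: br T 1 1 G G n = 0.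
    exact: (congr1 (fun f : T => f n) flow_series_mc).
  apply: subr0_eq; rewrite -e; lmod.
have cbrG : ctr ha (br T 1 1 G G n) = - 2%:R *: br T 0 1 L G n.
  have -> : ctr ha (br T 1 1 G G n) = - br T 0 1 L G n + br T 1 0 G L n.
    rewrite /= -sumrN -big_split /=.
    have -> : ctr ha (\sum_(l < n.+1) cbr 1 1 (G l) (G (n - l)%N)) =
        \sum_(l < n.+1) ctr ha (cbr 1 1 (G l) (G (n - l)%N)).
      by apply: (big_morph (ctr ha)).
    apply: eq_bigr => l _; rewrite ctr_cbr.
    by have -> : ksign K (1 * sdeg ha) = -1 by []; rewrite scaleN1r.
  by rewrite eL tserE; lmod.
rewrite mc ctr_lin cbrG -[ctr ha (_ *: postd 1 (G n))]/(- 1 *: ctr ha (postd 1 (G n))).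
rewrite ctr_postd -[dif T 0 L n]/(postd 0 (L n) + ksign K (0 - 1) *: vcomp 2 (L n) Q).
have -> : ksign K (0 - 1) = -1 by [].
have -> : 1 + sdeg ha = 0 by [].
rewrite scalerA mulNr mulrN opprK mulVf ?scale1r; last exact: natS_neq0.
rewrite -/(L n); lmod.
Qed.

End Morphism.
End FlowPath.

(** * Constant cochains and evaluation *)

Section Constants.
Variables (K : fieldType) (charK0 : [pchar K] =i pred0) (g g' : fdgla K).
Local Notation cochain := (cochain g g').
Local Notation U := (uconv charK0 g g').
Local Notation TU := (tser charK0 U).
Local Notation T' := (tser charK0 g').
Implicit Types (F G : cochain) (s : seq (hel g)) (v : g').

Definition const_cochain v : cochain := fun s => if s is [::] then v else 0.

Lemma const_cochain_fil c n v : fil g' n v -> wshift c n (const_cochain v).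
Proof.
move=> fv [|x s] [|q p] //=; last by move=> *; apply: fil0.
by move=> _; rewrite big_nil add0r.
Qed.

Lemma const_cochain_gr i n v : gr g' i v -> fil g' n v -> 0 <= n ->
  gr U i (const_cochain v) /\ fil U n (const_cochain v).
Proof.
move=> gv fv n0; split; last exact: const_cochain_fil.
split; last by apply: const_cochain_fil; apply: fil_le fv.
split=> [s1 s2 x y z b _ _ _|s1 s2 x y|[|x s]].
- by case: s1 => [|? ?]; rewrite /= scaler0 addr0.
- by case: s1 => [|? ?]; rewrite /= scaler0.
- by rewrite sdegs_nil add0r.
exact: gr0.
Qed.

Lemma ctr_const v x : ctr x (const_cochain v) = 0. Proof. by []. Qed.

Lemma vcomp_const_cochain l v (V : Defs.cochain g g) s :
  vcomp l (const_cochain v) V s = 0.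
Proof.
have z k (W : Defs.cochain g g) t : vcomp k (0 : cochain) W t = 0.
  by have := comp_Zl k 0 (0 : cochain) W t; rewrite !scale0r.
elim: s l V => [//|x s IH] l V /=.
by rewrite IH ctr_const z scaler0 addr0.
Qed.

(* Only the distribution giving all of s to F contributes. *)
Lemma cbr_const i v F s : has_deg i F ->
  cbr 0 i (const_cochain v) F s = br g' 0 (sdegs s + i) v (F s).
Proof.
elim: s i F => [|x s IH] i F hF; first by rewrite /= sdegs_nil add0r.
rewrite [LHS]/= ctr_const IH; last exact: deg_ctr.
have -> : cbr (0 + sdeg x) i (0 : cochain) F s = 0.
  have h0 : has_deg (0 + sdeg x) (0 : cochain) by move=> t; apply: gr0.
  by have := cbr_Zl 0 s h0 hF; rewrite !scale0r.
rewrite scaler0 add0r sdegs_cons.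
by have -> : sdegs s + (i + sdeg x) = sdeg x + sdegs s + i by lia.
Qed.

Definition const_series (A : T') : TU := fun k => const_cochain (A k).

Lemma const_series_gr i (A : T') : gr T' i A -> fil T' 1 A ->
  gr TU i (const_series A) /\ fil TU 1 (const_series A).
Proof.
move=> [gA nA] fA; have h k : gr U i (const_cochain (A k)) /\
    fil U 1 (const_cochain (A k)) by apply: const_cochain_gr.
split; last by move=> k; case: (h k).
split=> [k|n]; first by case: (h k).
have [N hN] := nA n; exists N => k le.
exact: (@const_cochain_fil 1 n _ (hN k le)).
Qed.

Lemma const_seriesN (A : T') : - const_series A = const_series (- A).
Proof.
by apply: funext => k; apply: funext => -[|x s] //; exact: oppr0.
Qed.

Definition eval_at s (p : TU) : T' := fun k => p k s.

Lemma gmap_eval i s : gmap i (sdegs s + i) (eval_at s).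
Proof.
have [q hq] := fbound_exists s; set c := \sum_(r <- q) (r - 1).
split=> [p [hp np]|//|].
  split=> [k|n]; first by have [[_ _ hd] _] := hp k; apply: hd.
  have [N hN] := np (n - c); exists N => k le.
  by rewrite -[n](subrK c) addrC; apply: (hN k le s q hq).
by exists c => n p gp fp k; rewrite addrC; apply: (fp k s q hq).
Qed.

Lemma gmap_eval0 i s : @gmap K U g' i (sdegs s + i) (fun F => F s).
Proof.
have [q hq] := fbound_exists s; set c := \sum_(r <- q) (r - 1).
split=> [F [[_ _ hd] _]|//|]; first exact: hd.
by exists c => n F gF fF; rewrite addrC; apply: (fF s q hq).
Qed.

Lemma eval_ad i s (A : T') (p : TU) : gr TU i p ->
  eval_at s (br TU 0 i (const_series A) p) =
    br T' 0 (sdegs s + i) A (eval_at s p).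
Proof.
move=> [hp _]; apply: funext => k; rewrite /eval_at /=.
have -> : (\sum_(l < k.+1) cbr 0 i (const_series A l) (p (k - l)%N)) s =
    \sum_(l < k.+1) cbr 0 i (const_series A l) (p (k - l)%N) s.
  by elim/big_rec2: _ => // l y f _ <-.
apply: eq_bigr => l _; apply: cbr_const.
by case: (hp (k - l)%N) => -[].
Qed.

Lemma eval_adser c i s (A : T') (p : TU) : gr T' 0 A -> fil T' 1 A -> gr TU i p ->
  eval_at s (adser c i (const_series A) p) = adser c (sdegs s + i) A (eval_at s p).
Proof.
move=> gA fA gp; have [gB fB] := const_series_gr gA fA.
apply: (gmap_adser_comm (E := T') c (gmap_eval i s) gB fB gp) => q gq.
exact: eval_ad.
Qed.

Lemma eval_teval i s (p : TU) (t : K) : gr TU i p ->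
  teval i p t s = teval (sdegs s + i) (eval_at s p) t.
Proof.
move=> gp; rewrite /teval (gmap_gsum (gmap_eval0 i s)) //.
exact: summable_teval.
Qed.

Lemma dif_const_series s (A : T') : eval_at s (dif TU 0 (const_series A)) =
  if s is [::] then dif T' 0 A else 0.
Proof.
apply: funext => k; rewrite /eval_at /= cochainD cochainZ vcomp_const_cochain.
rewrite scaler0 addr0 /postd; case: s => [|x s] /=; first by rewrite sdegs_nil.
exact: (gmap0 (gmap_dif g' _)).
Qed.

Lemma tder_const_series s (A : T') : eval_at s (tder (const_series A)) =
  if s is [::] then tder A else 0.
Proof.
apply: funext => k; rewrite /eval_at /tder -scaler_nat cochainZ.
case: s => [|x s] /=; first by rewrite scaler_nat.
exact: scaler0.
Qed.

End Constants.

(** * Reduced paths *)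

Section Reduced.
Variables (K : fieldType) (charK0 : [pchar K] =i pred0) (g g' : fdgla K).
Local Notation U := (uconv charK0 g g').
Local Notation C := (convF charK0 g g').
Local Notation TU := (tser charK0 U).
Local Notation TC := (tser charK0 C).
Implicit Types (i : int).

Definition reduced (p : TU) := forall k, p k [::] = 0.

Lemma reduced_gr i (p : TU) : gr TU i p -> reduced p -> gr TC i p.
Proof.
move=> [gp np] rp; split=> [k|n]; first by apply/(hom_grP charK0).
by have [N hN] := np n; exists N => k le; apply/(conv_filP n (gp k) (rp k)); apply: hN.
Qed.

Lemma reduced_fil i (p : TU) : gr TU i p -> reduced p -> fil TC 1 p.
Proof.
move=> [gp _] rp k; apply/(conv_filP 1 (gp k) (rp k)).
suff : wshift 1 1 (p k) by []; move=> s q hq.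
case: s hq => [|x s] hq; first by rewrite rp; apply: fil0.
have [_ w] := gp k; apply: (fil_le _ (w _ _ hq)).
by rewrite !weight_sum (fbound_size hq) /=; lia.
Qed.

Lemma reduced_teval i (p : TU) t : gr TU i p -> reduced p ->
  @teval K C i p t = @teval K U i p t.
Proof.
move=> gp rp; have gC := reduced_gr gp rp; apply/esym.
have sC := gsumP (summable_teval t gC).
have grY : gr C i (@teval K C i p t) by apply: gsum_gr.
have grYU : gr U i (@teval K C i p t) by have [] := (hom_grP charK0 _ _).1 grY.
apply: (@gsum_uniq K U i _ _ grYU) => n; have [N hN] := sC n; exists N => m le.
have [gp1 _] := gp.
have gS : gr C i (@teval K C i p t - \sum_(j < m) t ^+ j *: p j).
  apply: grB => //; apply: gr_sum => j _; apply: grZ; by case: gC.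
have [h1 h2] := (hom_grP charK0 _ _).1 gS.
exact: ((conv_filP n h1 h2).1 (hN m le)).
Qed.

Lemma reduced_flow (p l : TU) : gr TU 1 p -> gr TU 0 l -> reduced p -> reduced l ->
  flow p l -> flow (p : TC) (l : TC).
Proof.
move=> [gp _] [gl _] rp rl hf; rewrite /flow.
have e1 : dif TC 0 l = dif TU 0 l.
  by apply: funext => k; apply: (conv_difE (charK0 := charK0)).
have e2 : br TC 0 1 l p = br TU 0 1 l p.
  apply: funext => k; rewrite /=; apply: eq_bigr => j _.
  exact: (conv_brE (gl j) (gp _) (rl j) (rp _)).
by rewrite e1 e2; exact: hf.
Qed.

End Reduced.

Section TwistValues.
Variables (K : fieldType) (charK0 : [pchar K] =i pred0) (g g' : fdgla K).
Local Notation cochain := (cochain g g').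
Implicit Types (F : cochain) (s : seq (hel g)).

Lemma mkhel_Hel i v (h : gr g i v) : mkhel i v = Hel h.
Proof. by apply: hel_eq; rewrite ?hdeg_mkhel ?hval_mkhel. Qed.

Lemma flow_coef_scale (t : K) a (ga : gr g 0 a) (gta : gr g 0 (t *: a)) n k F :
  acochain k F -> flow_coef gta n F = t ^+ n *: flow_coef ga n F.
Proof.
move=> hF; have field : gauge_field gta = t *: gauge_field ga.
  rewrite /gauge_field -!mkhel_Hel ctr_mkhelZ //.
  exact: (ac_lin (acochain_Qco g)).
have it m : acochain k (iter m (gauge_lie ga) F).
  by elim: m => //= m IH; apply: acochain_lie.
rewrite /flow_coef; have -> : iter n (gauge_lie gta) F =
    t ^+ n *: iter n (gauge_lie ga) F; last by lmod.
elim: n => [|n IH] /=; first by rewrite scale1r.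
rewrite IH gauge_lieZ {1}/gauge_lie field; apply: funext => s.
rewrite !cochainZ comp_Zr; first by rewrite scalerA exprSr.
  exact: (ac_lin (it n)).
exact: (ac_deg (acochain_field ga)).
Qed.

(** [a, a] = 0, so exp(a) fixes a. *)
Lemma exp_hel_self (t : K) a (ga : gr g 0 a) : exp_hel (t *: a) (Hel ga) = Hel ga.
Proof.
apply: hel_eq => //=.
have aa : br g 0 0 a a = 0.
  have := br_antisym (fdgla_axioms g) ga ga; rewrite mul0r scale1r => e.
  by apply: (mulrSn_inj charK0 (k := 1)); rewrite mulr2n {1}e addNr mul0rn.
rewrite -[RHS](gsum1 ga); apply: eq_gsum => -[|k].
  by rewrite invr1 scale1r.
rewrite (iter_adZ t k.+1 ga ga) iterSr aa.
have -> : iter k (br g 0 0 a) 0 = 0.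
  by apply: (gmap0 (gmap_iter_ad ga 0 k)).
by rewrite !scaler0.
Qed.

Lemma twist_flow a (ga : gr g 0 a) (fa : fil g 1 a) F e (x : hel g) s :
  acochain 1 F -> wshift 0 e F -> x = mkhel 1 (gauge_act a 0) -> s <> [::] ->
  twist F x (map (exp_hel a) s) = flow_sum ga 1 F s.
Proof.
move=> hF wF -> s0; rewrite (flow_twist charK0 ga fa s hF wF).
have -> : sdegs s = sdegs (map (exp_hel a) s).
  elim: (s) => [|y t IH]; first by [].
  by rewrite /= !sdegs_cons IH.
by case: s s0.
Qed.

End TwistValues.

Theorem proposition3p10 (K : fieldType) (charK0 : [pchar K] =i pred0)
    (g g' : fdgla K)
    (F : conv g g') (F_Linfty : Linfty_morphism F)
    (pi : g) (pi_mc : maurer_cartan pi)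
    (a : g) (a_gr : gr g 0 a) (a_fil : fil g 1 a)
    (pi_gauge : pi = gauge_act a 0)
    (S : g') (S_def : S = mc_image F (Hel (mc_gr pi_mc)))
    (pi' lam' : tseries g') (path' : homotopy_path pi' lam' 0 S)
    (path_induced : induced_path F a_gr pi' lam')
    (A' : tseries g')
    (A'_gr : gr (tseries g') 0 A') (A'_fil : fil (tseries g') 1 A')
    (A'_ode : lam' = dexp_ad 0 A' (tder A'))
    (A'_0 : teval 0 A' 0 = 0) :
  let F' : conv g g' :=
    exp_conj (- teval 0 A' 1) (twist F (Hel (mc_gr pi_mc))) a in
  homotopy_equivalent F F' /\ gauge_equivalent F F'.
Proof.
move=> F'.
pose U := uconv charK0 g g'; pose C := convF charK0 g g'.
pose TU := tser charK0 U; pose T' := tser charK0 g'.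
have [F_gr F_eq] := F_Linfty.
have [[hF wF] F0] := (hom_grP charK0 1 F).1 F_gr.
have mcC : dif C 1 F + (2%:R : K)^-1 *: br C 1 1 F F = 0.
  apply: funext => s; rewrite -[LHS]/(dif C 1 F s + (2%:R : K)^-1 *: br C 1 1 F F s).
  have -> : dif C 1 F s = dif g' (sdegs s + 1) (F s) + comp_coder F s.
    by rewrite /= scale1r.
  have -> : br C 1 1 F F s = - cup 1 1 F F s by rewrite /= scale1r.
  by rewrite F_eq /Q1' -[RHS]/(0 : g'); lmod.
have gUF : gr U 1 F by split.
have mcU : dif U 1 F + (2%:R : K)^-1 *: br U 1 1 F F = 0.
  have := mcC; rewrite -[dif C 1 F]/(dif (conv g g') 1 F) (conv_difE gUF).
  by rewrite -[br C 1 1 F F]/(br (conv g g') 1 1 F F) (conv_brE gUF gUF F0 F0).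
pose G : TU := flow_series charK0 a_gr F; pose L : TU := flow_generator charK0 a_gr F.
have gG : gr TU 1 G := flow_series_gr charK0 a_gr a_fil hF wF.
have gL : gr TU 0 L := flow_generator_gr charK0 a_gr a_fil hF wF.
have GL : flow G L := flow_series_flow a_gr a_fil hF wF mcU.
pose A : TU := @const_series K charK0 g g' A'.
have [gA fA] := const_series_gr (charK0 := charK0) g A'_gr A'_fil.
pose w := dexp_ad 1 A (dif TU 0 A); pose l0 := dexp_ad 0 A (tder A).
have gw : gr TU 1 w := gsum_gr _ _; have gl0 : gr TU 0 l0 := gsum_gr _ _.
(* Gauge away the constant terms of the flow. *)
pose p := exp_ad 1 (- A) (G + w); pose l := exp_ad 0 (- A) (L - l0).
have gp : gr TU 1 p := gsum_gr _ _; have gl : gr TU 0 l := gsum_gr _ _.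
have pl : flow p l := flow_transform gG gL GL gA fA.
have gA' : gr T' 0 A' := A'_gr; have fA' : fil T' 1 A' := A'_fil.
have gdA : gr TU 1 (dif TU 0 A) := dif_gr (fdgla_axioms TU) gA.
have gdA' : gr T' 1 (dif T' 0 A') := dif_gr (fdgla_axioms T') gA'.
have gtA := tder_gr gA; have gtA' : gr T' 0 (tder A') := tder_gr gA'.
have gG0 : gr T' 1 (eval_at [::] G).
  by have := gmap_gr (gmap_eval charK0 g' 1 [::]) gG; rewrite sdegs_nil add0r.
have gL0 : gr T' 0 (eval_at [::] L).
  by have := gmap_gr (gmap_eval charK0 g' 0 [::]) gL; rewrite sdegs_nil add0r.
have w_nil : eval_at [::] w = dexp_ad 1 A' (dif T' 0 A').
  have := eval_adser (dexp_coef K) [::] gA' fA' gdA.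
  by rewrite dif_const_series sdegs_nil add0r.
have l0_nil : eval_at [::] l0 = dexp_ad 0 A' (tder A').
  have := eval_adser (dexp_coef K) [::] gA' fA' gtA.
  by rewrite tder_const_series sdegs_nil add0r.
have w_cons x s : eval_at (x :: s) w = 0.
  have := eval_adser (dexp_coef K) (x :: s) gA' fA' gdA.
  rewrite dif_const_series => ->.
  exact: (gmap0 (gmap_adser gA' fA' _ _)).
(* The constant term of L and lam' agree at every time t: both are the twist by
   pi(t) evaluated at a, the time t flow of a being the time 1 flow of t a. *)
have L_nil : eval_at [::] L = lam'.
  have glam : gr T' 0 lam' by rewrite A'_ode; apply: gsum_gr.
  apply: (teval_inj gL0 glam) => t; have [_ ->] := path_induced t.
  have gta : gr g 0 (t *: a) := grZ t a_gr.
  have fta : fil g 1 (t *: a) := filZ t a_fil.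
  rewrite -{1}(exp_hel_self charK0 t a_gr) -[[:: exp_hel _ _]]/(map (exp_hel (t *: a)) [:: Hel a_gr]).
  rewrite (twist_flow charK0 gta fta hF wF) //; last first.
    by rewrite (mkhel_Hel (gauge_act_gr _ _)).
  rewrite /flow_sum /teval sdegs_cons sdegs_nil.
  by apply: eq_gsum => n; rewrite (flow_coef_scale a_gr gta n hF).
have GL_nil : flow (eval_at [::] G : T') (eval_at [::] L : T').
  apply: funext => k; have := congr1 (fun q : TU => q k [::]) GL.
  have -> : (- dif TU 0 L + br TU 0 1 L G) k [::] =
      - dif U 0 (L k) [::] + br TU 0 1 L G k [::] by [].
  have -> : dif U 0 (L k) [::] = dif g' 0 (L k [::]).
    rewrite /= cochainD cochainZ /= (mkhel0 _ [::]) ?scaler0 ?addr0.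
      by rewrite /postd sdegs_nil.
    by case: gL => /(_ k)[] [].
  have -> : br TU 0 1 L G k [::] = \sum_(j < k.+1) br g' 0 1 (L j [::]) (G (k - j)%N [::]).
    by rewrite /=; elim/big_rec2: _ => // j y f _ <-.
  have -> : tder G k [::] = tder (eval_at [::] G) k.
    by rewrite /tder -!scaler_nat.
  by move=> ->.
have A'0 : A' 0%N = 0 by have := teval0 gA'; rewrite A'_0.
have G_nil : eval_at [::] G = - dexp_ad 1 A' (dif T' 0 A').
  rewrite (flow_gauge gG0 gL0 GL_nil gA' fA' A'0); last by rewrite L_nil A'_ode.
  have -> : eval_at [::] G 0%N = 0 by rewrite /eval_at /G /flow_series flow_coef0.
  have -> : tconst charK0 0 = 0 :> T' by apply: funext => -[].
  by rewrite /gauge_act (gmap0 (gmap_exp_ad 1 gA' fA')) sub0r.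
have gNA' : gr T' 0 (- A') := grN gA'; have fNA' : fil T' 1 (- A') := filN fA'.
have eA : - A = @const_series K charK0 g g' (- A') by apply: const_seriesN.
have p_eval s : eval_at s p =
    exp_ad (sdegs s + 1) (- A' : T') (eval_at s G + eval_at s w).
  have := eval_adser (exp_coef K) s gNA' fNA' (grD gG gw).
  by rewrite -[@const_series _ _ _ _ _]eA.
have l_eval s : eval_at s l =
    exp_ad (sdegs s + 0) (- A' : T') (eval_at s L - eval_at s l0).
  have := eval_adser (exp_coef K) s gNA' fNA' (grB gL gl0).
  by rewrite -[@const_series _ _ _ _ _]eA.
have p_red : reduced p.
  move=> k; rewrite -[LHS]/(eval_at [::] p k) p_eval G_nil w_nil addNr.
  by rewrite (gmap0 (gmap_exp_ad _ gNA' fNA')).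
have l_red : reduced l.
  move=> k; rewrite -[LHS]/(eval_at [::] l k) l_eval L_nil l0_nil A'_ode subrr.
  by rewrite (gmap0 (gmap_exp_ad _ gNA' fNA')).
have gpC := reduced_gr gp p_red; have glC := reduced_gr gl l_red.
have fpC := reduced_fil gp p_red; have flC := reduced_fil gl l_red.
have plC := reduced_flow gp gl p_red l_red pl.
have A0 : (- A) 0%N = 0.
  by rewrite eA; apply: funext => -[|x s] //=; rewrite tserN A'0 oppr0.
have p0 : p 0%N = F.
  rewrite /p exp_adE (tser_fun0 _ (grN gA) (filN fA) (grD gG gw) A0).
  rewrite exp_coef0 scale1r tserD /w dexp_adE (tser_fun0 _ gA fA gdA); last first.
    by apply: oppr_inj; rewrite oppr0 -A0.
  have -> : dif TU 0 A 0%N = 0.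
    have -> : dif TU 0 A 0%N = dif U 0 (A 0%N) by [].
    have -> : A 0%N = 0 by apply: oppr_inj; rewrite oppr0 -A0.
    exact: (gmap0 (gmap_dif U 0)).
  by rewrite scaler0 addr0 /G /flow_series flow_coef0.
have p_start : @teval K C 1 p 0 = F by rewrite (teval0 gpC).
have p_end : @teval K C 1 p 1 = F'.
  have gpt := gmap_gr (gmap_teval charK0 C 1 1) gpC.
  apply: funext => -[|x s].
    rewrite (hom_reduced gpt) /F' /exp_conj /=; apply/esym.
    apply: (@gmap0 K g' g' _ _ _ (gmap_exp_ad _ _ _)).
      by apply: grN; apply: gsum_gr.
    by apply: filN; apply: (teval_fil 1 gA' fA').
  rewrite (reduced_teval 1 gp p_red) (eval_teval (x :: s) 1 gp) p_eval w_cons addr0.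
  have gGs : gr T' (sdegs (x :: s) + 1) (eval_at (x :: s) G).
    exact: (gmap_gr (gmap_eval charK0 g' 1 (x :: s)) gG).
  rewrite exp_adE teval_adser //.
  rewrite (gmapN (gmap_teval charK0 g' 0 1)) // /F' /exp_conj exp_adE.
  congr (adser _ _ _ _); rewrite (twist_flow charK0 a_gr a_fil hF wF) //; last first.
    by rewrite (mkhel_Hel (gauge_act_gr a 0)); apply: hel_eq.
  by rewrite /teval; apply: eq_gsum => n; rewrite expr1n scale1r.
have F_mc : @maurer_cartan K C F.
  split=> //; first by have := fpC 0%N; rewrite p0.
have F'_mc : @maurer_cartan K C F'.
  by rewrite -p_end; apply: (flow_mc_end 1 gpC fpC glC plC); rewrite p0.
have step : @homotopic_step K C F F'.
  split; [exact: F_mc | exact: F'_mc | exists p, l].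
  by split; [split; [exact: gpC | exact: fpC] | split; [exact: glC | exact: flC]
    | exact: plC | exact: p_start | exact: p_end].
split; last exact: (homotopic_gauge charK0 step).
by apply: Relation_Operators.t_step; exact: step.
Qed.
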